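(* Let $s\in(0,1)$ and let $\Omega\subset\mathbb{R}^n$ be an open and bounded set. Let $B$ be a ball with radius $r$ such that $2B\subset\Omega$. Let $\phi$ be an N-function with Simonenko indices $p$ and $q$, where $1\le p\le q<\infty$. If $u\in W^{s,\phi}(\mathbb{R}^n,\mathbb{R}^N)$ is a weak solution to $$\int_{\mathbb{R}^n}\int_{\mathbb{R}^n}\phi'\left(\frac{|u(x)-u(y)|}{|x-y|^s}\right)\frac{u(x)-u(y)}{|u(x)-u(y)|}\cdot\frac{\psi(x)-\psi(y)}{|x-y|^s}\,\frac{dx\,dy}{|x-y|^n}=0\qquad\text{for all }\psi\in W^{s,\phi}_c(\Omega,\mathbb{R}^N),$$ then $u\in L^\infty(B,\mathbb{R}^N)$ and $$\sup_B\phi(r^{-s}|u|)\le c\,\frac{1}{|2B|}\int_{2B}\phi(r^{-s}|u|)\,dx+c\,\phi\big(r^{-s}\,\mathrm{Tail}(u,B)\big),$$ where $c>0$ depends only on $q$, $s$ and $n$.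
   Context: An N-function is a function $\phi:[0,\infty)\to[0,\infty)$ that is convex, left-continuous, with $\phi(0)=0$, $\lim_{t\to0}\phi(t)/t=0$ and $\lim_{t\to\infty}\phi(t)/t=\infty$. $\phi'$ denotes its non-decreasing right-derivative, so $\phi(t)=\int_0^t\phi'(s)\,ds$. The lower and upper Simonenko indices of $\phi$ are $p=\inf_{t>0}\frac{\phi'(t)t}{\phi(t)}$ and $q=\sup_{t>0}\frac{\phi'(t)t}{\phi(t)}$. $L^\phi(\mathbb{R}^n,\mathbb{R}^N)$ is the set of $v\in L^1_{\mathrm{loc}}$ with $\int\phi(|v|/\lambda)\,dx<\infty$ for some $\lambda>0$. $W^{s,\phi}(\mathbb{R}^n,\mathbb{R}^N)$ is the set of $v\in L^\phi(\mathbb{R}^n,\mathbb{R}^N)$ with $\int_{\mathbb{R}^n}\int_{\mathbb{R}^n}\phi\big(\frac{|v(x)-v(y)|}{\lambda|x-y|^s}\big)\frac{dx\,dy}{|x-y|^n}<\infty$ for some $\lambda>0$. $W^{s,\phi}_c(\Omega,\mathbb{R}^N)$ is the set of functions in $W^{s,\phi}(\mathbb{R}^n,\mathbb{R}^N)$ with compact support contained in $\Omega$. For a ball $B$ with radius $r>0$ and center $x_B$, with $B^c=\mathbb{R}^n\setminus B$, the nonlocal tail is $$\mathrm{Tail}(u,B)=r^s(\phi')^{-1}\left(r^s\int_{B^c}\phi'\left(\frac{|u(y)|}{|y-x_B|^s}\right)\frac{dy}{|y-x_B|^{n+s}}\right),$$ where $(\phi')^{-1}$ is the inverse of $\phi'$,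 in general the right-continuous generalized inverse $(\phi')^{-1}(\tau)=\inf\{t\ge0:\phi'(t)>\tau\}$. The expression $\phi'(|a|)a/|a|$ is $0$ for $a=0$. $2B$ is the ball with the same center as $B$ and twice the radius; $|2B|$ is its Lebesgue measure. The supremum is the essential supremum. *)

(* Defs.v *)
From HB Require Import structures.
From mathcomp Require Import all_boot all_order all_algebra.
From mathcomp Require Import all_classical all_reals all_analysis.

Set Implicit Arguments.
Unset Strict Implicit.
Unset Printing Implicit Defensive.

Import Order.TTheory GRing.Theory Num.Theory.
Import numFieldNormedType.Exports.

Local Open Scope classical_set_scope.
Local Open Scope ring_scope.

(** * Lebesgue measure on R^n

    As for [n.-tuple], the sigma-algebra on row vectors is generated by the
    coordinates, which gives the Borel sigma-algebra of R^n.  An almost-everywhere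
    class of Lebesgue-measurable functions is represented by a Borel function,
    and the Lebesgue-null sets are those negligible for [lebesgue_rV]. *)

Definition rV_display : measure_display.
Proof. exact: default_measure_display. Qed.

Section rV_measurable.
Context {R : realType} {n : nat}.

Definition coord (i : 'I_n) (v : 'rV[R]_n) : measurableTypeR R := v ord0 i.

Let rV_set0 : g_sigma_preimage coord set0.
Proof. exact: sigma_algebra0. Qed.

Let rV_setC A : g_sigma_preimage coord A -> g_sigma_preimage coord (~` A).
Proof. exact: sigma_algebraC. Qed.

Let rV_bigcup (F : (set 'rV[R]_n)^nat) :
  (forall i, g_sigma_preimage coord (F i)) ->
  g_sigma_preimage coord (\bigcup_i (F i)).
Proof. exact: sigma_algebra_bigcup. Qed.

HB.instance Definition _ := @isMeasurable.Build rV_display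
  'rV[R]_n (g_sigma_preimage coord) rV_set0 rV_setC rV_bigcup.

End rV_measurable.

Lemma measurable_coord (R : realType) n (i : 'I_n) :
  measurable_fun [set: 'rV[R]_n] (coord i).
Proof.
move=> _ Y mY; rewrite setTI; apply: sub_sigma_algebra => /=.
rewrite -bigcup_seq/=; exists i => /=; first by rewrite mem_index_enum.
by exists Y => //; rewrite setTI.
Qed.

Lemma measurable_rVP (R : realType) d (T : measurableType d) n
    (f : T -> 'rV[R]_n) :
  (forall i, measurable_fun [set: T] (coord i \o f)) ->
  measurable_fun [set: T] f.
Proof.
move=> mf _ A mA; rewrite setTI.
suff : g_sigma_preimage (fun i => coord i \o f) `<=` measurable.
  rewrite (g_sigma_preimage_comp coord f); apply.
  by exists A => //; rewrite setTI.
apply: smallest_sub; first exact: sigma_algebra_measurable.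
case: n => [|n] in f mf A mA *; first by rewrite big_ord0.
rewrite -bigcup_mkord_ord; apply: bigcup_sub => i Ii.
by move=> B [C mC <-]; exact: mf.
Qed.

Definition consrV (R : realType) n (p : measurableTypeR R * 'rV[R]_n) :
  'rV[R]_n.+1 := row_mx (p.1 : R)%:M p.2.

Lemma consrV0 (R : realType) n (p : measurableTypeR R * 'rV[R]_n) :
  consrV p ord0 ord0 = p.1.
Proof.
rewrite /consrV [LHS]mxE; case: split_ordP => j jE; first by rewrite mxE (ord1 j) eqxx.
by move/(congr1 val): jE.
Qed.

Lemma consrVS (R : realType) n (p : measurableTypeR R * 'rV[R]_n) i :
  consrV p ord0 (lift ord0 i) = p.2 ord0 i.
Proof.
rewrite /consrV [LHS]mxE; case: split_ordP => j jE.
  by move/(congr1 val): jE; rewrite /= (ord1 j).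
by congr (p.2 _ _); apply: val_inj; move/(congr1 val): jE => /= -[].
Qed.

Lemma measurable_consrV (R : realType) n :
  measurable_fun setT (@consrV R n).
Proof.
apply: measurable_rVP => i.
have [j ->|->] := unliftP ord0 i.
  rewrite [X in measurable_fun _ X](_ : _ = coord j \o snd); last first.
    by apply/funext => p; rewrite /= /coord consrVS.
  by apply: measurableT_comp; [exact: measurable_coord|exact: measurable_snd].
rewrite [X in measurable_fun _ X](_ : _ = fst); first exact: measurable_fst.
by apply/funext => p; rewrite /= /coord consrV0.
Qed.

Fixpoint lebesgue_rV (R : realType) n : set 'rV[R]_n -> \bar R :=
  if n is m.+1 then
    pushforward (lebesgue_measure \x^ @lebesgue_rV R m)%E (@consrV R m)
  else \d_(0 : 'rV[R]_0).

Arguments lebesgue_rV {R n}.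

Lemma lebesgue_rV_measure (R : realType) n :
  exists mu : {measure set 'rV[R]_n -> \bar R}, lebesgue_rV = mu.
Proof.
elim: n => [|n [mu muE]] /=; first by exists (\d_(0 : 'rV[R]_0)).
pose m := [the measure _ _ of (lebesgue_measure \x^ mu)%E].
unshelve eexists.
  exact: (measure_function_pushforward__canonical__measure_function_Measure
    m (@measurable_consrV R n)).
by rewrite /lebesgue_rV -/lebesgue_rV muE.
Qed.

Section lebesgue_rV_instances.
Context {R : realType} {n : nat}.
Local Open Scope ereal_scope.

Let lebesgue_rV0 : @lebesgue_rV R n set0 = 0.
Proof. by have [mu ->] := lebesgue_rV_measure R n; rewrite measure0. Qed.

Let lebesgue_rV_ge0 (A : set 'rV[R]_n) : 0 <= lebesgue_rV A.
Proof. by have [mu ->] := lebesgue_rV_measure R n; exact: measure_ge0. Qed.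

Let lebesgue_rV_sigma_additive : semi_sigma_additive (@lebesgue_rV R n).
Proof.
have [mu ->] := lebesgue_rV_measure R n.
exact: measure_semi_sigma_additive.
Qed.

HB.instance Definition _ := isMeasure.Build _ _ _ (@lebesgue_rV R n)
  lebesgue_rV0 lebesgue_rV_ge0 lebesgue_rV_sigma_additive.

End lebesgue_rV_instances.

Lemma measurable_box (R : realType) n (A : 'I_n -> set (measurableTypeR R)) :
  (forall i, measurable (A i)) ->
  measurable [set v : 'rV[R]_n | forall i, A i (v ord0 i)].
Proof.
move=> mA.
rewrite [X in measurable X](_ : _ =
    \bigcap_(i in [set: 'I_n]) (coord i @^-1` A i)); last first.
  by apply/seteqP; split => [v Av i _|v Av i]; exact: Av.
apply: fin_bigcap_measurable => // i _.
by rewrite -[X in measurable X]setTI; exact: measurable_coord.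
Qed.

Lemma lebesgue_rV_box (R : realType) n (A : 'I_n -> set (measurableTypeR R)) :
  (forall i, measurable (A i)) ->
  lebesgue_rV [set v : 'rV[R]_n | forall i, A i (v ord0 i)] =
  (\prod_(i < n) lebesgue_measure (A i))%E.
Proof.
elim: n A => [|n IH] A mA.
  by rewrite big_ord0 /= diracE mem_set// => -[].
rewrite big_ord_recl -IH; last by move=> i; exact: mA.
rewrite [LHS]/= /pushforward [X in (_ \x^ _)%E X](_ : _ = A ord0 `*`
  [set v : 'rV[R]_n | forall i, A (lift ord0 i) (v ord0 i)]); last first.
  apply/seteqP; split => [[x v] /= Axv|[x v] /= [Ax Av] i].
    split => [|i]; first by have := Axv ord0; rewrite consrV0.
    by have := Axv (lift ord0 i); rewrite consrVS.
  by have [j ->|->] := unliftP ord0 i; rewrite ?consrVS ?consrV0.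
exact: (product_measure2E lebesgue_measure lebesgue_rV (mA ord0)
  (measurable_box (fun i => mA (lift ord0 i)))).
Qed.

Lemma lebesgue_rV_sigma_finite (R : realType) n :
  sigma_finite setT (@lebesgue_rV R n).
Proof.
pose I (k : nat) : set (measurableTypeR R) := `[- k%:R, k%:R]%classic.
exists (fun k => [set v : 'rV[R]_n | forall i, I k (v ord0 i)]).
  apply/esym/seteqP; split => // v _.
  exists (\max_(i < n) (Num.truncn `|v ord0 i|).+1)%N => // i.
  rewrite /I/= in_itv/= -ler_norml (le_trans (ltW (truncnS_gt _)))// ler_nat.
  exact: (leq_bigmax i).
move=> k; have mI : measurable (I k) by exact: measurable_itv.
split; first exact: (measurable_box (A := fun=> I k)).
rewrite (lebesgue_rV_box (A := fun=> I k))//.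
rewrite (eq_bigr (fun=> (fine (lebesgue_measure (I k)))%:E)) => [|i _].
  by rewrite prodEFin ltry.
by rewrite fineK// lebesgue_measure_itv/=; case: ifP.
Qed.

HB.instance Definition _ (R : realType) n :=
  Measure_isSigmaFinite.Build _ _ _ (@lebesgue_rV R n)
    (@lebesgue_rV_sigma_finite R n).

(** * Euclidean structure

    The library's norm on matrices is the sup norm; it is used here only
    through the topology and [bounded_set], where the choice is immaterial. *)

Section euclidean.
Context {R : realType} {n : nat}.
Implicit Types u v : 'rV[R]_n.

Definition dotrV u v : R := \sum_(i < n) u ord0 i * v ord0 i.

Definition enorm v : R := Num.sqrt (dotrV v v).

Definition eball (x : 'rV[R]_n) (r : R) : set 'rV[R]_n :=
  [set y | enorm (y - x) < r].

End euclidean.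

Section essential.
Context {R : realType} {n : nat}.
Local Open Scope ereal_scope.

(** [ess_sup] of the measure restricted to [D]. *)
Definition ess_sup_on (D : set 'rV[R]_n) (f : 'rV[R]_n -> \bar R) : \bar R :=
  ereal_inf [set y | \forall x \ae lebesgue_rV, D x -> f x <= y].

(** Support of an almost-everywhere class: the complement of the largest open
    set on which [v] vanishes almost everywhere. *)
Definition ess_support N (v : 'rV[R]_n -> 'rV[R]_N) : set 'rV[R]_n :=
  [set x | forall U : set 'rV[R]_n, open U -> U x ->
     ~ \forall y \ae lebesgue_rV, U y -> v y = 0%R].

Definition L1loc N (v : 'rV[R]_n -> 'rV[R]_N) : Prop :=
  measurable_fun setT v /\
  forall K : set 'rV[R]_n, compact K ->
    \int[lebesgue_rV]_(x in K) (enorm (v x))%:E < +oo.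

Definition Linfty N (D : set 'rV[R]_n) (v : 'rV[R]_n -> 'rV[R]_N) : Prop :=
  measurable_fun D v /\ ess_sup_on D (fun x => (enorm (v x))%:E) < +oo.

End essential.

(** * N-functions

    A function on [0, +oo[ is represented by a function on R, of which only the
    values at nonnegative arguments matter. *)

Section n_function.
Context {R : realType}.
Implicit Types phi f : R -> R.

Record N_function phi : Prop := {
  N_function_ge0 : forall t, 0 <= t -> 0 <= phi t ;
  N_function_convex : convex_function (`[0, +oo[%classic : set R^o) phi ;
  N_function_left_continuous :
    forall t, 0 < t -> phi x @[x --> t^'-] --> phi t ;
  N_function0 : phi 0 = 0 ;
  N_function_cvg0 : phi t / t @[t --> 0^'+] --> 0 ;
  N_function_cvgy : phi t / t @[t --> +oo] --> +oo }.

Definition rderiv phi (t : R) : R :=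
  lim (h^-1 * (phi (t + h) - phi t) @[h --> 0^'+]).

(** If [phi] vanishes at some [t > 0], then [0 / 0 = 0] makes the lower index
    [0], and the upper index is [+oo]. *)
Definition simonenko_lower phi : \bar R :=
  ereal_inf [set (rderiv phi t * t / phi t)%:E | t in [set t | 0 < t]].

Definition simonenko_upper phi : \bar R :=
  ereal_sup [set (rderiv phi t * t / phi t)%:E | t in [set t | 0 < t]].

(** The right-continuous generalized inverse of [f] on [0, +oo[, with value
    [+oo] at [+oo]. *)
Definition ginv f (tau : \bar R) : \bar R :=
  ereal_inf [set t%:E | t in [set t | 0 <= t /\ (tau < (f t)%:E)%E]].

(** Extension of [phi] to [[0, +oo]], by its limit [+oo] at [+oo]. *)
Definition ephi phi (x : \bar R) : \bar R :=
  if x is t%:E then (phi t)%:E else +oo%E.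

End n_function.

(** * Fractional Orlicz-Sobolev spaces, tails and weak solutions *)

Section orlicz.
Context {R : realType} {n N : nat}.
Implicit Types (phi : R -> R) (s : R) (u v : 'rV[R]_n -> 'rV[R]_N).
Local Open Scope ereal_scope.

Definition Lphi phi v : Prop :=
  L1loc v /\ exists lambda : R, (0 < lambda)%R /\
    \int[lebesgue_rV]_x (phi (enorm (v x) / lambda))%:E < +oo.

Definition Wsphi s phi v : Prop :=
  Lphi phi v /\ exists lambda : R, (0 < lambda)%R /\
    \int[lebesgue_rV]_x \int[lebesgue_rV]_y
      (phi (enorm (v x - v y) / (lambda * enorm (x - y) `^ s))
         / enorm (x - y) ^+ n)%:E < +oo.

Definition Wsphi_c s phi (Omega : set 'rV[R]_n) v : Prop :=
  [/\ Wsphi s phi v, compact (ess_support v) & ess_support v `<=` Omega].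

(** Where [u x = u y] the inner product vanishes, hence so does the integrand. *)
Definition weak_solution s phi (Omega : set 'rV[R]_n) u : Prop :=
  forall psi : 'rV[R]_n -> 'rV[R]_N, Wsphi_c s phi Omega psi ->
    \int[lebesgue_rV]_x \int[lebesgue_rV]_y
      (rderiv phi (enorm (u x - u y) / enorm (x - y) `^ s)
         * (dotrV (u x - u y) (psi x - psi y) / enorm (u x - u y))
         / enorm (x - y) `^ s / enorm (x - y) ^+ n)%:E = 0.

Definition tail s phi u (xB : 'rV[R]_n) (r : R) : \bar R :=
  (r `^ s)%:E * ginv (rderiv phi)
    ((r `^ s)%:E * \int[lebesgue_rV]_(y in ~` eball xB r)
      (rderiv phi (enorm (u y) / enorm (y - xB) `^ s)
         / enorm (y - xB) `^ (n%:R + s))%:E).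

End orlicz.

(* Main.v *)
Require Import Defs.
From mathcomp Require Import all_boot all_order all_algebra.
From mathcomp Require Import all_classical all_reals all_analysis.
From mathcomp Require Import measurable_realfun.
From mathcomp Require Import ring lra.
Import Order.TTheory GRing.Theory Num.Theory.
Import numFieldNormedType.Exports.
Local Open Scope classical_set_scope.
Local Open Scope ring_scope.

Set Implicit Arguments.
Unset Strict Implicit.
Unset Printing Implicit Defensive.

(** The proof is a De Giorgi iteration on the super-level sets
    [A(rho, k) = {x in B_rho : |u x| > k}], whose energy is the integral of
    [phi(r^-s |u|)] over them.  It tests the equation with [g u], where
    [g = eta^M (|u| - k)_+ / |u|], [eta] is a cut-off and [M] is an exponent,
    depending on [q] only, with [phi(2t) <= 2^M phi(t)].

    The inner product in the equation is
    [(g x + g y)/2 |u x - u y|^2 + (g x - g y)/2 (|u x|^2 - |u y|^2)]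
    ([dotrV_weightedE]).  Since [(|u| - k)_+ / |u|] increases with [|u|], its
    second term is negative only because of the variation of [eta], and there
    it is absorbed by the first term up to [phi(|eta x - eta y| |u| / |x-y|^s)]
    ([flux_opposed]); the power [M] of [eta] pays for this absorption.
    Integrating the error against [|x-y|^-n] gives a multiple of the energy,
    because its dependence on [x-y] is dominated by a kernel of bounded mass
    ([phi_cutoff_kern], [integral_kern_le]).  When one of the points is far away
    the error is controlled by the tail ([flux_outside], [far_kernel]), which is
    absorbed by the energy as soon as [k] exceeds the tail ([superlevel_tail]).

    The gain comes from the singularity of the kernel.  Let [r1 < r2] and
    [k1 < k2].  If [A(r2, k1)] has at most half the measure of a cube inscribed
    in the ball of radius [rho], a point [x] of the smaller set [A(r1, k2)]
    sees, within distance [rho], a set of measure comparable to [rho^n] where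
    [g] vanishes and [|u x - u y|] is comparable to [|u x|].  The singular kernel
    then yields at least [(r/rho)^s phi(r^-s |u x|)], because
    [phi(l t) >= l phi(t)] for [l >= 1] ([energy_lower]).  Hence the energy of
    the smaller set is at most [C (rho/r)^s] times that of the larger one, up to
    a power of [1/de], where [de] measures the relative gaps between the radii
    and between the levels ([energy_decay]).

    By Chebyshev's inequality the measure of a super-level set is at most its
    energy divided by [phi] at the level, so that a geometrically decreasing
    sequence of radii [rho] is admissible at every step, provided the initial
    energy is small compared with [r^n phi(kap)].  The measures then tend to
    zero and [|u| <= 2 kap r^s] almost everywhere on [B] ([superlevel_null]).
    Choosing [kap] up to a constant factor minimal among the levels that exceed
    the tail and make the initial energy small gives the estimate
    ([growth_level]). *)

(** * Calculus of N-functions *)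

Section n_function_calculus.
Context {R : realType} (phi : R -> R).
Hypothesis Nphi : N_function phi.
Local Notation f := (rderiv phi).

Lemma N_function_conv (t x y : R) : 0 <= t -> t <= 1 -> 0 <= x -> 0 <= y ->
  phi (t * x + (1 - t) * y) <= t * phi x + (1 - t) * phi y.
Proof.
move=> t0 t1 x0 y0.
have := N_function_convex Nphi (Itv01 t0 t1).
move=> /(_ x y); apply; rewrite inE/= in_itv/= andbT//.
Qed.

Lemma N_function_chord (x y z : R) : 0 <= x -> x < y -> y < z ->
  (phi y - phi x) * (z - x) <= (phi z - phi x) * (y - x).
Proof.
move=> x0 xy yz.
have zx : 0 < z - x by lra.
have := @N_function_conv ((z - y) / (z - x)) x z.
have -> : 1 - (z - y) / (z - x) = (y - x) / (z - x) by field; lra.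
have -> : (z - y) / (z - x) * x + (y - x) / (z - x) * z = y by field; lra.
have -> : (z - y) / (z - x) * phi x + (y - x) / (z - x) * phi z =
  ((z - y) * phi x + (y - x) * phi z) / (z - x) by field; lra.
move=> H; have {H} := H (divr_ge0 _ _) _ x0 _.
rewrite ler_pdivrMr// ler_pdivlMr// => H.
have {}H : phi y * (z - x) <= (z - y) * phi x + (y - x) * phi z.
  by apply: H; lra.
by nra.
Qed.

Let slope (t h : R) := h^-1 * (phi (t + h) - phi t).

Let slope_mono t : 0 <= t ->
  {in `]0, +oo[ &, {homo slope t : h k / h <= k}}.
Proof.
move=> t0 h k; rewrite !in_itv/= !andbT => h0 k0.
rewrite le_eqVlt => /predU1P[->//|hk].
have := @N_function_chord t (t + h) (t + k) t0.
have -> : t + h - t = h by ring.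
have -> : t + k - t = k by ring.
move=> H; rewrite /slope ler_pdivrMl// mulrCA ler_pdivlMl//.
by rewrite [X in X <= _]mulrC [X in _ <= X]mulrC; apply: H; lra.
Qed.

Let slope_lb t : 0 <= t -> has_lbound (slope t @` `]0, +oo[).
Proof.
move=> t0.
have [->|tn0] := eqVneq t 0.
  exists 0; move=> y [h /=]; rewrite in_itv/= andbT => h0 <-.
  rewrite /slope add0r (N_function0 Nphi) subr0 mulr_ge0 ?invr_ge0 ?(ltW h0)//.
  by apply: (N_function_ge0 Nphi); rewrite ltW.
have {tn0}t0 : 0 < t by rewrite lt_neqAle eq_sym tn0.
exists (t^-1 * phi t); move=> y [h /=]; rewrite in_itv/= andbT => h0 <-.
rewrite /slope ler_pdivrMl// mulrCA ler_pdivlMl//.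
have := @N_function_chord 0 t (t + h); rewrite !subr0 (N_function0 Nphi) !subr0.
by move=> H; have := H (lexx _) t0 ltac:(lra); lra.
Qed.

(** The difference quotients of a convex function increase with the step, so
    that their limit is an infimum. *)
Lemma rderivE t : 0 <= t -> f t = inf (slope t @` `]0, +oo[).
Proof.
move=> t0; apply/cvg_lim => //.
exact: (@nondecreasing_at_right_cvgr R (slope t) 0 +oo%O _
  (slope_mono t0) (slope_lb t0)).
Qed.

(** To the right of [t] the infimum is below the quotient; to the left, the
    chord from [x] to [t] is a lower bound of all the quotients. *)
Lemma rderiv_subgradient t x : 0 <= t -> 0 <= x ->
  phi t + f t * (x - t) <= phi x.
Proof.
move=> t0 x0; have [tx|xt|->] := ltgtP t x; last by rewrite subrr; lra.
  have h0 : 0 < x - t by lra.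
  suff : f t <= (x - t)^-1 * (phi x - phi t).
    by rewrite ler_pdivlMl// => ?; lra.
  rewrite rderivE//; apply: ge_inf; first exact: slope_lb.
  exists (x - t); first by rewrite /= in_itv/= h0.
  by rewrite /slope; congr (_ * (phi _ - _)); ring.
have h0 : 0 < t - x by lra.
suff : (t - x)^-1 * (phi t - phi x) <= f t.
  by rewrite ler_pdivrMl// => ?; lra.
rewrite rderivE//; apply: lb_le_inf.
  by exists (slope t 1), 1; rewrite //= in_itv/= ltr01.
move=> y [h /=]; rewrite in_itv/= andbT => k0 <-.
rewrite /slope ler_pdivrMl// mulrCA ler_pdivlMl//.
have := @N_function_chord x t (t + h) x0 xt ltac:(lra).
by nra.
Qed.

Lemma rderiv_mono t u : 0 <= t -> t <= u -> f t <= f u.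
Proof.
move=> t0; rewrite le_eqVlt => /predU1P[->//|tu].
have := @rderiv_subgradient t u t0 ltac:(lra).
have := @rderiv_subgradient u t ltac:(lra) t0.
by nra.
Qed.

Lemma rderiv0 : f 0 = 0.
Proof.
rewrite /rderiv; apply/cvg_lim => //.
rewrite [X in X @ _](_ : _ = fun t => phi t / t); first exact: N_function_cvg0.
by apply/funext => h; rewrite add0r (N_function0 Nphi) subr0 mulrC.
Qed.

Lemma rderiv_ge0 t : 0 <= t -> 0 <= f t.
Proof. by move=> t0; rewrite -rderiv0 rderiv_mono. Qed.

Lemma N_function_le_rderiv t : 0 <= t -> phi t <= f t * t.
Proof.
move=> t0; have := @rderiv_subgradient t 0 t0 (lexx _).
by rewrite (N_function0 Nphi); lra.
Qed.

Lemma N_function_mono t u : 0 <= t -> t <= u -> phi t <= phi u.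
Proof.
move=> t0 tu; have := @rderiv_subgradient t u t0 ltac:(lra).
have := rderiv_ge0 t0; nra.
Qed.

Lemma N_function_sublinear l t : 0 <= l -> l <= 1 -> 0 <= t ->
  phi (l * t) <= l * phi t.
Proof.
move=> l0 l1 t0; have := @N_function_conv l t 0 l0 l1 t0 (lexx _).
by rewrite mulr0 addr0 (N_function0 Nphi) mulr0 addr0.
Qed.

Lemma N_function_unbounded X : exists2 t, 0 < t & X <= phi t.
Proof.
have /cvgryPge/(_ (Num.max X 0)) := N_function_cvgy Nphi.
move=> H; near +oo_R => t.
have t1 : 1 <= t by near: t; exact: nbhs_pinfty_ge.
exists t; first lra.
have : Num.max X 0 <= phi t / t by near: t.
rewrite ler_pdivlMr; last lra.
have X0 : 0 <= Num.max X 0 by rewrite le_max lexx orbT.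
have XX : X <= Num.max X 0 by rewrite le_max lexx.
by nra.
Unshelve. all: by end_near. Qed.

End n_function_calculus.


(** What the estimates use of [phi] and of its right derivative [f].  The upper
    index [q] acts through [f t * t <= q * phi t] and through the doubling
    exponent [M], which is natural so that it also serves as a power of the
    cut-off. *)
Record growth {R : realType} (phi f : R -> R) (q : R) (M : nat) : Prop := {
  growth_q1 : 1 <= q ;
  growth_M0 : (0 < M)%N ;
  growth_phi0 : phi 0 = 0 ;
  growth_mono : forall t u, 0 <= t -> t <= u -> phi t <= phi u ;
  growth_sublinear : forall l t, 0 <= l -> l <= 1 -> 0 <= t ->
    phi (l * t) <= l * phi t ;
  growth_double : forall t, 0 <= t -> phi (2 * t) <= 2 ^+ M * phi t ;
  growth_f0 : f 0 = 0 ;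
  growth_fmono : forall t u, 0 <= t -> t <= u -> f t <= f u ;
  growth_le_f : forall t, 0 <= t -> phi t <= f t * t ;
  growth_f_le : forall t, 0 <= t -> f t * t <= q * phi t }.

Section growth_theory.
Context {R : realType} {phi f : R -> R} {q : R} {M : nat}.
Hypothesis G : growth phi f q M.

Lemma growth_ge0 t : 0 <= t -> 0 <= phi t.
Proof. by move=> t0; rewrite -(growth_phi0 G); apply: (growth_mono G). Qed.

Lemma growth_f_ge0 t : 0 <= t -> 0 <= f t.
Proof. by move=> t0; rewrite -(growth_f0 G); apply: (growth_fmono G). Qed.

Lemma growth_dilate l t : 1 <= l -> 0 <= t -> phi (l * t) <= (2 * l) ^+ M * phi t.
Proof.
move=> l1 t0.
have [k lk] : exists k : nat, l <= 2 ^+ k.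
  exists (Num.truncn l).+1; rewrite (le_trans (ltW (truncnS_gt _)))//.
  by rewrite -natrX ler_nat ltnW// ltn_expl.
elim: k => [|k IH] in l l1 lk *.
  rewrite expr0 in lk; have -> : l = 1 by apply/eqP; rewrite eq_le lk.
  rewrite mul1r mulr1 ler_peMl ?growth_ge0//.
  by rewrite exprn_ege1//; lra.
have [l2|l2] := leP l 2.
  apply: (@le_trans _ _ (phi (2 * t))); last first.
    apply: (le_trans (growth_double G t0)).
    rewrite ler_wpM2r ?growth_ge0// lerXn2r// ?nnegrE; lra.
  by apply: (growth_mono G); [rewrite mulr_ge0//; lra|rewrite ler_wpM2r].
have -> : l * t = 2 * (l / 2 * t) by field.
apply: (le_trans (growth_double G _)); first by rewrite mulr_ge0//; lra.
have -> : 2 * l = 2 * (2 * (l / 2)) by field.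
rewrite [X in X * phi t]exprMn -[X in _ <= X]mulrA ler_wpM2l ?exprn_ge0//.
by apply: IH; rewrite ?ler_pdivrMr// -?exprSr//; lra.
Qed.

Lemma growth_f_dilate l t : 1 <= l -> 0 <= t ->
  f (l * t) <= q * (2 * l) ^+ M * f t.
Proof.
move=> l1; rewrite le_eqVlt => /predU1P[<-|t0].
  by rewrite mulr0 (growth_f0 G) mulr0.
have lt0 : 0 <= l * t by rewrite mulr_ge0; lra.
have q1 := growth_q1 G.
rewrite -(ler_pM2r t0).
apply: (@le_trans _ _ (f (l * t) * (l * t))).
  rewrite ler_wpM2l ?growth_f_ge0// ler_peMl//; lra.
rewrite (le_trans (growth_f_le G lt0))// -!mulrA ler_wpM2l//; first lra.
rewrite (le_trans (growth_dilate l1 (ltW t0)))// ler_wpM2l ?exprn_ge0//.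
- by lra.
- by apply: (growth_le_f G); lra.
Qed.

Lemma growth_superlinear l t : 1 <= l -> 0 <= t -> l * phi t <= phi (l * t).
Proof.
move=> l1 t0; have l0 : 0 < l by lra.
have := growth_sublinear G (l := l^-1) (t := l * t).
rewrite mulKf ?gt_eqF// ler_pdivlMl// => ->//.
- by rewrite invr_ge0; lra.
- by rewrite invf_le1.
- by rewrite mulr_ge0//; lra.
Qed.

Lemma growth_add a b : 0 <= a -> 0 <= b ->
  phi (a + b) <= 2 ^+ M * (phi a + phi b).
Proof.
wlog : a b / a <= b.
  move=> H a0 b0; have [ab|/ltW ba] := leP a b; first exact: H.
  by rewrite addrC [X in _ * X]addrC; exact: H.
move=> ab a0 b0; apply: (@le_trans _ _ (phi (2 * b))).
  by apply: (growth_mono G); lra.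
rewrite (le_trans (growth_double G b0))// ler_wpM2l ?exprn_ge0//.
by rewrite lerDr growth_ge0.
Qed.

End growth_theory.

(** The subgradient inequality between [t] and [th * t], with
    [th = 1 - 1/(2q)], loses at most [1/(2q) * (q * phi t)], half of [phi t]; as
    many steps as it takes to halve the argument give the doubling, with an
    exponent that does not depend on [phi]. *)
Lemma N_function_growth {R : realType} (q : R) : 1 <= q ->
  exists M : nat, forall (phi : R -> R) (p : R), N_function phi ->
    simonenko_lower phi = p%:E -> simonenko_upper phi = q%:E -> 1 <= p ->
    growth phi (rderiv phi) q M /\ forall t, 0 < t -> 0 < phi t.
Proof.
move=> q1; pose th : R := 1 - (2 * q)^-1.
have q2 : 0 < (2 * q)^-1 by rewrite invr_gt0; lra.
have q2' : (2 * q)^-1 <= 2^-1 by rewrite lef_pV2// ?posrE; lra.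
have [M [M0 thM]] : exists M, (0 < M)%N /\ th ^+ M <= 2^-1.
  have : (fun k => th ^+ k) @ \oo --> 0.
    by apply: cvg_expr; rewrite ger0_norm /th; lra.
  move=> /cvgr_le/(_ 2^-1) => /(_ ltac:(lra)) [k _ kP].
  by exists k.+1; split=> //; apply: kP => /=; rewrite leqnSn.
exists M => phi p Nphi lo up p1.
have lo1 t : 0 < t -> 1 <= rderiv phi t * t / phi t.
  move=> t0; rewrite -lee_fin (@le_trans _ _ p%:E)// -lo.
  by apply: ereal_inf_lbound; exists t.
have upq t : 0 < t -> rderiv phi t * t / phi t <= q.
  by move=> t0; rewrite -lee_fin -up; apply: ereal_sup_ubound; exists t.
have phi_gt0 t : 0 < t -> 0 < phi t.
  move=> t0; rewrite lt_neqAle (N_function_ge0 Nphi) ?(ltW t0)// andbT eq_sym.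
  by apply/eqP => p0; have := lo1 _ t0; rewrite p0 invr0 mulr0; lra.
have fq t : 0 <= t -> rderiv phi t * t <= q * phi t.
  rewrite le_eqVlt => /predU1P[<-|t0].
    by rewrite mulr0 (N_function0 Nphi) mulr0.
  by have := upq _ t0; rewrite ler_pdivrMr// phi_gt0.
split=> //; split=> //.
- exact: N_function0.
- by move=> t u; exact: N_function_mono.
- by move=> l t; exact: N_function_sublinear.
- have half t : 0 <= t -> phi t <= 2 * phi (th * t).
    move=> t0; have tht : 0 <= th * t by rewrite mulr_ge0//; rewrite /th; lra.
    have := @rderiv_subgradient _ _ Nphi t (th * t) t0 tht.
    have -> : th * t - t = - (2 * q)^-1 * t by rewrite /th; ring.
    have : rderiv phi t * ((2 * q)^-1 * t) <= 2^-1 * phi t.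
      have -> : rderiv phi t * ((2 * q)^-1 * t) = (rderiv phi t * t) * (2 * q)^-1.
        by ring.
      have -> : 2^-1 * phi t = (q * phi t) * (2 * q)^-1 by field; lra.
      by rewrite ler_wpM2r ?fq// ltW.
    by lra.
  have iter k t : 0 <= t -> phi t <= 2 ^+ k * phi (th ^+ k * t).
    move=> t0; elim: k => [|k IH]; first by rewrite !expr0 !mul1r.
    rewrite (le_trans IH)// exprSr -mulrA ler_wpM2l ?exprn_ge0//.
    rewrite exprS -mulrA half// mulr_ge0// exprn_ge0// /th; lra.
  move=> t t0; rewrite (le_trans (iter M _ _))//; first lra.
  rewrite ler_wpM2l ?exprn_ge0//; apply: N_function_mono => //.
    by rewrite !mulr_ge0// exprn_ge0// /th; lra.
  by nra.
- exact: rderiv0.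
- by move=> t u; exact: rderiv_mono.
- by move=> t; exact: N_function_le_rderiv.
Qed.


(** * Euclidean norm and Lebesgue measure of balls *)

Section euclid.
Context {R : realType} {n : nat}.
Implicit Types u v w : 'rV[R]_n.

Lemma dotrVC u v : dotrV u v = dotrV v u.
Proof. by apply: eq_bigr => i _; rewrite mulrC. Qed.

Lemma dotrVDl u v w : dotrV (u + v) w = dotrV u w + dotrV v w.
Proof. by rewrite -big_split; apply: eq_bigr => i _; rewrite !mxE mulrDl. Qed.

Lemma dotrVZl a u v : dotrV (a *: u) v = a * dotrV u v.
Proof. by rewrite /dotrV mulr_sumr; apply: eq_bigr => i _; rewrite !mxE mulrA. Qed.

Lemma dotrVNl u v : dotrV (- u) v = - dotrV u v.
Proof. by rewrite -scaleN1r dotrVZl mulN1r. Qed.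

Lemma dotrVDr u v w : dotrV w (u + v) = dotrV w u + dotrV w v.
Proof. by rewrite !(dotrVC w) dotrVDl. Qed.

Lemma dotrVZr a u v : dotrV u (a *: v) = a * dotrV u v.
Proof. by rewrite !(dotrVC u) dotrVZl. Qed.

Lemma dotrVNr u v : dotrV u (- v) = - dotrV u v.
Proof. by rewrite !(dotrVC u) dotrVNl. Qed.

Lemma dotrV_ge0 v : 0 <= dotrV v v.
Proof. by apply: sumr_ge0 => i _; rewrite -expr2 sqr_ge0. Qed.

Lemma enorm_ge0 v : 0 <= enorm v.
Proof. exact: sqrtr_ge0. Qed.

Lemma enorm_sqr v : enorm v ^+ 2 = dotrV v v.
Proof. by rewrite sqr_sqrtr ?dotrV_ge0. Qed.

Lemma enormN v : enorm (- v) = enorm v.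
Proof. by rewrite /enorm dotrVNl dotrVNr opprK. Qed.

Lemma enormB u v : enorm (u - v) = enorm (v - u).
Proof. by rewrite -enormN opprB. Qed.

Lemma enormZ a v : enorm (a *: v) = `|a| * enorm v.
Proof.
rewrite /enorm dotrVZl dotrVZr mulrA -expr2 sqrtrM ?sqr_ge0//.
by rewrite sqrtr_sqr.
Qed.

Lemma enorm0 : enorm (0 : 'rV[R]_n) = 0.
Proof. by rewrite -(scale0r 0) enormZ normr0 mul0r. Qed.

Lemma coord_le_enorm v i : `|v ord0 i| <= enorm v.
Proof.
rewrite -sqrtr_sqr ler_wsqrtr// /dotrV (bigD1 i)//= expr2 lerDl.
by apply: sumr_ge0 => j _; rewrite -expr2 sqr_ge0.
Qed.

Lemma enorm_eq0 v : enorm v = 0 -> v = 0.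
Proof.
move=> v0; apply/rowP => i; rewrite mxE; apply/normr0_eq0/le_anti.
by rewrite normr_ge0 andbT -v0 coord_le_enorm.
Qed.

Lemma dotrV_le u v : dotrV u v <= enorm u * enorm v.
Proof.
have [u0|u0] := eqVneq (enorm u) 0.
  by rewrite u0 mul0r (enorm_eq0 u0) -(scale0r 0) dotrVZl mul0r.
have [v0|v0] := eqVneq (enorm v) 0.
  by rewrite v0 mulr0 (enorm_eq0 v0) -(scale0r 0) dotrVZr mul0r.
have uv0 : 0 < enorm u * enorm v.
  by rewrite mulr_gt0// lt_neqAle eq_sym ?u0 ?v0 enorm_ge0.
have := dotrV_ge0 (enorm v *: u - enorm u *: v).
rewrite !(dotrVDl, dotrVDr, dotrVNl, dotrVNr, dotrVZl, dotrVZr).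
rewrite -!enorm_sqr (dotrVC v u); set a := enorm u; set b := enorm v.
rewrite -/a -/b in uv0.
rewrite [X in 0 <= X](_ : _ = (a * b) * (a * b - dotrV u v) * 2); last by ring.
by rewrite pmulr_lge0// pmulr_rge0// subr_ge0.
Qed.

Lemma enormD u v : enorm (u + v) <= enorm u + enorm v.
Proof.
rewrite -(@ler_pXn2r _ 2)// ?nnegrE ?addr_ge0 ?enorm_ge0//.
rewrite enorm_sqr !(dotrVDl, dotrVDr) (dotrVC v u) -!enorm_sqr.
by have := dotrV_le u v; nra.
Qed.

Lemma enormB_le u v : enorm (u - v) <= enorm u + enorm v.
Proof. by apply: le_trans (enormD _ _) _; rewrite enormN. Qed.

Lemma enorm_sub_le u v : enorm u - enorm v <= enorm (u - v).
Proof. by rewrite lerBlDr; apply: le_trans (enormD _ _); rewrite subrK. Qed.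

Lemma enorm_le_sum v : enorm v <= \sum_i `|v ord0 i|.
Proof.
have S0 : 0 <= \sum_i `|v ord0 i| by apply: sumr_ge0.
rewrite -(@ler_pXn2r _ 2)// ?nnegrE ?enorm_ge0// enorm_sqr expr2 mulr_suml.
apply: ler_sum => i _; rewrite (le_trans (ler_norm _))// normrM ler_wpM2l//.
by rewrite (bigD1 i)//= lerDl sumr_ge0.
Qed.

End euclid.

Section measurability.
Context {R : realType} {n : nat}.

Lemma measurable_enorm_comp d (T : measurableType d) (f : T -> 'rV[R]_n) :
  measurable_fun setT f -> measurable_fun setT (fun x => enorm (f x)).
Proof.
move=> mf.
have ms := @nondecreasing_measurable R setT _ measurableT (@ler_wsqrtr R).
apply: (measurableT_comp ms); apply: measurable_sum => i.
have mi : measurable_fun setT (Defs.coord i \o f).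
  by apply: measurableT_comp => //; exact: measurable_coord.
exact: measurable_funM.
Qed.

Lemma measurable_rVB d (T : measurableType d) (f g : T -> 'rV[R]_n) :
  measurable_fun setT f -> measurable_fun setT g ->
  measurable_fun setT (fun x => f x - g x).
Proof.
move=> mf mg; apply: measurable_rVP => i.
rewrite [X in measurable_fun _ X](_ : _ =
    fun x => (Defs.coord i \o f) x - (Defs.coord i \o g) x).
  by apply: measurable_funB; apply: measurableT_comp => //; exact: measurable_coord.
by apply/funext => x; rewrite /= /Defs.coord !mxE.
Qed.

Lemma measurable_rVZ d (T : measurableType d) (f : T -> 'rV[R]_n) (g : T -> R) :
  measurable_fun setT f -> measurable_fun setT g ->
  measurable_fun setT (fun x => g x *: f x).
Proof.
move=> mf mg; apply: measurable_rVP => i.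
rewrite [X in measurable_fun _ X](_ : _ = fun x => g x * (Defs.coord i \o f) x).
  by apply: measurable_funM => //; apply: measurableT_comp => //; exact: measurable_coord.
by apply/funext => x; rewrite /= /Defs.coord !mxE.
Qed.

Lemma measurable_dotrV d (T : measurableType d) (f g : T -> 'rV[R]_n) :
  measurable_fun setT f -> measurable_fun setT g ->
  measurable_fun setT (fun x => dotrV (f x) (g x)).
Proof.
move=> mf mg; apply: measurable_sum => i.
by apply: measurable_funM; [apply: (measurableT_comp (measurable_coord i) mf)|
  apply: (measurableT_comp (measurable_coord i) mg)].
Qed.

Lemma measurable_eball (x : 'rV[R]_n) r : measurable (eball x r).
Proof.
have m : measurable_fun [set: 'rV[R]_n] (fun y : 'rV[R]_n => enorm (y - x)).
  by apply: measurable_enorm_comp; apply: measurable_rVB.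
have := m measurableT _ (measurable_itv `]-oo, r[); rewrite setTI.
rewrite [X in measurable X -> _](_ : _ = eball x r)//.
Qed.

Lemma measurable_funV d (T : measurableType d) (f : T -> R) :
  measurable_fun setT f -> measurable_fun setT (fun x => (f x)^-1).
Proof.
move=> mf.
(* Real powers are measurable, and those of a square need no sign condition;
   both sides vanish where [f] does. *)
rewrite [X in measurable_fun _ X](_ : _ = fun x => f x * (f x ^+ 2) `^ (-1)).
  apply: measurable_funM => //; apply: (measurableT_comp (f := @powR R ^~ (-1))).
    exact: measurable_powR.
  exact: measurable_funX.
apply/funext => x; rewrite powR_inv1 ?sqr_ge0//.
have [->|fx0] := eqVneq (f x) 0; first by rewrite mul0r invr0.
by rewrite expr2 invfM mulVKf.
Qed.

End measurability.

Section ball_measure.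
Context {R : realType} {n : nat}.
Implicit Types x : 'rV[R]_n.

Lemma lebesgue_rV_cube x (r : R) : 0 < r ->
  lebesgue_rV [set v : 'rV[R]_n |
    forall i, `]x ord0 i - r, x ord0 i + r[%classic (v ord0 i)]
  = ((2 * r) ^+ n)%:E.
Proof.
move=> r0.
rewrite (lebesgue_rV_box (A := fun i => `]x ord0 i - r, x ord0 i + r[%classic))//.
rewrite (eq_bigr (fun=> (2 * r)%:E)) => [|i _].
  by rewrite prodEFin; congr _%:E; rewrite prodr_const card_ord.
rewrite lebesgue_measure_itv/= lte_fin ifT; last by lra.
by rewrite -EFinB; congr _%:E; lra.
Qed.

Lemma measurable_cube x (r : R) : measurable
  [set v : 'rV[R]_n | forall i, `]x ord0 i - r, x ord0 i + r[%classic (v ord0 i)].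
Proof.
by apply: (measurable_box (A := fun i => `]x ord0 i - r, x ord0 i + r[%classic)).
Qed.

Lemma lebesgue_eball_le x (r : R) : 0 < r ->
  (lebesgue_rV (eball x r) <= ((2 * r) ^+ n)%:E)%E.
Proof.
move=> r0; rewrite -(lebesgue_rV_cube x r0); apply: le_measure.
- by rewrite inE; exact: measurable_eball.
- by rewrite inE; exact: measurable_cube.
move=> y /= yr i; have := coord_le_enorm (y - x) i; rewrite !mxE => H.
by have := le_lt_trans H yr; rewrite ltr_norml in_itv/= => /andP[? ?]; lra.
Qed.

Lemma lebesgue_eball_ge x (r : R) : (0 < n)%N -> 0 < r ->
  (((2 * r / n%:R) ^+ n)%:E <= lebesgue_rV (eball x r))%E.
Proof.
move=> n0 r0; have nR : 0 < n%:R :> R by rewrite ltr0n.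
have rn : 0 < r / n%:R by rewrite divr_gt0.
rewrite -mulrA -(lebesgue_rV_cube x rn); apply: le_measure.
- by rewrite inE; exact: measurable_cube.
- by rewrite inE; exact: measurable_eball.
set e := r / n%:R in rn *; move=> y /= yr; rewrite /eball/= (le_lt_trans (enorm_le_sum _))//.
apply: (@lt_le_trans _ _ (\sum_(i < n) e)); last first.
  by rewrite sumr_const card_ord -[X in X <= _]mulr_natr /e divfK ?gt_eqF.
rewrite -subr_gt0 -sumrB.
have {nR}[m nm] : exists m, n = m.+1 by case: (n) n0 => // m; exists m.
(* Each coordinate is below [r / n], and [n > 0] makes the sum strict. *)
move: e rn yr; rewrite {}nm in x y * => e e0 yr; rewrite big_ord_recl; apply: ltr_wpDr.
  apply: sumr_ge0 => i _; have := yr (lift ord0 i); rewrite in_itv/= => /andP[? ?].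
  by rewrite subr_ge0 !mxE ler_norml; apply/andP; split; lra.
have := yr ord0; rewrite in_itv/= => /andP[? ?].
by rewrite subr_gt0 !mxE ltr_norml; apply/andP; split; lra.
Qed.

End ball_measure.


(** * The two-sided kernel *)

Section integral_tools.
Context d (T : measurableType d) (R : realType).
Variable mu : {measure set T -> \bar R}.
Local Open Scope ereal_scope.
Import HBNNSimple.

(** The integral of a nonnegative function is a supremum over the simple
    functions below it, hence monotone without measurability. *)
Lemma ge0_le_integralW (D : set T) (f g : T -> \bar R) :
  (forall x, D x -> 0 <= f x) -> (forall x, D x -> f x <= g x) ->
  \int[mu]_(x in D) f x <= \int[mu]_(x in D) g x.
Proof.
move=> f0 fg; rewrite !ge0_integralE//; last first.
  by move=> x Dx; rewrite (le_trans (f0 _ Dx))// fg.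
apply: le_ereal_sup => _ [h /= hf <-]; exists h => // x.
rewrite (le_trans (hf x))//; apply: lee_restrict => //.
Qed.

Lemma ge0_integral_setS (A B : set T) (f : T -> \bar R) :
  A `<=` B -> (forall x, B x -> 0 <= f x) ->
  \int[mu]_(x in A) f x <= \int[mu]_(x in B) f x.
Proof.
move=> AB f0; rewrite integral_mkcond [leRHS]integral_mkcond.
apply: ge0_le_integralW => x _; rewrite !patchE.
  by case: ifPn => // /set_mem /AB; exact: f0.
case: ifPn => [/set_mem /AB/mem_set ->//|_].
by case: ifPn => // /set_mem; exact: f0.
Qed.

End integral_tools.

Section kernel.
Context {R : realType} {n : nat}.

(** The two-sided power weight [min(z/r, r/z)^beta] against [z^-n]: integrable
    near the origin and near infinity, uniformly in [r]. *)
Definition kern (beta r z : R) : R := Num.min (z / r) (r / z) `^ beta / z ^+ n.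

Lemma kern_ge0 beta r z : 0 <= z -> 0 <= kern beta r z.
Proof. by move=> z0; rewrite /kern divr_ge0 ?powR_ge0 ?exprn_ge0. Qed.

Let halfpow (m : R) : 0 < m -> m <= 1 ->
  exists i : nat, 2^-1 ^+ i.+1 < m /\ m <= 2^-1 ^+ i.
Proof.
move=> m0 m1.
have ex : exists k, 2^-1 ^+ k < m.
  have : (fun k => (2^-1 : R) ^+ k) @ \oo --> 0.
    by apply: cvg_expr; rewrite ger0_norm; lra.
  by move=> /cvgr_lt/(_ _ m0) [k _ kP]; exists k; apply: kP => /=.
case: (ex_minnP ex) => -[|k]; first by rewrite expr0 ltNge m1.
by move=> km kmin; exists k; split => //; rewrite leNgt; apply/negP => /kmin; rewrite ltnn.
Qed.

Lemma geometric_le (th : R) (K : R) N : 0 <= th -> th < 1 -> 0 <= K ->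
  \sum_(0 <= i < N) K * th ^+ i <= K / (1 - th).
Proof.
move=> t0 t1 K0; rewrite -mulr_sumr ler_wpM2l//.
have : (1 - th) * \sum_(0 <= i < N) th ^+ i = 1 - th ^+ N.
  by rewrite big_mkord -[RHS]opprB subrX1 -mulNr opprB.
move=> E; rewrite -(@ler_pM2l _ (1 - th)) ?subr_gt0// E mulfV ?gt_eqF ?subr_gt0//.
by rewrite gerBl exprn_ge0.
Qed.

(** Dyadic decomposition: where [min(z/r, r/z)] lies between [2^-(i+1)] and
    [2^-i], the point is in one of two annuli, of radii about [2^-i r] and
    [2^i r], on which [z^-n] is the inverse of the measure of the ball; the
    weight [2^-(i beta)] makes the series converge. *)
Lemma integral_kern_le (beta : R) : (0 < n)%N -> 0 < beta ->
  exists2 C, 0 < C & forall (r : R) (x : 'rV[R]_n), 0 < r ->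
    (\int[lebesgue_rV]_y (kern beta r (enorm (x - y)))%:E <= C%:E)%E.
Proof.
move=> n0 b0; pose th : R := (2^-1) `^ beta.
have th0 : 0 < th by rewrite powR_gt0.
have th1 : th < 1.
  have := @gt0_ltr_powR R beta b0 2^-1 1; rewrite powR1; apply; rewrite ?nnegrE; lra.
have thX i : (2^-1 ^+ i) `^ beta = th ^+ i.
  elim: i => [|i IH]; first by rewrite !expr0 powR1.
  by rewrite !exprS powRM ?exprn_ge0// IH.
pose K : R := 8 ^+ n + 4 ^+ n.
exists (K / (1 - th)) => [|r x r0].
  by rewrite divr_gt0 ?subr_gt0// addr_gt0// exprn_gt0.
pose c i : R := th ^+ i / (2^-1 ^+ i.+1 * r) ^+ n.
pose e i : R := th ^+ i / (2 ^+ i * r) ^+ n.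
pose Bc i := eball x (2 * 2^-1 ^+ i * r).
pose Be i := eball x (2 * 2 ^+ i * r).
have c0 i : 0 <= c i by rewrite divr_ge0 ?exprn_ge0 ?mulr_ge0 ?exprn_ge0// ltW.
have e0 i : 0 <= e i by rewrite divr_ge0 ?exprn_ge0 ?mulr_ge0 ?exprn_ge0// ltW.
pose g i y : \bar R := (c i * \1_(Bc i) y + e i * \1_(Be i) y)%:E.
have g0 i y : (0 <= g i y)%E.
  by rewrite lee_fin addr_ge0// mulr_ge0.
have mg i : measurable_fun setT (g i).
  apply/measurable_EFinP; apply: measurable_funD; apply: measurable_funM => //;
    by apply: measurable_indic; exact: measurable_eball.
apply: (@le_trans _ _ (\int[lebesgue_rV]_y (\sum_(i <oo) g i y))%E).
  apply: ge0_le_integralW => y _; first by rewrite lee_fin kern_ge0// enorm_ge0.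
  set z := enorm (x - y).
  have : 0 <= z by exact: enorm_ge0.
  rewrite le_eqVlt => /predU1P[z0|z0].
    rewrite -z0 /kern expr0n gtn_eqF// invr0 mulr0.
    by apply: nneseries_ge0 => i _ _; exact: g0.
  pose m := Num.min (z / r) (r / z).
  have m0 : 0 < m by rewrite lt_min !divr_gt0.
  have m1 : m <= 1.
    by rewrite ge_min !ler_pdivrMr// !mul1r; case: (leP z r) => // /ltW ->; rewrite orbT.
  have [i [im mi]] := halfpow m0 m1.
  apply: (@le_trans _ _ (g i y)); last first.
    have := @nneseries_lim_ge R (fun i => g i y) xpredT 0 i.+1 (fun i _ _ => g0 i y).
    apply: le_trans; rewrite big_nat_recr//= leeDr// sume_ge0// => j _.
  rewrite lee_fin /kern -/m.
  have mth : m `^ beta <= th ^+ i.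
    by rewrite -thX ge0_ler_powR ?nnegrE ?(ltW b0) ?(ltW m0)// exprn_ge0.
  have [zr|rz] := leP z r.
    have mE : m = z / r.
      by rewrite /m min_l// ler_pdivrMr// mulrAC ler_pdivlMr// ler_pM// ltW.
    have -> : \1_(Bc i) y = 1 :> R.
      rewrite indicE mem_set//= /Bc /eball/= enormB -/z -ltr_pdivrMr//.
      by rewrite -mE (le_lt_trans mi)// ltr_pMl ?exprn_gt0//; lra.
    rewrite mulr1 (@le_trans _ _ (c i))//; last by rewrite lerDl mulr_ge0.
    rewrite /c ler_pM ?powR_ge0 ?invr_ge0 ?exprn_ge0 ?(ltW z0)//.
    rewrite lef_pV2 ?posrE ?exprn_gt0 ?mulr_gt0 ?exprn_gt0//.
    rewrite lerXn2r// ?nnegrE ?mulr_ge0 ?exprn_ge0 ?(ltW r0) ?(ltW z0)//.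
    by rewrite -ler_pdivlMr// -mE ltW.
  have mE : m = r / z.
    rewrite /m min_r// ler_pdivrMr// mulrAC ler_pdivlMr// ler_pM// ltW//.
  have twoi : (2 : R) ^+ i * 2^-1 ^+ i = 1 by rewrite -exprMn divff// expr1n.
  have -> : \1_(Be i) y = 1 :> R.
    rewrite indicE mem_set//= /Be /eball/= enormB -/z.
    rewrite -exprS -(@ltr_pM2l _ (2^-1 ^+ i.+1)) ?exprn_gt0// mulrA -exprMn mulVf//.
    by rewrite expr1n mul1r -ltr_pdivlMr// -mE.
  rewrite mulr1 (@le_trans _ _ (e i))//; last by rewrite lerDr mulr_ge0.
  rewrite /e ler_pM ?powR_ge0 ?invr_ge0 ?exprn_ge0 ?(ltW z0)//.
  rewrite lef_pV2 ?posrE ?exprn_gt0 ?mulr_gt0 ?exprn_gt0//.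
  rewrite lerXn2r// ?nnegrE ?mulr_ge0 ?exprn_ge0 ?(ltW r0) ?(ltW z0)//.
  rewrite -(@ler_pM2l _ (2^-1 ^+ i)) ?exprn_gt0// mulrA [X in X * r]mulrC twoi mul1r.
  by rewrite -ler_pdivrMr// -mE.
rewrite integral_nneseries//.
apply: lime_le.
  by apply: is_cvg_nneseries => i _ _; apply: integral_ge0 => y _; exact: g0.
apply: nearW => N.
apply: (@le_trans _ _ (\sum_(0 <= i < N) (K * th ^+ i)%:E)%E); last first.
  by rewrite sumEFin lee_fin geometric_le ?(ltW th0)// addr_ge0 ?exprn_ge0.
apply: lee_sum => i _.
under eq_integral do rewrite /g EFinD !EFinM.
have mI rho : measurable_fun setT (fun y => (\1_(eball x rho) y)%:E : \bar R).
  by apply/measurable_EFinP; apply: measurable_indic; exact: measurable_eball.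
have mIk k rho : measurable_fun setT (fun y => k%:E * (\1_(eball x rho) y)%:E : \bar R)%E.
  by apply: measurable_funeM; exact: mI.
have Ik0 k rho y : 0 <= k -> (0 <= k%:E * (\1_(eball x rho) y)%:E :> \bar R)%E.
  by move=> k0; rewrite -EFinM lee_fin mulr_ge0.
rewrite (ge0_integralD _ measurableT (fun y _ => Ik0 _ _ y (c0 i)) (mIk _ _)
  (fun y _ => Ik0 _ _ y (e0 i)) (mIk _ _)).
have I0 rho y : setT y -> (0 <= (\1_(eball x rho) y)%:E :> \bar R)%E.
  by rewrite lee_fin.
rewrite (ge0_integralZl_EFin _ measurableT (I0 _) (mI _) (c0 i)).
rewrite (ge0_integralZl_EFin _ measurableT (I0 _) (mI _) (e0 i)).
rewrite !integral_indic ?setIT//; try exact: measurable_eball.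
apply: (@le_trans _ _ ((c i)%:E * ((2 * (2 * 2^-1 ^+ i * r)) ^+ n)%:E +
   (e i)%:E * ((2 * (2 * 2 ^+ i * r)) ^+ n)%:E)%E).
  by apply: leeD; apply: lee_wpmul2l; rewrite ?lee_fin//;
    apply: lebesgue_eball_le; rewrite !mulr_gt0// exprn_gt0.
rewrite -!EFinM -EFinD lee_fin /K [leRHS]mulrDl.
rewrite le_eqVlt; apply/orP; left; apply/eqP; congr (_ + _).
  rewrite /c mulrAC -mulrA mulrC; congr (_ * _).
  rewrite -expr_div_n; congr (_ ^+ _); rewrite exprS.
  have : (2^-1 : R) ^+ i != 0 by rewrite gt_eqF// exprn_gt0.
  by move: (2^-1 ^+ i) => h h0; field; rewrite h0 gt_eqF.
rewrite /e mulrAC -mulrA mulrC; congr (_ * _).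
rewrite -expr_div_n; congr (_ ^+ _).
have : (2 : R) ^+ i != 0 by rewrite gt_eqF// exprn_gt0.
by move: (2 ^+ i) => h h0; field; rewrite h0 gt_eqF.
Qed.

End kernel.


(** * Pointwise bounds for the integrand *)

Lemma expr_sub_le {R : realType} (x y : R) m : 0 <= x -> x <= y ->
  y ^+ m.+1 - x ^+ m.+1 <= m.+1%:R * (y - x) * y ^+ m.
Proof.
move=> x0 xy; have y0 : 0 <= y by exact: le_trans xy.
elim: m => [|m IH]; first by rewrite !expr1 mul1r mulr1.
have -> : y ^+ m.+2 - x ^+ m.+2 =
    y * (y ^+ m.+1 - x ^+ m.+1) + x ^+ m.+1 * (y - x).
  by rewrite !exprS; ring.
have -> : m.+2%:R * (y - x) * y ^+ m.+1 =
    y * (m.+1%:R * (y - x) * y ^+ m) + y ^+ m.+1 * (y - x).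
  by rewrite -(natr1 m.+1) !exprS; ring.
rewrite lerD// ?ler_wpM2l// ler_wpM2r ?subr_ge0//.
by rewrite lerXn2r// ?nnegrE.
Qed.

Section pointwise.
Context {R : realType} {phi f : R -> R} {q : R} {M : nat}.
Hypothesis G : growth phi f q M.

Section bracket.
Context {N : nat}.
Variables (ux uy : 'rV[R]_N) (gx gy L : R).
Hypotheses (gx0 : 0 <= gx) (gy0 : 0 <= gy) (L0 : 0 < L).
Let a := enorm ux.
Let c := enorm uy.
Let D := enorm (ux - uy).
Let flux := f (D / L) * (dotrV (ux - uy) (gx *: ux - gy *: uy) / D) / L.

Let a0 : 0 <= a. Proof. exact: enorm_ge0. Qed.
Let c0 : 0 <= c. Proof. exact: enorm_ge0. Qed.
Let D0 : 0 <= D. Proof. exact: enorm_ge0. Qed.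
Let fD0 : 0 <= f (D / L).
Proof. by apply: (growth_f_ge0 G); rewrite divr_ge0 ?enorm_ge0 ?ltW. Qed.

Lemma dotrV_weightedE :
  dotrV (ux - uy) (gx *: ux - gy *: uy) =
  (gx + gy) / 2 * D ^+ 2 + (gx - gy) / 2 * (a ^+ 2 - c ^+ 2).
Proof.
rewrite /D /a /c !enorm_sqr !(dotrVDl, dotrVDr, dotrVNl, dotrVNr, dotrVZr).
by rewrite (dotrVC uy ux); field.
Qed.

(** When the weights are ordered like the moduli, both terms of
    [dotrV_weightedE] are nonnegative; the first one is kept. *)
Lemma flux_aligned : 0 <= (gx - gy) * (a - c) ->
  (gx + gy) / 2 * (f (D / L) * (D / L)) <= flux.
Proof.
move=> aligned; rewrite /flux dotrV_weightedE.
have [->|Dn0] := eqVneq D 0; first by rewrite invr0 !(mulr0, mul0r).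
rewrite (_ : _ / 2 * (_ * _) = f (D / L) * ((gx + gy) / 2 * D ^+ 2 / D) / L); last first.
  by field; rewrite Dn0 gt_eqF.
rewrite ler_wpM2r ?invr_ge0 ?(ltW L0)// ler_wpM2l// ler_wpM2r ?invr_ge0//.
rewrite lerDl subr_sqr mulrA.
have -> : (gx - gy) / 2 * (a - c) = (gx - gy) * (a - c) / 2 by ring.
by rewrite mulr_ge0 ?divr_ge0 ?addr_ge0.
Qed.

(** When [gx <= gy] although [|uy| <= |ux|], the difference of the weights is
    due to the cut-offs: [gy - gx <= M (ey - ex) ey^(M-1) hy].  The bracket is
    then negative only if [|ux - uy| <= 2 M (ey - ex) |ux| / ey].  Inserting
    this bound into [f] costs a factor [ey^-M] by [growth_dilate], which the
    weight [ey^M] compensates. *)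
Lemma flux_opposed (ex ey hx hy : R) : c <= a -> gx <= gy ->
  0 <= ex -> ex < ey -> ey <= 1 -> 0 <= hy -> hy <= hx -> hy <= 1 ->
  gx = ex ^+ M * hx -> gy = ey ^+ M * hy ->
  - flux <= q / 2 * (4 * M%:R) ^+ M * phi ((ey - ex) * a / L).
Proof.
move=> ca ggxy ex0 exy ey1 hy0 hxy hy1 gxE gyE.
have ey0 : 0 < ey by exact: le_lt_trans exy.
have q1 := growth_q1 G.
have [m ME] : exists m, M = m.+1 by case: (M) (growth_M0 G) => // m; exists m.
have M1 : 1 <= M%:R :> R by rewrite ler1n (growth_M0 G).
set de := ey - ex; have de0 : 0 < de by rewrite subr_gt0.
have Xle : ey ^+ M - ex ^+ M <= M%:R * de * ey ^+ m.
  by rewrite ME; apply: expr_sub_le => //; exact: ltW.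
have RHS0 : 0 <= q / 2 * (4 * M%:R) ^+ M * phi (de * a / L).
  rewrite !mulr_ge0 ?exprn_ge0 ?mulr_ge0//; [lra|].
  by apply: (growth_ge0 G); rewrite divr_ge0 ?mulr_ge0// ltW.
have [D00|Dn0] := eqVneq D 0.
  by rewrite /flux D00 invr0 !(mulr0, mul0r) oppr0.
have Dgt0 : 0 < D by rewrite lt_neqAle eq_sym Dn0.
have acD : a - c <= D by exact: enorm_sub_le.
have dg : gy - gx <= M%:R * de * ey ^+ m * hy.
  apply: (@le_trans _ _ ((ey ^+ M - ex ^+ M) * hy)).
    by rewrite gyE gxE mulrBl lerB// ler_wpM2l// exprn_ge0.
  by rewrite ler_wpM2r.
pose W := D * (ey ^+ m * hy).
have W0 : 0 <= W by rewrite !mulr_ge0 ?exprn_ge0// ltW.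
have bracket_ge : W * (ey * D / 2 - M%:R * de * a) <=
    dotrV (ux - uy) (gx *: ux - gy *: uy).
  rewrite dotrV_weightedE.
  have H1 : (gy - gx) * (a ^+ 2 - c ^+ 2) <= (M%:R * de * ey ^+ m * hy) * (D * (2 * a)).
    have ac2 : 0 <= a - c by rewrite subr_ge0.
    rewrite subr_sqr; apply: ler_pM => //; first by rewrite subr_ge0.
      by rewrite mulr_ge0// addr_ge0.
    by apply: ler_pM => //; [rewrite addr_ge0|lra].
  have H2 : ey ^+ m.+1 * hy * D ^+ 2 <= (gx + gy) * D ^+ 2.
    by rewrite ler_wpM2r ?sqr_ge0// gyE ME lerDr.
  have -> : W * (ey * D / 2 - M%:R * de * a) =
     (ey ^+ m.+1 * hy * D ^+ 2) / 2 - ((M%:R * de * ey ^+ m * hy) * (D * (2 * a))) / 2.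
    by rewrite /W exprS; field.
  by lra.
have [good|bad] := leP 0 (ey * D / 2 - M%:R * de * a).
  apply: le_trans RHS0; rewrite oppr_le0 divr_ge0 ?(ltW L0)// mulr_ge0// divr_ge0//.
  by apply: le_trans bracket_ge; rewrite mulr_ge0.
pose La := 2 * M%:R / ey * (de * a).
have DLa : D <= La.
  rewrite /La mulrAC ler_pdivlMr//; lra.
have La0 : 0 <= La by exact: le_trans DLa.
have step1 : - flux <= f (La / L) * (La / L) * (ey ^+ M / 2).
  apply: (@le_trans _ _ (f (D / L) * ((ey ^+ m * hy) * (M%:R * de * a)) / L)).
    rewrite /flux -mulNr ler_wpM2r ?invr_ge0 ?(ltW L0)// -mulrN ler_wpM2l//.
    rewrite -mulNr ler_pdivrMr// lerNl.
    apply: le_trans bracket_ge.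
    rewrite -subr_ge0.
    rewrite (_ : _ - _ = W * (ey * D / 2)); last by rewrite /W; ring.
    by apply: mulr_ge0 => //; rewrite divr_ge0// mulr_ge0// ltW.
  have -> : f (La / L) * (La / L) * (ey ^+ M / 2) =
     f (La / L) * ((ey ^+ m * 1) * (M%:R * de * a)) / L.
    by rewrite /La ME exprS; field; rewrite !gt_eqF//= ltr0n.
  rewrite ler_wpM2r ?invr_ge0 ?(ltW L0)//.
  apply: ler_pM => //; first by rewrite !mulr_ge0 ?exprn_ge0 ?(ltW ey0)// ltW.
    apply: (growth_fmono G); first by rewrite divr_ge0// ltW.
    by rewrite ler_wpM2r ?invr_ge0 ?(ltW L0).
  rewrite ler_wpM2r ?mulr_ge0//; [exact: ltW|].
  by rewrite ler_wpM2l ?exprn_ge0 ?(ltW ey0).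
have deaL : 0 <= de * a / L by rewrite divr_ge0 ?mulr_ge0// ltW.
rewrite (le_trans step1)//.
apply: (@le_trans _ _ (q * phi (La / L) * (ey ^+ M / 2))).
  rewrite ler_wpM2r ?divr_ge0 ?exprn_ge0 ?(ltW ey0)//.
  by apply: (growth_f_le G); rewrite divr_ge0// ltW.
have l1 : 1 <= 2 * M%:R / ey.
  rewrite ler_pdivlMr// mul1r; lra.
have := growth_dilate G l1 deaL.
rewrite (_ : _ * (de * a / L) = La / L); last by rewrite /La; ring.
move=> H; have {}H := ler_wpM2r (divr_ge0 (exprn_ge0 M (ltW ey0)) (ler0n R 2)) H.
have {H} := ler_wpM2l (le_trans ler01 q1) H.
rewrite !mulrA => /le_trans; apply.
rewrite le_eqVlt; apply/orP; left; apply/eqP.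
have -> : 4 * M%:R = 2 * (2 * M%:R / ey) * ey :> R by field; rewrite gt_eqF.
by rewrite [in RHS]exprMn !mulrA; ring.
Qed.

(** A negative inner product [(ux - uy) . (- uy)] forces [|uy| <= |ux|], whence
    [|ux - uy| <= 2 |ux|]. *)
Lemma flux_outside : gx = 0 -> gy <= 1 ->
  - flux <= f (2 * a / L) * (c / L).
Proof.
move=> gxE gy1.
have R0 : 0 <= f (2 * a / L) * (c / L).
  rewrite mulr_ge0 ?divr_ge0 ?(ltW L0)//.
  by apply: (growth_f_ge0 G); rewrite divr_ge0 ?mulr_ge0// ltW.
have [b0|b0] := leP 0 (dotrV (ux - uy) (gx *: ux - gy *: uy)).
  by apply: le_trans R0; rewrite oppr_le0 divr_ge0 ?(ltW L0)// mulr_ge0// divr_ge0.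
have [D00|Dn0] := eqVneq D 0.
  by rewrite /flux D00 invr0 !(mulr0, mul0r) oppr0.
have Dgt0 : 0 < D by rewrite lt_neqAle eq_sym Dn0.
have bE : dotrV (ux - uy) (gx *: ux - gy *: uy) = - (gy * dotrV (ux - uy) uy).
  by rewrite gxE scale0r add0r dotrVNr dotrVZr.
have ca : c <= a.
  rewrite leNgt; apply/negP => ac.
  move: b0; rewrite bE oppr_lt0 => H.
  have gyp : 0 < gy.
    by rewrite lt_neqAle gy0 andbT; apply/eqP => e; rewrite -e mul0r ltxx in H.
  move: H; rewrite pmulr_rgt0//.
  rewrite dotrVDl dotrVNl -enorm_sqr -/c subr_gt0.
  have := ler_wpM2r c0 (ltW ac); rewrite -expr2.
  by have := dotrV_le ux uy; rewrite -/a -/c; lra.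
have D2a : D <= 2 * a by have := enormB_le ux uy; rewrite -/D -/a -/c; lra.
apply: (@le_trans _ _ (f (D / L) * (c / L))); last first.
  rewrite ler_wpM2r ?divr_ge0 ?(ltW L0)//.
  apply: (growth_fmono G); first by rewrite divr_ge0// ltW.
  by rewrite ler_wpM2r ?invr_ge0 ?(ltW L0).
rewrite (_ : - flux = f (D / L) * (gy * dotrV (ux - uy) uy / D / L)); last first.
  by rewrite /flux bE; ring.
rewrite ler_wpM2l// ler_wpM2r ?invr_ge0 ?(ltW L0)// ler_pdivrMr//.
apply: (@le_trans _ _ (gy * (D * c))); first by rewrite ler_wpM2l// dotrV_le.
by rewrite [c * D]mulrC ler_piMl// mulr_ge0.
Qed.

End bracket.
End pointwise.


(** * The truncated test function *)

Lemma powRV {R : realType} (a s : R) : 0 <= a -> a^-1 `^ s = (a `^ s)^-1.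
Proof. by move=> a0; rewrite -powR_inv1// powRAC powR_inv1 ?powR_ge0. Qed.

Section cutoff.
Context {R : realType}.

Definition cutoff (b e z : R) : R := Num.max 0 (Num.min 1 ((b + e - z) / e)).

Lemma cutoff_ge0 b e z : 0 <= cutoff b e z.
Proof. by rewrite le_max lexx. Qed.

Lemma cutoff_le1 b e z : cutoff b e z <= 1.
Proof. by rewrite ge_max ler01 ge_min lexx. Qed.

Lemma cutoff_eq1 b e z : 0 < e -> z <= b -> cutoff b e z = 1.
Proof.
move=> e0 zb; rewrite /cutoff min_l; first by rewrite max_r.
by rewrite ler_pdivlMr//; lra.
Qed.

Lemma cutoff_eq0 b e z : 0 < e -> b + e <= z -> cutoff b e z = 0.
Proof.
move=> e0 zb; rewrite /cutoff max_l// ge_min.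
by apply/orP; right; rewrite ler_pdivrMr//; lra.
Qed.

Lemma cutoff_sub_le b e z w : 0 < e ->
  cutoff b e z - cutoff b e w <= `|z - w| / e.
Proof.
move=> e0; have zw : (w - z) / e <= `|z - w| / e.
  by rewrite ler_wpM2r ?invr_ge0 ?(ltW e0)// distrC ler_norm.
have zw0 : 0 <= `|z - w| / e by rewrite divr_ge0// ltW.
have E : (b + e - z) / e - (b + e - w) / e = (w - z) / e by ring.
move: zw zw0 E; rewrite /cutoff; move: ((b + e - z) / e) ((b + e - w) / e) => A B.
move: (`|z - w| / e) ((w - z) / e) => X Y.
rewrite /Num.max /Num.min.
by case: (ltP 1 A); case: (ltP 1 B); rewrite ?ltr01;
  case: (ltP 0 A); case: (ltP 0 B); lra.
Qed.

(** [excess k a * a] is the truncation [(a - k)_+]. *)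
Definition excess (k a : R) : R := Num.max (a - k) 0 / a.

Lemma excess_ge0 k a : 0 <= a -> 0 <= excess k a.
Proof. by move=> a0; rewrite divr_ge0// le_max lexx orbT. Qed.

Lemma excess_le1 k a : 0 <= k -> 0 <= a -> excess k a <= 1.
Proof.
move=> k0; rewrite le_eqVlt => /predU1P[<-|a0]; first by rewrite /excess invr0 mulr0.
by rewrite ler_pdivrMr// mul1r ge_max (ltW a0) andbT; lra.
Qed.

Lemma excess_eq0 k a : a <= k -> excess k a = 0.
Proof. by move=> ak; rewrite /excess max_r ?mul0r// subr_le0. Qed.

Lemma excess_gtE k a : k <= a -> 0 < a -> excess k a = 1 - k / a.
Proof.
by move=> ka a0; rewrite /excess max_l ?subr_ge0// mulrBl divff// gt_eqF.
Qed.

Lemma excess_mono k a b : 0 < k -> 0 <= a -> a <= b -> excess k a <= excess k b.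
Proof.
move=> k0 a0 ab; have [ak|ka] := leP a k.
  by rewrite excess_eq0// excess_ge0// (le_trans a0).
rewrite !excess_gtE//; [|lra..].
by rewrite lerB// ler_wpM2l ?(ltW k0)// lef_pV2 ?posrE; lra.
Qed.

End cutoff.

(** Elementary relations between the radii [r <= r1 < r2 <= 2 r], where the
    cut-off decreases on an interval of length [de * r] past [r1] and an equal
    margin is left before [r2]. *)
Section nested_radii.
Context {R : realType}.
Variables (r r1 r2 de : R).
Hypotheses (de0 : 0 < de) (de1 : de <= 1) (r0 : 0 < r) (rr1 : r <= r1).
Hypotheses (r12 : r1 + 2 * (de * r) <= r2) (r22 : r2 <= 2 * r).
Let dr0 : 0 < de * r. Proof. exact: mulr_gt0. Qed.

Lemma nested_outer z : r2 <= z -> r1 + de * r <= z.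
Proof. by move: dr0 r12 => ? ? ?; lra. Qed.

Lemma nested_inner z : z < r1 + de * r -> z < r2.
Proof. by move: dr0 r12 => ? ? ?; lra. Qed.

Lemma nested_base z : r2 <= z -> r <= z.
Proof. by move: dr0 rr1 r12 => ? ? ? ?; lra. Qed.

Lemma nested_shift rho z w l : rho <= de * r -> z < r1 -> l < rho ->
  w - z <= l -> w < r2.
Proof. by move: dr0 r12 => *; lra. Qed.

(** A point beyond [r2] is as far from the support of the cut-off as from the
    centre, up to a factor [de / 2]. *)
Lemma nested_dist z w l : r2 <= z -> w < r1 + de * r -> z - w <= l ->
  de / 2 * z <= l.
Proof.
move=> rz wr zwl.
have : 0 <= (1 - de / 2) * (z - r2) by rewrite mulr_ge0 ?subr_ge0//; move: de1; lra.
have : 0 <= de * (2 * r - r2) by rewrite mulr_ge0 ?subr_ge0 ?(ltW de0).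
by move: dr0 r12 => *; nra.
Qed.

End nested_radii.

Section scaled_kernels.
Context {R : realType} {phi f : R -> R} {q : R} {M : nat}.
Hypothesis G : growth phi f q M.

Lemma far_kernel (n : nat) (s de a c z l : R) :
  0 < s -> s < 1 -> 0 < de -> de <= 1 -> 0 <= a -> 0 <= c -> 0 < z ->
  de / 2 * z <= l ->
  f (2 * a / l `^ s) * (c / l `^ s) / l ^+ n <=
  q * (8 / de) ^+ M * (2 / de) ^+ n.+1 *
    (c * (f (a / z `^ s) / z `^ (n%:R + s))).
Proof.
move=> s0 s1 de0 de1 a0 c0 z0 zl.
have d20 : 0 < de / 2 by rewrite divr_gt0.
have d2z : 0 < de / 2 * z by rewrite mulr_gt0.
have l0 : 0 < l by exact: lt_le_trans zl.
have ls0 : 0 < l `^ s by rewrite powR_gt0.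
have zs0 : 0 < z `^ s by rewrite powR_gt0.
have d21 : de / 2 <= 1 by rewrite ler_pdivrMr//; lra.
have lsz : de / 2 * z `^ s <= l `^ s.
  apply: (@le_trans _ _ ((de / 2 * z) `^ s)); last first.
    by rewrite ge0_ler_powR ?nnegrE ?(ltW s0) ?(ltW d2z) ?(ltW l0).
  rewrite powRM ?(ltW d20) ?(ltW z0)// ler_wpM2r ?powR_ge0//.
  by apply: ger1_powR; rewrite ?d20// ltW.
have az : 0 <= a / z `^ s by rewrite divr_ge0// ltW.
have fa : f (2 * a / l `^ s) <= q * (8 / de) ^+ M * f (a / z `^ s).
  have l1 : 1 <= 4 / de by rewrite ler_pdivlMr//; lra.
  apply: (@le_trans _ _ (f (4 / de * (a / z `^ s)))).
    apply: (growth_fmono G); first by rewrite divr_ge0 ?mulr_ge0 ?(ltW ls0).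
    rewrite ler_pdivrMr//.
    apply: (@le_trans _ _ (4 / de * (a / z `^ s) * (de / 2 * z `^ s))).
      by rewrite le_eqVlt; apply/orP; left; apply/eqP; field; rewrite !gt_eqF.
    by rewrite ler_wpM2l// mulr_ge0 ?divr_ge0 ?(ltW de0) ?(ltW zs0).
  have := growth_f_dilate G l1 az.
  by rewrite (_ : 2 * (4 / de) = 8 / de)//; ring.
have Zl : (l `^ s)^-1 / l ^+ n <= (2 / de) ^+ n.+1 / z `^ (n%:R + s).
  have -> : (2 / de) ^+ n.+1 / z `^ (n%:R + s) =
     (de / 2 * z `^ s)^-1 / (de / 2 * z) ^+ n.
    rewrite powRD; last by apply/implyP => _; rewrite gt_eqF.
    rewrite powR_mulrn ?(ltW z0)// exprS !exprMn !exprVn.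
    by field; rewrite !gt_eqF// exprn_gt0.
  apply: ler_pM; rewrite ?invr_ge0 ?exprn_ge0 ?(ltW l0) ?(ltW ls0)//.
    by rewrite lef_pV2 ?posrE// mulr_gt0.
  rewrite lef_pV2 ?posrE ?exprn_gt0//.
  by rewrite lerXn2r// ?nnegrE ltW.
have -> : f (2 * a / l `^ s) * (c / l `^ s) / l ^+ n =
   c * (f (2 * a / l `^ s) * ((l `^ s)^-1 / l ^+ n)) by ring.
have -> : q * (8 / de) ^+ M * (2 / de) ^+ n.+1 *
     (c * (f (a / z `^ s) / z `^ (n%:R + s))) =
   c * ((q * (8 / de) ^+ M * f (a / z `^ s)) *
     ((2 / de) ^+ n.+1 / z `^ (n%:R + s))).
  by ring.
rewrite ler_wpM2l//; apply: ler_pM => //.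
- by apply: (growth_f_ge0 G); rewrite divr_ge0 ?mulr_ge0 ?(ltW ls0).
- by rewrite mulr_ge0 ?invr_ge0 ?exprn_ge0 ?(ltW l0) ?(ltW ls0).
Qed.

Lemma close_kernel (n : nat) (s r rho de a D g l : R) :
  0 < s -> 0 < de -> de <= 1 -> 0 < r -> 0 < rho -> rho <= r ->
  0 < l -> l <= rho -> 0 <= a -> de * a <= D -> de <= g ->
  (de / 2) ^+ M.+1 * ((r / rho) `^ s * phi (r `^ (- s) * a) / rho ^+ n) <=
  g / 2 * (f (D / l `^ s) * (D / l `^ s)) / l ^+ n.
Proof.
move=> s0 de0 de1 r0 rho0 rhor l0 lrho a0 aD dg.
have ls0 : 0 < l `^ s by rewrite powR_gt0.
have rs0 : 0 < rho `^ s by rewrite powR_gt0.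
have d20 : 0 <= de / 2 by rewrite divr_ge0// ltW.
set b := r `^ (- s) * a; have b0 : 0 <= b by rewrite mulr_ge0 ?powR_ge0.
have lam1 : 1 <= (r / rho) `^ s.
  have H : 1 <= r / rho by rewrite ler_pdivlMr// mul1r.
  have := ge0_ler_powR (ltW s0) (ler01 : 1 \in Num.nneg) _ H; rewrite powR1; apply.
  by rewrite nnegrE (le_trans ler01).
have D0 : 0 <= D by rewrite (le_trans _ aD)// mulr_ge0// ltW.
have DL0 : 0 <= D / l `^ s by rewrite divr_ge0// ltW.
have P1 : (de / 2) ^+ M * ((r / rho) `^ s * phi b) <= phi (D / l `^ s).
  have t0 : 0 <= de * ((r / rho) `^ s * b) by rewrite !mulr_ge0 ?powR_ge0 ?(ltW de0).
  apply: (@le_trans _ _ (phi (de * ((r / rho) `^ s * b)))); last first.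
    apply: (growth_mono G) => //.
    apply: (@le_trans _ _ (de * a / rho `^ s)).
      rewrite le_eqVlt; apply/orP; left; apply/eqP.
      rewrite /b powRN powRM ?invr_ge0 ?(ltW r0) ?(ltW rho0)//.
      rewrite (powRV s (ltW rho0)).
      by field; rewrite !gt_eqF// powR_gt0.
    apply: ler_pM => //; rewrite ?mulr_ge0 ?invr_ge0 ?(ltW de0) ?(ltW rs0)//.
    rewrite lef_pV2 ?posrE//.
    by rewrite ge0_ler_powR ?nnegrE ?(ltW s0) ?(ltW l0) ?(ltW rho0).
  apply: (@le_trans _ _ ((de / 2) ^+ M * phi ((r / rho) `^ s * b))).
    by rewrite ler_wpM2l ?exprn_ge0// (growth_superlinear G).
  have dei : 1 <= de^-1 by rewrite -[1]invr1 lef_pV2 ?posrE.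
  have := growth_dilate G dei t0; rewrite mulKf ?gt_eqF//.
  move=> /(ler_wpM2l (exprn_ge0 M d20)) /le_trans; apply.
  rewrite [X in X <= _]mulrA -exprMn (_ : de / 2 * (2 / de) = 1) ?expr1n ?mul1r//.
  by field; rewrite gt_eqF.
have S0 : 0 <= (de / 2) ^+ M * ((r / rho) `^ s * phi b).
  by rewrite !mulr_ge0 ?exprn_ge0 ?powR_ge0 ?(growth_ge0 G).
have -> : (de / 2) ^+ M.+1 * ((r / rho) `^ s * phi b / rho ^+ n) =
  (de / 2) * ((de / 2) ^+ M * ((r / rho) `^ s * phi b)) / rho ^+ n.
  by rewrite exprS; ring.
apply: ler_pM.
- by rewrite mulr_ge0.
- by rewrite invr_ge0 exprn_ge0// ltW.
- apply: ler_pM => //; first by rewrite ler_wpM2r.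
  by apply: (le_trans P1); exact: (growth_le_f G).
- by rewrite lef_pV2 ?posrE ?exprn_gt0// lerXn2r ?nnegrE ?(ltW l0) ?(ltW rho0).
Qed.

End scaled_kernels.

Section geometry.
Context {R : realType} {n N : nat} (phi f : R -> R) (q : R) (M : nat).
Hypothesis G : growth phi f q M.
Hypothesis n0 : (0 < n)%N.
Variables (s r : R) (xB : 'rV[R]_n) (u : 'rV[R]_n -> 'rV[R]_N).
Hypotheses (s0 : 0 < s) (s1 : s < 1) (r0 : 0 < r).
Variables (r1 r2 de k1 : R).
Hypotheses (de0 : 0 < de) (de1 : de <= 1) (rr1 : r <= r1).
Hypotheses (r12 : r1 + 2 * (de * r) <= r2) (r22 : r2 <= 2 * r) (k10 : 0 < k1).

Definition superlevel rho k : set 'rV[R]_n :=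
  eball xB rho `&` [set x | k < enorm (u x)].

Definition test_weight x : R :=
  cutoff r1 (de * r) (enorm (x - xB)) ^+ M * excess k1 (enorm (u x)).

Definition test_fun x : 'rV[R]_N := test_weight x *: u x.

Definition weak_integrand (psi : 'rV[R]_n -> 'rV[R]_N) x y : R :=
  f (enorm (u x - u y) / enorm (x - y) `^ s)
   * (dotrV (u x - u y) (psi x - psi y) / enorm (u x - u y))
   / enorm (x - y) `^ s / enorm (x - y) ^+ n.

Definition scaled_phi x : R := phi (r `^ (- s) * enorm (u x)).

Definition tail_integrand y : R :=
  f (enorm (u y) / enorm (y - xB) `^ s) / enorm (y - xB) `^ (n%:R + s).

Local Notation beta := (Num.min s (1 - s)).

Definition near_part x y : R :=
  \1_(superlevel r2 k1) x * scaled_phi x * kern (n := n) beta r (enorm (x - y)).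

Definition far_part x y : R :=
  \1_(superlevel r2 k1) y * enorm (u y) * (\1_(~` eball xB r) x * tail_integrand x).

Let dr0 : 0 < de * r. Proof. exact: mulr_gt0. Qed.

Let u0 x : 0 <= enorm (u x). Proof. exact: enorm_ge0. Qed.

Lemma scaled_phi_ge0 x : 0 <= scaled_phi x.
Proof. by apply: (growth_ge0 G); rewrite mulr_ge0 ?powR_ge0. Qed.

Lemma tail_integrand_ge0 y : 0 <= tail_integrand y.
Proof.
rewrite divr_ge0 ?powR_ge0//; apply: (growth_f_ge0 G).
by rewrite divr_ge0 ?powR_ge0.
Qed.

Lemma near_part_ge0 x y : 0 <= near_part x y.
Proof.
apply: mulr_ge0; last exact/kern_ge0/enorm_ge0.
by apply: mulr_ge0 => //; exact: scaled_phi_ge0.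
Qed.

Lemma far_part_ge0 x y : 0 <= far_part x y.
Proof.
apply: mulr_ge0; first by rewrite mulr_ge0 ?enorm_ge0.
by apply: mulr_ge0 => //; exact: tail_integrand_ge0.
Qed.

Lemma weak_integrandC psi x y : weak_integrand psi x y = weak_integrand psi y x.
Proof.
rewrite /weak_integrand (enormB (u y)) (enormB y); congr (_ * (_ / _) / _ / _).
by rewrite -[u y - u x]opprB -[psi y - psi x]opprB dotrVNl dotrVNr opprK.
Qed.

Lemma test_weight_ge0 x : 0 <= test_weight x.
Proof. by rewrite mulr_ge0 ?exprn_ge0 ?cutoff_ge0 ?excess_ge0. Qed.

Lemma test_weight_le1 x : test_weight x <= 1.
Proof.
rewrite mulr_ile1 ?exprn_ge0 ?cutoff_ge0 ?excess_ge0 ?excess_le1 ?(ltW k10)//.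
by rewrite exprn_ile1 ?cutoff_ge0 ?cutoff_le1.
Qed.

Lemma enorm_dist_sub x y : `|enorm (x - xB) - enorm (y - xB)| <= enorm (x - y).
Proof.
rewrite ler_norml; apply/andP; split.
  rewrite lerNl opprB (enormB x y); apply: le_trans (enorm_sub_le _ _) _.
  by rewrite opprB addrA subrK.
by apply: le_trans (enorm_sub_le _ _) _; rewrite opprB addrA subrK.
Qed.

(** Where the cut-off varies by [d <= min(1, |x-y| / (de r))], the singular
    factor [|x-y|^-s] is compensated at short range by the Lipschitz bound and
    at long range by its own decay. *)
Lemma phi_cutoff_kern (d a l : R) : 0 <= a -> 0 < l -> 0 <= d -> d <= 1 ->
  d <= l / (de * r) ->
  phi (d * a / l `^ s) / l ^+ n <=
  (2 / de) ^+ M * phi (r `^ (- s) * a) * kern (n := n) beta r l.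
Proof.
move=> a0 l0 d0 d1 dl; rewrite /kern mulrA ler_wpM2r ?invr_ge0 ?exprn_ge0 ?(ltW l0)//.
have b0 : 0 < beta by rewrite lt_min s0 subr_gt0 s1.
set mm := Num.min _ _.
have mm0 : 0 < mm by rewrite lt_min !divr_gt0.
have mm1 : mm <= 1.
  by rewrite ge_min !ler_pdivrMr// !mul1r; case: (leP l r) => // /ltW ->; rewrite orbT.
have ls0 : 0 < l `^ s by rewrite powR_gt0.
have rs0 : 0 < r `^ s by rewrite powR_gt0.
have dde : 1 <= de^-1 by rewrite -[1]invr1 lef_pV2 ?posrE.
have dls : d / l `^ s <= mm `^ beta * (de^-1 * r `^ (- s)).
  rewrite powRN; have [lr|rl] := leP l r.
    have mE : mm = l / r.
      by rewrite /mm min_l// ler_pdivrMr// mulrAC ler_pdivlMr// ler_pM// ltW.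
    have H : (l / r) `^ (1 - s) <= mm `^ beta.
      by rewrite mE; apply: ger_powR; rewrite ?divr_gt0 -?mE ?mm1// ge_min lexx orbT.
    apply: (@le_trans _ _ ((l / r) `^ (1 - s) * (de^-1 * (r `^ s)^-1))); last first.
      by rewrite ler_wpM2r// mulr_ge0 ?invr_ge0 ?powR_ge0// ltW.
    rewrite powRB; last by rewrite gt_eqF ?divr_gt0// implybT.
    rewrite powRr1 ?divr_ge0 ?(ltW l0) ?(ltW r0)//.
    rewrite powRM ?invr_ge0 ?(ltW l0) ?(ltW r0)//.
    rewrite (powRV s (ltW r0)).
    rewrite (_ : _ / _ * _ = l / (de * r) / l `^ s); last first.
      by field; rewrite !gt_eqF.
    by rewrite ler_wpM2r ?invr_ge0 ?powR_ge0.
  have mE : mm = r / l.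
    by rewrite /mm min_r// ler_pdivrMr// mulrAC ler_pdivlMr// ler_pM// ltW.
  have H : (r / l) `^ s <= mm `^ beta.
    by rewrite mE; apply: ger_powR; rewrite ?divr_gt0 -?mE ?mm1// ge_min lexx.
  apply: (@le_trans _ _ ((r / l) `^ s * (de^-1 * (r `^ s)^-1))); last first.
    by rewrite ler_wpM2r// mulr_ge0 ?invr_ge0 ?powR_ge0// ltW.
  rewrite powRM ?invr_ge0 ?(ltW l0) ?(ltW r0)//.
  rewrite (powRV s (ltW l0)).
  rewrite (_ : _ / _ * _ = de^-1 / l `^ s); last first.
    by field; rewrite !gt_eqF.
  by rewrite ler_wpM2r ?invr_ge0 ?powR_ge0// (le_trans d1).
have ra0 : 0 <= r `^ (- s) * a by rewrite mulr_ge0 ?powR_ge0.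
apply: (@le_trans _ _ (phi (mm `^ beta * (de^-1 * (r `^ (- s) * a))))).
  apply: (growth_mono G); first by rewrite divr_ge0 ?powR_ge0// mulr_ge0.
  by rewrite mulrAC [de^-1 * (_ * _)]mulrA mulrA ler_wpM2r.
have mb1 : mm `^ beta <= 1.
  by have := ge0_ler_powR (ltW b0) (ltW mm0 : mm \in Num.nneg) ler01 mm1; rewrite powR1.
apply: (le_trans (growth_sublinear G (powR_ge0 _ _) mb1 _)).
  by rewrite mulr_ge0// invr_ge0 ltW.
by rewrite mulrC ler_wpM2r ?powR_ge0// (growth_dilate G).
Qed.

Let K1 := q / 2 * (4 * M%:R) ^+ M * (2 / de) ^+ M.
Let K2 := q * (8 / de) ^+ M * (2 / de) ^+ n.+1.

Let summand_le (A B p1 p2 p3 p4 : R) : 0 <= A -> 0 <= B ->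
  0 <= p1 -> 0 <= p2 -> 0 <= p3 -> 0 <= p4 ->
  A * p1 <= A * (p1 + p2) + B * (p3 + p4) /\
  B * p3 <= A * (p1 + p2) + B * (p3 + p4).
Proof.
move=> A0 B0 h1 h2 h3 h4; rewrite !mulrDr.
have := mulr_ge0 A0 h1; have := mulr_ge0 A0 h2.
by have := mulr_ge0 B0 h3; have := mulr_ge0 B0 h4; lra.
Qed.

(** By symmetry [|u y| <= |u x|].  The integrand is negative only if the weight
    is larger at [y]; then [|u y|], hence [|u x|], exceeds the level.  Either [x]
    is still in the ball of radius [r2], and the error belongs to the near
    part, or [x] is far from the support of the cut-off. *)
Lemma weak_integrand_ge x y :
  - weak_integrand test_fun x y <=
  K1 * (near_part x y + near_part y x) + K2 * (far_part x y + far_part y x).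
Proof.
wlog ca : x y / enorm (u y) <= enorm (u x).
  move=> H; have [ca|/ltW ca] := leP (enorm (u y)) (enorm (u x)); first exact: H.
  rewrite weak_integrandC (addrC (near_part x y)) (addrC (far_part x y)).
  exact: H.
have q1 := growth_q1 G.
have K10 : 0 <= K1.
  by rewrite /K1 !mulr_ge0 ?exprn_ge0 ?divr_ge0 ?mulr_ge0 ?(ltW de0)//; lra.
have K20 : 0 <= K2.
  by rewrite /K2 !mulr_ge0 ?exprn_ge0 ?divr_ge0 ?(ltW de0)//; lra.
have R0 : 0 <= K1 * (near_part x y + near_part y x) + K2 * (far_part x y + far_part y x).
  by rewrite addr_ge0// mulr_ge0// addr_ge0 ?near_part_ge0 ?far_part_ge0.
have [near_le far_le] := summand_le K10 K20 (near_part_ge0 x y) (near_part_ge0 y x)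
  (far_part_ge0 x y) (far_part_ge0 y x).
have [->|xy] := eqVneq x y.
  rewrite /weak_integrand !subrr !enorm0 expr0n gtn_eqF// invr0 mulr0 oppr0.
  by rewrite addr_ge0// mulr_ge0// addr_ge0 ?near_part_ge0 ?far_part_ge0.
have l0 : 0 < enorm (x - y).
  rewrite lt_neqAle enorm_ge0 andbT eq_sym; apply/eqP => /enorm_eq0/eqP.
  by rewrite subr_eq0 (negbTE xy).
have ls0 : 0 < enorm (x - y) `^ s by rewrite powR_gt0.
have Z0 : 0 <= (enorm (x - y) ^+ n)^-1 by rewrite invr_ge0 exprn_ge0// ltW.
have [gxy|gxy] := leP (test_weight y) (test_weight x).
  apply: le_trans R0; rewrite oppr_le0 mulr_ge0//.
  have yx : 0 <= (test_weight x - test_weight y) * (enorm (u x) - enorm (u y)).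
    by rewrite mulr_ge0// subr_ge0.
  have := flux_aligned G ls0 yx.
  apply: le_trans.
  have D0 : 0 <= enorm (u x - u y) / enorm (x - y) `^ s.
    by rewrite divr_ge0 ?enorm_ge0// ltW.
  apply: mulr_ge0; first by rewrite divr_ge0 ?addr_ge0 ?test_weight_ge0.
  by apply: mulr_ge0 => //; exact: (growth_f_ge0 G).
have gy0 : 0 < test_weight y by exact: le_lt_trans (test_weight_ge0 x) gxy.
have ky : k1 < enorm (u y).
  rewrite ltNge; apply/negP => H.
  by rewrite /test_weight (excess_eq0 H) mulr0 ltxx in gy0.
have yr : enorm (y - xB) < r1 + de * r.
  rewrite ltNge; apply/negP => H.
  by rewrite /test_weight (cutoff_eq0 dr0 H) expr0n gtn_eqF ?(growth_M0 G)// mul0r ltxx in gy0.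
have hxy : excess k1 (enorm (u y)) <= excess k1 (enorm (u x)) by exact: excess_mono.
have [xr|xr] := ltP (enorm (x - xB)) r2.
  have ey : cutoff r1 (de * r) (enorm (x - xB)) < cutoff r1 (de * r) (enorm (y - xB)).
    rewrite ltNge; apply/negP => H; move: gxy; rewrite ltNge => /negP; apply.
    rewrite ler_pM ?exprn_ge0 ?cutoff_ge0 ?excess_ge0// lerXn2r// ?nnegrE cutoff_ge0//.
  apply: le_trans near_le.
  have := flux_opposed G (test_weight_ge0 x) ls0 ca (ltW gxy) (cutoff_ge0 _ _ _)
    ey (cutoff_le1 _ _ _) (excess_ge0 _ (u0 _)) hxy
    (excess_le1 (ltW k10) (u0 _)) erefl erefl.
  move=> /(ler_wpM2r Z0); rewrite mulNr => /le_trans; apply.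
  rewrite -[_ * phi _ * _]mulrA.
  have -> : K1 * near_part x y =
    q / 2 * (4 * M%:R) ^+ M * ((2 / de) ^+ M * near_part x y) by rewrite /K1 !mulrA.
  apply: ler_wpM2l.
    by rewrite mulr_ge0 ?exprn_ge0 ?mulr_ge0 ?divr_ge0// (le_trans ler01).
  rewrite /near_part indicE mem_set; last first.
    by split => //=; rewrite (lt_le_trans ky).
  rewrite mul1r mulrA; apply: phi_cutoff_kern => //.
  - by rewrite subr_ge0 ltW.
  - by rewrite lerBlDr (le_trans (cutoff_le1 _ _ _))// lerDl cutoff_ge0.
  - rewrite (le_trans (cutoff_sub_le _ _ _ dr0))// ler_wpM2r ?invr_ge0 ?(ltW dr0)//.
    by rewrite [X in _ <= X]enormB enorm_dist_sub.
apply: le_trans far_le.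
have gx0 : test_weight x = 0.
  rewrite /test_weight cutoff_eq0//; last by apply: nested_outer xr.
  by rewrite expr0n gtn_eqF ?(growth_M0 G)// mul0r.
have := flux_outside G (u x) (u y) (test_weight_ge0 y) ls0 gx0 (test_weight_le1 y).
move=> /(ler_wpM2r Z0); rewrite mulNr => /le_trans; apply.
rewrite /far_part !indicE !mem_set; last 2 first.
- rewrite /setC /eball/=; apply/negP; rewrite -leNgt.
  exact: (nested_base de0 r0 rr1 r12).
- split; [exact: (nested_inner de0 r0 r12 yr)|exact: ky].
rewrite !mul1r.
set dx := enorm (x - xB); have dx0 : 0 < dx.
  by rewrite (lt_le_trans r0)// (nested_base de0 r0 rr1 r12).
have ldx : de / 2 * dx <= enorm (x - y).
  apply: (nested_dist de0 de1 r0 r12 r22 xr yr).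
  exact: le_trans (ler_norm _) (enorm_dist_sub x y).
exact: (far_kernel G n s0 s1 de0 de1 (u0 x) (u0 y) dx0 ldx).
Qed.

(** The weight is at least [de] at [x] and zero at [y], and [|u x - u y|] is at
    least [de |u x|]; what remains of the kernel at distance [rho] is the gain
    [(r / rho) ^ s]. *)
Lemma weak_integrand_le_superlevel (k2 rho : R) x y :
  0 < k2 -> k1 <= (1 - de) * k2 -> 0 < rho -> rho <= de * r ->
  superlevel r1 k2 x -> eball x rho y -> ~ superlevel r2 k1 y ->
  (de / 2) ^+ M.+1 * ((r / rho) `^ s * scaled_phi x / rho ^+ n)
    <= weak_integrand test_fun x y.
Proof.
move=> k20 k12 rho0 rhor [/= xr kx] yrho nAy.
have yr2 : enorm (y - xB) < r2.
  apply: (nested_shift de0 r0 r12 rhor xr yrho).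
  exact: le_trans (ler_norm _) (enorm_dist_sub y x).
have yk : enorm (u y) <= k1.
  by rewrite leNgt; apply/negP => ky; apply: nAy.
set a := enorm (u x); have a0 : 0 < a by exact: lt_trans kx.
have ka : k1 <= (1 - de) * a.
  by apply: (le_trans k12); rewrite ler_wpM2l ?subr_ge0// ltW.
have k1a : k1 <= a by rewrite (le_trans ka)// ler_piMl ?(ltW a0)// gerBl ltW.
have ya : enorm (u y) <= a by exact: le_trans k1a.
have l0 : 0 < enorm (x - y).
  rewrite lt_neqAle enorm_ge0 andbT eq_sym; apply/eqP => /enorm_eq0/eqP.
  rewrite subr_eq0 => /eqP xyE; move: yk; rewrite -xyE -/a leNgt => /negP; apply.
  by rewrite (le_lt_trans ka)// gtr_pMl// gtrBl.
have lrho : enorm (x - y) <= rho by rewrite enormB ltW.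
have gy : test_weight y = 0 by rewrite /test_weight excess_eq0// mulr0.
have gx : de <= test_weight x.
  rewrite /test_weight cutoff_eq1//; last by rewrite ltW.
  rewrite expr1n mul1r excess_gtE// lerBrDl -lerBrDr ler_pdivrMr//.
have D_ge : de * a <= enorm (u x - u y).
  apply: le_trans (enorm_sub_le _ _); rewrite -/a lerBrDr -lerBrDl.
  by rewrite (le_trans yk)// (le_trans ka)// mulrBl mul1r.
have ls0 : 0 < enorm (x - y) `^ s by rewrite powR_gt0.
have Z0 : 0 <= (enorm (x - y) ^+ n)^-1 by rewrite invr_ge0 exprn_ge0// ltW.
have yx : 0 <= (test_weight x - 0) * (enorm (u x) - enorm (u y)).
  by rewrite subr0 mulr_ge0 ?test_weight_ge0// subr_ge0.
have := flux_aligned G ls0 yx; rewrite addr0 => /(ler_wpM2r Z0) H.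
have -> : weak_integrand test_fun x y =
  f (enorm (u x - u y) / enorm (x - y) `^ s) *
  (dotrV (u x - u y) (test_weight x *: u x - 0 *: u y) / enorm (u x - u y)) /
  enorm (x - y) `^ s / enorm (x - y) ^+ n by rewrite /weak_integrand /test_fun gy.
apply: le_trans H.
have rhor' : rho <= r by rewrite (le_trans rhor)// ler_piMl// ltW.
exact: (close_kernel G n s0 de0 de1 r0 rho0 rhor' l0 lrho (ltW a0) D_ge gx).
Qed.

End geometry.


(** * Iterated integrals *)

Section iterated_integrals.
Context d (T : measurableType d) (R : realType).
Local Open Scope ereal_scope.

Lemma integral_indicM (mu : {measure set T -> \bar R}) (A : set T) (g : T -> R) :
  \int[mu]_x (\1_A x * g x)%:E = \int[mu]_(x in A) (g x)%:E.
Proof.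
rewrite [RHS]integral_mkcond; apply: eq_integral => x _.
by rewrite patchE indicE; case: (x \in A); rewrite ?mul1r ?mul0r.
Qed.

Lemma measurable_mono_comp (h : R -> R) (v : T -> R) :
  (forall s t, 0 <= s -> s <= t -> h s <= h t)%R -> (forall x, 0 <= v x)%R ->
  measurable_fun setT v -> measurable_fun setT (fun x => h (v x)).
Proof.
move=> hm v0 mv.
have mh : measurable_fun [set: R] (fun t : R => h (Num.max 0 t))%R.
  apply: (@nondecreasing_measurable R setT _ measurableT) => s t st.
  apply: hm; first by rewrite le_max lexx.
  by rewrite ge_max !le_max lexx/= st orbT.
rewrite [X in measurable_fun _ X](_ : _ = (fun t : R => h (Num.max 0 t))%R \o v).
  exact: measurableT_comp.
by apply/funext => x /=; rewrite max_r.
Qed.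

Lemma measurable_slice d' (T' : measurableType d') (F : T -> T -> T') x :
  measurable_fun setT (fun z : T * T => F z.1 z.2) -> measurable_fun setT (F x).
Proof. by move=> mF; exact: (measurableT_comp mF (pair1_measurable x)). Qed.

Variable mu : {sigma_finite_measure set T -> \bar R}.

Lemma measurable_integral_snd (F : T -> T -> R) :
  measurable_fun setT (fun z : T * T => F z.1 z.2) -> (forall x y, 0 <= F x y)%R ->
  measurable_fun setT (fun x => \int[mu]_y (F x y)%:E).
Proof.
move=> mF F0.
have := @measurable_fun_fubini_tonelli_F _ _ _ _ _ mu (fun z => (F z.1 z.2)%:E).
apply; last by move=> z; rewrite lee_fin.
exact/measurable_EFinP.
Qed.

Lemma integral_swap (F : T -> T -> R) :
  measurable_fun setT (fun z : T * T => F z.1 z.2) -> (forall x y, 0 <= F x y)%R ->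
  \int[mu]_x \int[mu]_y (F x y)%:E = \int[mu]_x \int[mu]_y (F y x)%:E.
Proof.
move=> mF F0.
have := @fubini_tonelli _ _ _ _ _ mu mu (fun z => (F z.1 z.2)%:E).
by apply; [exact/measurable_EFinP|move=> z; rewrite lee_fin].
Qed.

Lemma integral2D (F1 F2 : T -> T -> R) :
  measurable_fun setT (fun z : T * T => F1 z.1 z.2) -> (forall x y, 0 <= F1 x y)%R ->
  measurable_fun setT (fun z : T * T => F2 z.1 z.2) -> (forall x y, 0 <= F2 x y)%R ->
  \int[mu]_x \int[mu]_y (F1 x y + F2 x y)%:E =
  \int[mu]_x \int[mu]_y (F1 x y)%:E + \int[mu]_x \int[mu]_y (F2 x y)%:E.
Proof.
move=> m1 F10 m2 F20.
have mx (F : T -> T -> R) x : measurable_fun setT (fun z : T * T => F z.1 z.2) ->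
    measurable_fun setT (fun y => (F x y)%:E).
  by move=> mF; apply/measurable_EFinP; exact: measurable_slice.
rewrite -ge0_integralD//; first last.
- exact: measurable_integral_snd.
- by move=> x _; apply: integral_ge0 => y _; rewrite lee_fin.
- exact: measurable_integral_snd.
- by move=> x _; apply: integral_ge0 => y _; rewrite lee_fin.
apply: eq_integral => x _; under eq_integral do rewrite EFinD.
by rewrite ge0_integralD// => [y _||y _|]; rewrite ?lee_fin//; exact: mx.
Qed.

Lemma integral2Zl (F : T -> T -> R) (k : R) : (0 <= k)%R ->
  measurable_fun setT (fun z : T * T => F z.1 z.2) -> (forall x y, 0 <= F x y)%R ->
  \int[mu]_x \int[mu]_y (k * F x y)%:E =
  k%:E * \int[mu]_x \int[mu]_y (F x y)%:E.
Proof.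
move=> k0 mF F0.
rewrite -ge0_integralZl_EFin//; first last.
- exact: measurable_integral_snd.
- by move=> x _; apply: integral_ge0 => y _; rewrite lee_fin.
apply: eq_integral => x _; under eq_integral do rewrite EFinM.
rewrite ge0_integralZl_EFin//.
- by move=> y _; rewrite lee_fin.
by apply/measurable_EFinP; exact: measurable_slice.
Qed.

Lemma integral2_sym (F1 F2 : T -> T -> R) (k1 k2 : R) :
  (0 <= k1)%R -> (0 <= k2)%R ->
  measurable_fun setT (fun z : T * T => F1 z.1 z.2) -> (forall x y, 0 <= F1 x y)%R ->
  measurable_fun setT (fun z : T * T => F2 z.1 z.2) -> (forall x y, 0 <= F2 x y)%R ->
  \int[mu]_x \int[mu]_y (k1 * (F1 x y + F1 y x) + k2 * (F2 x y + F2 y x))%:E =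
  k1%:E * (\int[mu]_x \int[mu]_y (F1 x y)%:E + \int[mu]_x \int[mu]_y (F1 x y)%:E) +
  k2%:E * (\int[mu]_x \int[mu]_y (F2 x y)%:E + \int[mu]_x \int[mu]_y (F2 x y)%:E).
Proof.
move=> k10 k20 m1 F10 m2 F20.
have sw (F : T -> T -> R) : measurable_fun setT (fun z : T * T => F z.1 z.2) ->
    measurable_fun setT (fun z : T * T => F z.2 z.1).
  move=> mF.
  exact: (measurableT_comp mF (measurable_fun_pair measurable_snd measurable_fst)).
pose S (F : T -> T -> R) x y := (F x y + F y x)%R.
have S0 F x y : (forall x y, 0 <= F x y)%R -> (0 <= S F x y)%R.
  by move=> F0; rewrite addr_ge0.
have mS F : measurable_fun setT (fun z : T * T => F z.1 z.2) ->
    measurable_fun setT (fun z : T * T => S F z.1 z.2).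
  by move=> mF; apply: measurable_funD => //; exact: sw.
have SE (F : T -> T -> R) : measurable_fun setT (fun z : T * T => F z.1 z.2) ->
    (forall x y, 0 <= F x y)%R -> \int[mu]_x \int[mu]_y (S F x y)%:E =
    \int[mu]_x \int[mu]_y (F x y)%:E + \int[mu]_x \int[mu]_y (F x y)%:E.
  move=> mF F0; rewrite {2}(integral_swap mF F0).
  by apply: (@integral2D F (fun x y => F y x)) => //; exact: sw.
rewrite -(SE _ m1 F10) -(SE _ m2 F20).
rewrite -(integral2Zl k10 (mS _ m1)) => [|x y]; last exact: S0.
rewrite -(integral2Zl k20 (mS _ m2)) => [|x y]; last exact: S0.
apply: (@integral2D (fun x y => k1 * S F1 x y)%R (fun x y => k2 * S F2 x y)%R).
- by apply: measurable_funM => //; exact: mS.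
- by move=> x y; apply: mulr_ge0 => //; exact: S0.
- by apply: measurable_funM => //; exact: mS.
- by move=> x y; apply: mulr_ge0 => //; exact: S0.
Qed.

(** Only the negative part of [F] is known to be integrable beforehand.  With
    [P] and [Q] the inner integrals of the two parts, the vanishing integral of
    [P - Q] has equal positive and negative parts, the latter at most [Q], and
    [P <= (P - Q)^+ + Q]. *)
Lemma integral2_pos_le (F B : T -> T -> R) :
  measurable_fun setT (fun z : T * T => F z.1 z.2) ->
  (forall x y, 0 <= B x y)%R -> (forall x y, - F x y <= B x y)%R ->
  \int[mu]_x \int[mu]_y (F x y)%:E = 0 ->
  \int[mu]_x \int[mu]_y (B x y)%:E < +oo ->
  \int[mu]_x \int[mu]_y (Num.max (F x y) 0)%:E <=
  2%:E * \int[mu]_x \int[mu]_y (B x y)%:E.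
Proof.
move=> mF B0 FB F0 Boo.
pose Fp x y := Num.max (F x y) 0%R; pose Fn x y := Num.max (- F x y)%R 0%R.
have Fp0 x y : (0 <= Fp x y)%R by rewrite le_max lexx orbT.
have Fn0 x y : (0 <= Fn x y)%R by rewrite le_max lexx orbT.
have mFp : measurable_fun setT (fun z : T * T => Fp z.1 z.2).
  exact: measurable_maxr.
have mFn : measurable_fun setT (fun z : T * T => Fn z.1 z.2).
  by apply: measurable_maxr => //; exact: measurableT_comp.
pose P x := \int[mu]_y (Fp x y)%:E; pose Q x := \int[mu]_y (Fn x y)%:E.
have P0 x : 0 <= P x by apply: integral_ge0 => y _; rewrite lee_fin.
have Q0 x : 0 <= Q x by apply: integral_ge0 => y _; rewrite lee_fin.
have mP : measurable_fun setT P by exact: measurable_integral_snd.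
have mQ : measurable_fun setT Q by exact: measurable_integral_snd.
have HE x : \int[mu]_y (F x y)%:E = P x - Q x.
  rewrite integralE; congr (_ - _); apply: eq_integral => y _.
    by rewrite funeposE -EFin_max.
  by rewrite funenegE -EFinN -EFin_max.
pose H x := P x - Q x.
have mH : measurable_fun setT H by exact: emeasurable_funB.
have intQ : \int[mu]_x Q x <= \int[mu]_x \int[mu]_y (B x y)%:E.
  apply: ge0_le_integralW => x _ //; apply: ge0_le_integralW => y _.
    by rewrite lee_fin.
  by rewrite lee_fin /Fn ge_max FB B0.
have HnQ : \int[mu]_x H^\- x <= \int[mu]_x Q x.
  apply: ge0_le_integralW => x _ //.
  rewrite funenegE ge_max Q0 andbT /H.
  have := P0 x; have := Q0 x; case: (P x) (Q x) => [p| |] [q'| |]//=;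
    rewrite ?leey ?leNye// ?lee_fin => ? ?.
  by lra.
have Hnoo : \int[mu]_x H^\- x < +oo.
  exact: le_lt_trans (le_trans HnQ intQ) Boo.
have HpE : \int[mu]_x H^\+ x = \int[mu]_x H^\- x.
  move: F0; under eq_integral do rewrite HE.
  rewrite -/H integralE.
  have Hn0 : 0 <= \int[mu]_x H^\- x by apply: integral_ge0.
  have Hp0 : 0 <= \int[mu]_x H^\+ x by apply: integral_ge0.
  move: Hn0 Hp0 Hnoo; case: (\int[mu]_x H^\- x) => [b| |]//.
  case: (\int[mu]_x H^\+ x) => [a| |]// _ _ _ /eqP.
  by rewrite -EFinB eqe subr_eq0 => /eqP ->.
apply: (@le_trans _ _ (\int[mu]_x (H^\+ x + Q x))).
  apply: ge0_le_integralW => x _; first exact: P0.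
  rewrite -/(P x) funeposE /H.
  have := P0 x; have := Q0 x; case: (P x) (Q x) => [p| |] [q'| |]//=;
    rewrite ?leey ?leNye// ?lee_fin => ? ?.
  - by rewrite -EFinB -EFin_max -EFinD lee_fin -lerBlDr le_max lexx.
  - by rewrite maxNye add0e leey.
  - by rewrite maxNye add0e leey.
rewrite ge0_integralD//; last exact: measurable_funepos.
rewrite HpE (_ : 2%:E = 1 + 1)// ge0_muleDl// mul1e.
by apply: leeD; [exact: le_trans HnQ intQ|exact: intQ].
Qed.

End iterated_integrals.


(** * One step of the iteration *)

Section integrand_measurability.
Context {R : realType} {n N : nat} {phi f : R -> R} {q : R} {M : nat}.
Hypothesis G : growth phi f q M.
Variables (s r : R) (xB : 'rV[R]_n) (u : 'rV[R]_n -> 'rV[R]_N).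
Hypothesis u_meas : measurable_fun setT u.
Context d (T : measurableType d).
Implicit Types X Y : T -> 'rV[R]_n.

Lemma measurable_enormB_powR X Y a : measurable_fun setT X -> measurable_fun setT Y ->
  measurable_fun setT (fun z => enorm (X z - Y z) `^ a).
Proof.
move=> mX mY; apply: (measurableT_comp (f := @powR R ^~ a)).
  exact: measurable_powR.
by apply: measurable_enorm_comp; exact: measurable_rVB.
Qed.

Lemma measurable_growth_f (v w : T -> R) : (forall z, 0 <= v z) -> (forall z, 0 <= w z) ->
  measurable_fun setT v -> measurable_fun setT w ->
  measurable_fun setT (fun z => f (v z / w z)).
Proof.
move=> v0 w0 mv mw; apply: measurable_mono_comp.
- exact: (growth_fmono G).
- by move=> z; rewrite divr_ge0.
- by apply: measurable_funM => //; exact: measurable_funV.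
Qed.

Lemma measurable_test_weight r1 de k1 :
  measurable_fun setT (test_weight M r xB u r1 de k1).
Proof.
apply: measurable_funM.
  apply: measurable_funX; apply: measurable_maxr => //; apply: measurable_minr => //.
  apply: measurable_funM => //; apply: measurable_funB => //.
  by apply: measurable_enorm_comp; exact: measurable_rVB.
have u_meas' : measurable_fun setT (fun x => enorm (u x)) by exact: measurable_enorm_comp.
apply: measurable_funM; last exact: measurable_funV.
by apply: measurable_maxr => //; exact: measurable_funB.
Qed.

Lemma measurable_test_fun r1 de k1 :
  measurable_fun setT (test_fun M r xB u r1 de k1).
Proof. by apply: measurable_rVZ => //; exact: measurable_test_weight. Qed.

Lemma measurable_weak_integrand psi X Y : measurable_fun setT psi ->
  measurable_fun setT X -> measurable_fun setT Y ->
  measurable_fun setT (fun z => weak_integrand f s u psi (X z) (Y z)).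
Proof.
move=> mpsi mX mY.
have muB : measurable_fun setT (fun z => u (X z) - u (Y z)).
  by apply: measurable_rVB; exact: measurableT_comp.
have mpB : measurable_fun setT (fun z => psi (X z) - psi (Y z)).
  by apply: measurable_rVB; exact: measurableT_comp.
have mD : measurable_fun setT (fun z => enorm (u (X z) - u (Y z))).
  exact: measurable_enorm_comp.
have ml : measurable_fun setT (fun z => enorm (X z - Y z)).
  by apply: measurable_enorm_comp; exact: measurable_rVB.
have mL := measurable_enormB_powR s mX mY.
apply: measurable_funM; last by apply: measurable_funV; exact: measurable_funX.
apply: measurable_funM; last exact: measurable_funV.
apply: measurable_funM.
  by apply: measurable_growth_f => // z; rewrite ?enorm_ge0 ?powR_ge0.
apply: measurable_funM; last exact: measurable_funV.
exact: measurable_dotrV.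
Qed.

Lemma measurable_superlevel rho k : measurable (superlevel xB u rho k).
Proof.
apply: measurableI; first exact: measurable_eball.
have m : measurable_fun setT (fun x => enorm (u x)) by exact: measurable_enorm_comp.
have := m measurableT _ (measurable_itv `]k, +oo[); rewrite setTI.
rewrite [X in measurable X -> _](_ : _ = [set x | k < enorm (u x)])//.
by apply/seteqP; split => y; rewrite /= in_itv/= andbT.
Qed.

Lemma measurable_scaled_phi : measurable_fun setT (scaled_phi phi s r u).
Proof.
apply: measurable_mono_comp; first exact: (growth_mono G).
  by move=> x; rewrite mulr_ge0 ?powR_ge0 ?enorm_ge0.
by apply: measurable_funM => //; exact: measurable_enorm_comp.
Qed.

Lemma measurable_tail_integrand : measurable_fun setT (tail_integrand f s xB u).
Proof.
have m a : measurable_fun setT (fun y : 'rV[R]_n => enorm (y - xB) `^ a).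
  apply: (measurableT_comp (f := @powR R ^~ a)); first exact: measurable_powR.
  by apply: measurable_enorm_comp; exact: measurable_rVB.
apply: measurable_funM; last exact: measurable_funV.
apply: measurable_mono_comp; first exact: (growth_fmono G).
  by move=> x; rewrite divr_ge0 ?powR_ge0 ?enorm_ge0.
by apply: measurable_funM; [exact: measurable_enorm_comp|exact: measurable_funV].
Qed.

Lemma measurable_kern beta X Y : measurable_fun setT X -> measurable_fun setT Y ->
  measurable_fun setT (fun z => kern (n := n) beta r (enorm (X z - Y z))).
Proof.
move=> mX mY.
have ml : measurable_fun setT (fun z => enorm (X z - Y z)).
  by apply: measurable_enorm_comp; exact: measurable_rVB.
apply: measurable_funM; last by apply: measurable_funV; exact: measurable_funX.
apply: (measurableT_comp (f := @powR R ^~ beta)); first exact: measurable_powR.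
apply: measurable_minr; first exact: measurable_funM.
by apply: measurable_funM => //; exact: measurable_funV.
Qed.

End integrand_measurability.

Section energy.
Context {R : realType} {n N : nat} (phi f : R -> R) (q : R) (M : nat).
Hypothesis G : growth phi f q M.
Hypothesis n0 : (0 < n)%N.
Variables (s r : R) (xB : 'rV[R]_n) (u : 'rV[R]_n -> 'rV[R]_N).
Hypotheses (s0 : 0 < s) (s1 : s < 1) (r0 : 0 < r).
Hypothesis u_meas : measurable_fun setT u.
Variable Ck : R.
Hypothesis Ck0 : 0 < Ck.
Hypothesis kernC : forall (r : R) (x : 'rV[R]_n), 0 < r ->
  (\int[lebesgue_rV]_y (kern (n := n) (Num.min s (1 - s)) r (enorm (x - y)))%:E <= Ck%:E)%E.
Local Notation leb := (@lebesgue_rV R n).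
Local Open Scope ereal_scope.

Definition energy_on A := \int[leb]_(x in A) (scaled_phi phi s r u x)%:E.
Definition tail_mass := \int[leb]_(y in ~` eball xB r) (tail_integrand f s xB u y)%:E.

Variables (r2 k1 : R).
Local Notation A := (superlevel xB u r2 k1).
Let near := near_part phi s r xB u r2 k1.
Let far := far_part f s r xB u r2 k1.

Let m_near : measurable_fun setT (fun z : 'rV[R]_n * 'rV[R]_n => near z.1 z.2).
Proof.
apply: measurable_funM; last first.
  by apply: measurable_kern; [exact: measurable_fst|exact: measurable_snd].
apply: (measurableT_comp (f := fun x => \1_A x * scaled_phi phi s r u x)%R); last first.
  exact: measurable_fst.
apply: measurable_funM; last exact: (measurable_scaled_phi G).
by apply: measurable_indic; exact: measurable_superlevel.
Qed.

Let m_far : measurable_fun setT (fun z : 'rV[R]_n * 'rV[R]_n => far z.1 z.2).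
Proof.
apply: measurable_funM.
  apply: (measurableT_comp
    (f := fun y => \1_A y * enorm (u y))%R); last first.
    exact: measurable_snd.
  apply: measurable_funM; last exact: measurable_enorm_comp.
  by apply: measurable_indic; exact: measurable_superlevel.
apply: (measurableT_comp
  (f := fun y => \1_(~` eball xB r) y * tail_integrand f s xB u y)%R); last first.
  exact: measurable_fst.
apply: measurable_funM; last exact: (measurable_tail_integrand G).
by apply: measurable_indic; apply: measurableC; exact: measurable_eball.
Qed.

Lemma integral_near_le :
  \int[leb]_x \int[leb]_y (near x y)%:E <= Ck%:E * energy_on A.
Proof.
pose g x := (\1_A x * scaled_phi phi s r u x)%R.
have g0 x : (0 <= g x)%R by rewrite mulr_ge0 ?(scaled_phi_ge0 G).
have mg : measurable_fun setT g.
  apply: measurable_funM; last exact: (measurable_scaled_phi G).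
  by apply: measurable_indic; exact: measurable_superlevel.
rewrite /energy_on -integral_indicM -ge0_integralZl_EFin//; first last.
- exact: ltW.
- exact/measurable_EFinP.
- by move=> x _; rewrite lee_fin; exact: g0.
apply: ge0_le_integralW => x _.
  by apply: integral_ge0 => y _; rewrite lee_fin; exact: (near_part_ge0 G).
rewrite /near /near_part -/(g x); under eq_integral do rewrite EFinM.
rewrite ge0_integralZl_EFin//; first last.
- apply/measurable_EFinP; apply: measurable_kern => //.
- by move=> y _; rewrite lee_fin kern_ge0 ?enorm_ge0.
by rewrite muleC; apply: lee_wpmul2r; rewrite ?lee_fin// kernC.
Qed.

Lemma integral_far_le :
  \int[leb]_x \int[leb]_y (far x y)%:E =
  tail_mass * \int[leb]_(y in A) (enorm (u y))%:E.
Proof.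
pose g y := (\1_A y * enorm (u y))%R.
pose t x := (\1_(~` eball xB r) x * tail_integrand f s xB u x)%R.
have g0 x : (0 <= g x)%R by rewrite mulr_ge0 ?enorm_ge0.
have t0 x : (0 <= t x)%R by rewrite mulr_ge0 ?(tail_integrand_ge0 G).
have mg : measurable_fun setT g.
  apply: measurable_funM; last exact: measurable_enorm_comp.
  by apply: measurable_indic; exact: measurable_superlevel.
have mt : measurable_fun setT t.
  apply: measurable_funM; last exact: (measurable_tail_integrand G).
  by apply: measurable_indic; apply: measurableC; exact: measurable_eball.
rewrite /tail_mass -(integral_indicM _ A) -(integral_indicM _ (~` eball xB r)).
rewrite -ge0_integralZr//; first last.
- by apply: integral_ge0 => y _; rewrite lee_fin; exact: g0.
- by move=> x _; rewrite lee_fin; exact: t0.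
- exact/measurable_EFinP.
apply: eq_integral => x _.
have farE y : far x y = (t x * g y)%R by exact: mulrC.
transitivity (\int[leb]_y ((t x)%:E * (g y)%:E)).
  by apply: eq_integral => y _; rewrite farE EFinM.
rewrite ge0_integralZl_EFin//; first by move=> y _; rewrite lee_fin; exact: g0.
exact/measurable_EFinP.
Qed.

Variables (r1 k2 de rho : R).
Hypotheses (de0 : (0 < de)%R) (de1 : (de <= 1)%R) (rr1 : (r <= r1)%R).
Hypotheses (r12 : (r1 + 2 * (de * r) <= r2)%R) (r22 : (r2 <= 2 * r)%R) (k10 : (0 < k1)%R).
Hypotheses (k20 : (0 < k2)%R) (k12 : (k1 <= (1 - de) * k2)%R).
Hypotheses (rho0 : (0 < rho)%R) (rhor : (rho <= de * r)%R).
Hypothesis A_small : leb A <= (2^-1 * (2 * rho / n%:R) ^+ n)%:E.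
Hypothesis A_fin : energy_on A < +oo.
Hypothesis tail_le :
  tail_mass * \int[leb]_(y in A) (enorm (u y))%:E <= q%:E * energy_on A.
Let psi := test_fun M r xB u r1 de k1.
Let F := weak_integrand f s u psi.
Hypothesis weak : \int[leb]_x \int[leb]_y (F x y)%:E = 0.

Let K1 := (q / 2 * (4 * M%:R) ^+ M * (2 / de) ^+ M)%R.
Let K2 := (q * (8 / de) ^+ M * (2 / de) ^+ n.+1)%R.

Let mF : measurable_fun setT (fun z : 'rV[R]_n * 'rV[R]_n => F z.1 z.2).
Proof.
apply: (measurable_weak_integrand G) => //.
exact: measurable_test_fun.
Qed.

Let q1 : (1 <= q)%R. Proof. exact: growth_q1 G. Qed.

Let q0 : (0 <= q)%R. Proof. exact: le_trans q1. Qed.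

Let K10 : (0 <= K1)%R.
Proof. by rewrite /K1 !mulr_ge0 ?exprn_ge0 ?divr_ge0 ?mulr_ge0 ?(ltW de0). Qed.

Let K20 : (0 <= K2)%R.
Proof. by rewrite /K2 !mulr_ge0 ?exprn_ge0 ?divr_ge0 ?(ltW de0). Qed.

Lemma energy_upper :
  \int[leb]_x \int[leb]_y (Num.max (F x y) 0)%:E <=
  (4 * (K1 * Ck + K2 * q))%:E * energy_on A.
Proof.
pose B x y := (K1 * (near x y + near y x) + K2 * (far x y + far y x))%R.
have near0 x y : (0 <= near x y)%R by exact: (near_part_ge0 G).
have far0 x y : (0 <= far x y)%R by exact: (far_part_ge0 G).
have nn0 x y : (0 <= near x y + near y x)%R by rewrite addr_ge0.
have ff0 x y : (0 <= far x y + far y x)%R by rewrite addr_ge0.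
have EA0 : 0 <= energy_on A.
  by apply: integral_ge0 => x _; rewrite lee_fin (scaled_phi_ge0 G).
have BE : \int[leb]_x \int[leb]_y (B x y)%:E <= (2 * (K1 * Ck + K2 * q))%:E * energy_on A.
  rewrite (integral2_sym _ K10 K20 m_near near0 m_far far0) integral_far_le.
  have hn := integral_near_le.
  have fE : (2 * (K1 * Ck + K2 * q))%:E * energy_on A =
    K1%:E * (Ck%:E * energy_on A + Ck%:E * energy_on A) +
    K2%:E * (q%:E * energy_on A + q%:E * energy_on A).
    move: EA0 A_fin; case: (energy_on A) => [e| |]// _ _.
    by rewrite -!EFinM -!EFinD -?EFinM -?EFinD; congr _%:E; ring.
  rewrite fE; apply: leeD; apply: lee_wpmul2l; rewrite ?lee_fin//; exact: leeD.
have B0 x y : (0 <= B x y)%R by rewrite addr_ge0// mulr_ge0.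
have FB x y : (- F x y <= B x y)%R.
  exact: (weak_integrand_ge G n0 xB u s0 s1 r0 de0 de1 rr1 r12 r22 k10).
have Boo : \int[leb]_x \int[leb]_y (B x y)%:E < +oo.
  apply: (le_lt_trans BE); move: EA0 A_fin; case: (energy_on A) => [e| |]// _ _.
  by rewrite -EFinM ltry.
apply: (le_trans (integral2_pos_le mF B0 FB weak Boo)).
apply: (le_trans (lee_wpmul2l _ BE)); first by rewrite lee_fin.
by rewrite muleA -EFinM mulrA (_ : 2 * 2 = 4)%R// -natrM.
Qed.

(** [A] covers at most half of the ball of radius [rho] around [x], so that the
    rest contributes at least half of its measure. *)
Lemma energy_lower :
  ((de / 2) ^+ M.+1 * (r / rho) `^ s * (2^-1 * (2 / n%:R) ^+ n))%:E *
    energy_on (superlevel xB u r1 k2) <=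
  \int[leb]_x \int[leb]_y (Num.max (F x y) 0)%:E.
Proof.
pose c := ((de / 2) ^+ M.+1 * ((r / rho) `^ s / rho ^+ n))%R.
have c0 : (0 <= c)%R.
  by rewrite /c !mulr_ge0 ?exprn_ge0 ?invr_ge0 ?powR_ge0 ?exprn_ge0 ?divr_ge0
    ?(ltW de0) ?(ltW rho0).
pose b := (2^-1 * (2 * rho / n%:R) ^+ n)%R.
have nR : (0 < n%:R :> R)%R by rewrite ltr0n.
have b0 : (0 <= b)%R.
  by rewrite /b mulr_ge0 ?exprn_ge0 ?divr_ge0 ?mulr_ge0 ?(ltW rho0).
have mA : measurable A by exact: measurable_superlevel.
have ball_ge x : b%:E <= leb (eball x rho `\` A).
  have mb := measurable_eball x rho.
  have := lebesgue_eball_ge x n0 rho0.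
  have -> : ((2 * rho / n%:R) ^+ n = b + b)%R by rewrite /b; field.
  have : leb (eball x rho) <= leb (eball x rho `\` A) + leb A.
    have mD : measurable (eball x rho `\` A) by exact: measurableD.
    have := measureU2 leb mD mA; apply: le_trans; apply: le_measure; rewrite ?inE//.
      exact: measurableU.
    by move=> y xy; have [yA|yA] := pselect (A y); [right|left].
  have A0 : 0 <= leb A by exact: measure_ge0.
  move: A_small A0; rewrite -/b.
  case: (leb A) => [a| |]; [|by []|by move=> _; rewrite leNgt ltNy0].
  rewrite lee_fin => ab _ h1 h2; have := le_trans h2 h1.
  case: (leb (eball x rho `\` A)) => [w| |]; [|by move=> _; rewrite leey|by []].
  by rewrite -EFinD !lee_fin; lra.
have mA2 : measurable (superlevel xB u r1 k2) by exact: measurable_superlevel.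
have step x : superlevel xB u r1 k2 x ->
  (c * b * scaled_phi phi s r u x)%:E <= \int[leb]_y (Num.max (F x y) 0)%:E.
  move=> Ax.
  have sp0 := scaled_phi_ge0 G s r u x.
  apply: (@le_trans _ _ (\int[leb]_(y in eball x rho `\` A) (c * scaled_phi phi s r u x)%:E)).
    rewrite integral_cst; last by apply: measurableD => //; exact: measurable_eball.
    rewrite mulrAC EFinM; apply: lee_wpmul2l; last exact: ball_ge.
    by rewrite lee_fin mulr_ge0.
  apply: (@le_trans _ _ (\int[leb]_(y in eball x rho `\` A) (Num.max (F x y) 0)%:E)).
    apply: ge0_le_integralW => y [yrho nA]; first by rewrite lee_fin mulr_ge0.
    rewrite lee_fin le_max; apply/orP; left.
    have := weak_integrand_le_superlevel G s0 r0 de0 de1 r12 k20 k12 rho0 rhor Ax yrho nA.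
    by apply: le_trans; rewrite /c le_eqVlt; apply/orP; left; apply/eqP; ring.
  by apply: ge0_integral_setS => // y _; rewrite lee_fin le_max lexx orbT.
apply: (@le_trans _ _ (\int[leb]_(x in superlevel xB u r1 k2)
    \int[leb]_y (Num.max (F x y) 0)%:E)).
  have -> : ((de / 2) ^+ M.+1 * (r / rho) `^ s * (2^-1 * (2 / n%:R) ^+ n) = c * b)%R.
    rewrite /c /b [((2 * rho / n%:R) ^+ n)%R]exprMn [((2 * rho) ^+ n)%R]exprMn.
    rewrite [((2 / n%:R) ^+ n)%R]exprMn.
    have : (rho ^+ n != 0)%R by rewrite gt_eqF// exprn_gt0.
    by move: (rho ^+ n)%R => e e0; field; rewrite e0.
  rewrite /energy_on -ge0_integralZl_EFin//; first last.
  - exact: mulr_ge0.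
  - by apply/measurable_EFinP; apply: measurable_funTS; exact: (measurable_scaled_phi G).
  - by move=> x _; rewrite lee_fin; exact: (scaled_phi_ge0 G).
  apply: ge0_le_integralW => x Ax; last by rewrite -EFinM; exact: step.
  by rewrite -EFinM lee_fin; apply: mulr_ge0; [exact: mulr_ge0|exact: (scaled_phi_ge0 G)].
apply: ge0_integral_setS => // x _; apply: integral_ge0 => y _.
by rewrite lee_fin le_max lexx orbT.
Qed.

(** The two bounds for the positive part combined, with all powers of [2 / de]
    collected so that the remaining constant depends on [q], [s], [n] only. *)
Lemma energy_decay :
  energy_on (superlevel xB u r1 k2) <=
  (8 * (q / 2 * (4 * M%:R) ^+ M * Ck + q * 4 ^+ M * q) / (2 / n%:R) ^+ n *
   (2 / de) ^+ (M.+1 + (M + n.+1)) * (rho / r) `^ s)%:E * energy_on A.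
Proof.
have H := le_trans energy_lower energy_upper.
have nR : (0 < n%:R :> R)%R by rewrite ltr0n.
have E20 : 0 <= energy_on (superlevel xB u r1 k2).
  by apply: integral_ge0 => x _; rewrite lee_fin (scaled_phi_ge0 G).
have EA0 : 0 <= energy_on A.
  by apply: integral_ge0 => x _; rewrite lee_fin (scaled_phi_ge0 G).
pose e := (2 / de)%R; have e0 : (0 < e)%R by rewrite divr_gt0.
have e1 : (1 <= e)%R by rewrite /e ler_pdivlMr// mul1r (le_trans de1)// ler1n.
pose L := ((de / 2) ^+ M.+1 * (r / rho) `^ s * (2^-1 * (2 / n%:R) ^+ n))%R.
have L0 : (0 < L)%R.
  by rewrite /L !mulr_gt0 ?exprn_gt0 ?powR_gt0 ?divr_gt0.
have Li : (L^-1 = e ^+ M.+1 * (rho / r) `^ s * (2 / (2 / n%:R) ^+ n))%R.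
  have E1 : (((de / 2) ^+ M.+1)^-1 = e ^+ M.+1)%R by rewrite -exprVn invf_div.
  have E2 : (((r / rho) `^ s)^-1 = (rho / r) `^ s)%R.
    by rewrite -powRV ?invf_div// divr_ge0 ?(ltW r0) ?(ltW rho0).
  by rewrite /L invfM invfM E1 E2 invfM invrK.
have KU : (4 * (K1 * Ck + K2 * q) <=
   4 * (q / 2 * (4 * M%:R) ^+ M * Ck + q * 4 ^+ M * q) * e ^+ (M + n.+1))%R.
  have -> : (K1 * Ck = q / 2 * (4 * M%:R) ^+ M * Ck * e ^+ M)%R.
    by rewrite /K1 -/e; ring.
  have -> : (K2 * q = q * 4 ^+ M * q * e ^+ (M + n.+1))%R.
    rewrite /K2 -/e exprD (_ : 8 / de = 4 * e)%R; last by rewrite /e; field; rewrite gt_eqF.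
    by rewrite exprMn; ring.
  rewrite -[leRHS]mulrA ler_wpM2l// [leRHS]mulrDl lerD2r ler_wpM2l//.
    by rewrite !mulr_ge0 ?exprn_ge0 ?mulr_ge0 ?(ltW Ck0).
  by rewrite ler_weXn2l// leq_addr.
move: E20 H; rewrite -/L.
case: (energy_on (superlevel xB u r1 k2)) => [E2| |] // _; last first.
  rewrite gt0_muley ?lte_fin// => H; exfalso; move: H.
  move: EA0 A_fin; case: (energy_on A) => [a| |]//= _ _.
move: EA0 A_fin; case: (energy_on A) => [a| |]//= a0 _.
rewrite -!EFinM !lee_fin => H.
rewrite lee_fin in a0.
have {H} : (E2 <= L^-1 * (4 * (K1 * Ck + K2 * q) * a))%R.
  by rewrite ler_pdivlMl.
move=> /le_trans; apply.
apply: (@le_trans _ _ (L^-1 *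
  (4 * (q / 2 * (4 * M%:R) ^+ M * Ck + q * 4 ^+ M * q) * e ^+ (M + n.+1) * a))%R).
  by rewrite ler_wpM2l ?invr_ge0 ?(ltW L0)// ler_wpM2r.
rewrite Li le_eqVlt; apply/orP; left; apply/eqP.
rewrite -/e [(e ^+ (M.+1 + (M + n.+1)))%R]exprD.
move: (e ^+ M.+1)%R (e ^+ (M + n.+1))%R => X Y.
move: ((rho / r) `^ s)%R ((2 / n%:R) ^+ n)^-1%R ((4 * M%:R) ^+ M)%R (4 ^+ M)%R => *; ring.
Qed.

End energy.


(** * Admissibility of the test function *)

Section excess_lipschitz.
Context {R : realType}.

(** The contraction property of [v -> (|v|-k)_+ v/|v|] in terms of the moduli:
    the factor [c <= a] offsets the slope [k/a^2] of [excess k]. *)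
Lemma excess_sub_le (k a c : R) : 0 < k -> 0 <= c -> c <= a ->
  (excess k a - excess k c) * c <= a - c.
Proof.
move=> k0 c0 ca; have [ak|ka] := leP a k.
  by rewrite !excess_eq0 ?(le_trans ca)// subrr mul0r subr_ge0.
have a0 : 0 < a by exact: lt_trans ka.
have ca1 : c / a <= 1 by rewrite ler_pdivrMr// mul1r.
rewrite (excess_gtE (ltW ka) a0); have [ck|kc] := leP c k.
  rewrite (excess_eq0 ck) subr0.
  have -> : (1 - k / a) * c = (a - k) * (c / a) by field; rewrite gt_eqF.
  have : (a - k) * (c / a) <= a - k by rewrite ler_piMr// subr_ge0 ltW.
  by lra.
have cgt0 : 0 < c by exact: lt_trans kc.
rewrite (excess_gtE (ltW kc) cgt0).
have -> : (1 - k / a - (1 - k / c)) * c = (a - c) * (k / a).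
  by field; rewrite !gt_eqF.
by rewrite ler_piMr ?subr_ge0// ler_pdivrMr// mul1r ltW.
Qed.

End excess_lipschitz.

Section test_function.
Context {R : realType} {n N : nat} (phi f : R -> R) (q : R) (M : nat).
Hypothesis G : growth phi f q M.
Hypothesis n0 : (0 < n)%N.
Variables (s r : R) (xB : 'rV[R]_n) (u : 'rV[R]_n -> 'rV[R]_N).
Hypotheses (s0 : 0 < s) (s1 : s < 1) (r0 : 0 < r).
Variables (r1 de k1 : R).
Hypotheses (de0 : 0 < de) (de1 : de <= 1) (k10 : 0 < k1).
Local Notation g := (test_weight M r xB u r1 de k1).
Local Notation psi := (test_fun M r xB u r1 de k1).
Local Notation eta x := (cutoff r1 (de * r) (enorm (x - xB))).

Let dr0 : 0 < de * r. Proof. exact: mulr_gt0. Qed.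

Let g0 x : 0 <= g x. Proof. exact: test_weight_ge0. Qed.

Let g1 x : g x <= 1. Proof. exact: test_weight_le1. Qed.

Lemma enorm_test_fun_le x : enorm (psi x) <= enorm (u x).
Proof. by rewrite enormZ ger0_norm// ler_piMl ?enorm_ge0. Qed.

Let expr_eta_sub_le (a b : R) : 0 <= a -> a <= 1 -> 0 <= b -> b <= 1 ->
  `|a ^+ M - b ^+ M| <= M%:R * `|a - b|.
Proof.
wlog ab : a b / b <= a.
  move=> H; have [ba|/ltW ab] := leP b a; first exact: H.
  by rewrite distrC [`|a - b|]distrC => *; exact: H.
move=> a0 a1 b0 b1.
have [m ->] : exists m, M = m.+1 by case: (M) (growth_M0 G) => // m; exists m.
rewrite !ger0_norm ?subr_ge0 ?lerXn2r ?nnegrE//.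
apply: (le_trans (expr_sub_le m b0 ab)).
by rewrite ler_piMr ?mulr_ge0 ?subr_ge0// exprn_ile1.
Qed.

(** Moving [u] changes [g u] by at most twice as much, once through [u] and once
    through the truncation; the cut-off accounts for the rest. *)
Lemma enorm_test_fun_sub_le x y :
  enorm (psi x - psi y) <=
  2 * enorm (u x - u y) + M%:R * `|eta x - eta y| * enorm (u x).
Proof.
suff main : forall x y, enorm (u y) <= enorm (u x) ->
    enorm (psi x - psi y) <=
    2 * enorm (u x - u y) + M%:R * `|eta x - eta y| * enorm (u y).
  have [ca|/ltW ac] := leP (enorm (u y)) (enorm (u x)).
    apply: (le_trans (main _ _ ca)); rewrite lerD2l.
    by apply: ler_wpM2l => //; exact: mulr_ge0.
  by rewrite (enormB (psi x)) (enormB (u x)) distrC; exact: main.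
move=> {}x {}y ca.
have -> : psi x - psi y = g x *: (u x - u y) + (g x - g y) *: u y.
  by rewrite /test_fun scalerBr scalerBl addrA subrK.
apply: (le_trans (enormD _ _)); rewrite !enormZ (ger0_norm (g0 x)).
have h1 : g x * enorm (u x - u y) <= enorm (u x - u y).
  by rewrite ler_piMl ?enorm_ge0.
suff : `|g x - g y| * enorm (u y) <=
    enorm (u x - u y) + M%:R * `|eta x - eta y| * enorm (u y).
  by move: h1; lra.
set hx := excess k1 (enorm (u x)); set hy := excess k1 (enorm (u y)).
have hxy : 0 <= hx - hy by rewrite subr_ge0 excess_mono ?enorm_ge0.
have hy0 : 0 <= hy by rewrite excess_ge0 ?enorm_ge0.
have -> : g x - g y = eta x ^+ M * (hx - hy) + (eta x ^+ M - eta y ^+ M) * hy.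
  by rewrite /test_weight -/hx -/hy; ring.
apply: (@le_trans _ _ ((eta x ^+ M * (hx - hy) +
    `|eta x ^+ M - eta y ^+ M| * hy) * enorm (u y))).
  rewrite ler_wpM2r ?enorm_ge0// (le_trans (ler_normD _ _))// normrM [X in _ + X <= _]normrM.
  rewrite (ger0_norm hxy) (ger0_norm hy0).
  by rewrite ger0_norm// exprn_ge0 ?cutoff_ge0.
rewrite mulrDl lerD//.
  apply: (@le_trans _ _ ((hx - hy) * enorm (u y))).
    rewrite ler_wpM2r ?enorm_ge0// ler_piMl// exprn_ile1 ?cutoff_ge0 ?cutoff_le1//.
  apply: (le_trans (excess_sub_le k10 (enorm_ge0 _) ca)).
  exact: enorm_sub_le.
rewrite ler_wpM2r ?enorm_ge0//.
apply: (@le_trans _ _ (`|eta x ^+ M - eta y ^+ M|)).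
  by rewrite ler_piMr// excess_le1 ?enorm_ge0 ?(ltW k10).
by apply: expr_eta_sub_le; rewrite ?cutoff_ge0 ?cutoff_le1.
Qed.

Lemma abs_cutoff_sub_le x y : `|eta x - eta y| <= enorm (x - y) / (de * r).
Proof.
rewrite ler_norml; apply/andP; split.
  rewrite lerNl opprB; apply: (le_trans (cutoff_sub_le _ _ _ dr0)).
  by rewrite (enormB x y) ler_wpM2r ?invr_ge0 ?(ltW dr0)//; exact: enorm_dist_sub.
apply: (le_trans (cutoff_sub_le _ _ _ dr0)).
by rewrite ler_wpM2r ?invr_ge0 ?(ltW dr0)//; exact: enorm_dist_sub.
Qed.

Lemma abs_cutoff_sub_le1 x y : `|eta x - eta y| <= 1.
Proof.
rewrite ler_norml; apply/andP; split.
  rewrite lerNl opprB lerBlDr; apply: (le_trans (cutoff_le1 _ _ _)).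
  by rewrite lerDl cutoff_ge0.
by rewrite lerBlDr; apply: (le_trans (cutoff_le1 _ _ _)); rewrite lerDl cutoff_ge0.
Qed.

Lemma phi_scale_le (C t : R) : 0 <= C -> 0 <= t ->
  phi (C * t) <= (2 * (1 + C)) ^+ M * phi t.
Proof.
move=> C0 t0; apply: (@le_trans _ _ (phi ((1 + C) * t))).
  by apply: (growth_mono G); rewrite ?mulr_ge0// ler_wpM2r// lerDr.
by apply: (growth_dilate G) => //; rewrite lerDl.
Qed.

Lemma phi_test_fun_sub_le (lam : R) x y : 0 < lam ->
  phi (enorm (psi x - psi y) / (lam * enorm (x - y) `^ s)) / enorm (x - y) ^+ n <=
  4 ^+ M * (phi (enorm (u x - u y) / (lam * enorm (x - y) `^ s)) / enorm (x - y) ^+ n) +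
  2 ^+ M * (2 * (1 + M%:R / lam)) ^+ M * (2 / de) ^+ M *
    (scaled_phi phi s r u x * kern (n := n) (Num.min s (1 - s)) r (enorm (x - y))).
Proof.
move=> lam0; set l := enorm (x - y).
have D0 := enorm_ge0 (u x - u y).
have RHS0 : 0 <= 2 ^+ M * (2 * (1 + M%:R / lam)) ^+ M * (2 / de) ^+ M *
    (scaled_phi phi s r u x * kern (n := n) (Num.min s (1 - s)) r l).
  have kl : 0 <= kern (n := n) (Num.min s (1 - s)) r l by exact/kern_ge0/enorm_ge0.
  have sx : 0 <= scaled_phi phi s r u x by exact: (scaled_phi_ge0 G).
  have C0 : 0 <= 2 * (1 + M%:R / lam) by rewrite mulr_ge0// addr_ge0// divr_ge0// ltW.
  apply: mulr_ge0; last exact: mulr_ge0.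
  by apply: mulr_ge0; [apply: mulr_ge0; exact: exprn_ge0|rewrite exprn_ge0// divr_ge0// ltW].
have : 0 <= l by exact: enorm_ge0.
rewrite le_eqVlt => /predU1P[lE|l0].
  rewrite -lE expr0n gtn_eqF// invr0 !mulr0 add0r.
  by move: RHS0; rewrite -lE.
have ls0 : 0 < l `^ s by rewrite powR_gt0.
have L0 : 0 < lam * l `^ s by rewrite mulr_gt0.
have Z0 : 0 <= (l ^+ n)^-1 by rewrite invr_ge0 exprn_ge0// ltW.
set d := `|eta x - eta y|; have d0 : 0 <= d by exact: normr_ge0.
have a0 := enorm_ge0 (u x).
have da0 : 0 <= d * enorm (u x) / l `^ s by rewrite divr_ge0 ?mulr_ge0// ltW.
have DL0 : 0 <= enorm (u x - u y) / (lam * l `^ s) by rewrite divr_ge0// ltW.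
have split_le : phi (enorm (psi x - psi y) / (lam * l `^ s)) <=
   4 ^+ M * phi (enorm (u x - u y) / (lam * l `^ s)) +
   2 ^+ M * ((2 * (1 + M%:R / lam)) ^+ M * phi (d * enorm (u x) / l `^ s)).
  have Mda0 : 0 <= M%:R / lam * (d * enorm (u x) / l `^ s).
    by rewrite mulr_ge0// divr_ge0// ltW.
  apply: (@le_trans _ _ (phi (2 * (enorm (u x - u y) / (lam * l `^ s)) +
     M%:R / lam * (d * enorm (u x) / l `^ s)))).
    apply: (growth_mono G); first by rewrite divr_ge0 ?enorm_ge0// ltW.
    have := enorm_test_fun_sub_le x y; rewrite -/d => H.
    have -> : 2 * (enorm (u x - u y) / (lam * l `^ s)) +
      M%:R / lam * (d * enorm (u x) / l `^ s) =
      (2 * enorm (u x - u y) + M%:R * d * enorm (u x)) / (lam * l `^ s).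
      by field; rewrite !gt_eqF.
    by rewrite ler_wpM2r ?invr_ge0 ?(ltW L0).
  have D20 : 0 <= 2 * (enorm (u x - u y) / (lam * l `^ s)) by rewrite mulr_ge0.
  apply: (le_trans (growth_add G D20 Mda0)); rewrite mulrDr lerD//.
    have -> : 4 ^+ M = 2 ^+ M * 2 ^+ M :> R by rewrite -exprMn -natrM.
    by rewrite -mulrA ler_wpM2l ?exprn_ge0// (growth_double G).
  by rewrite ler_wpM2l ?exprn_ge0// phi_scale_le// divr_ge0// ltW.
have := phi_cutoff_kern (n := n) G s0 s1 r0 de0 de1 a0 l0 d0 (abs_cutoff_sub_le1 x y)
  (abs_cutoff_sub_le x y); rewrite -/d => cut.
have C0 : 0 <= 2 ^+ M * (2 * (1 + M%:R / lam)) ^+ M.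
  by rewrite mulr_ge0 ?exprn_ge0// mulr_ge0// addr_ge0// divr_ge0// ltW.
apply: (le_trans (ler_wpM2r Z0 split_le)).
rewrite mulrDl -[4 ^+ M * _ / _]mulrA lerD2l.
have -> : 2 ^+ M * ((2 * (1 + M%:R / lam)) ^+ M * phi (d * enorm (u x) / l `^ s)) / l ^+ n =
  2 ^+ M * (2 * (1 + M%:R / lam)) ^+ M * (phi (d * enorm (u x) / l `^ s) / l ^+ n).
  by ring.
apply: (le_trans (ler_wpM2l C0 cut)).
by rewrite /scaled_phi !mulrA.
Qed.

End test_function.


Section support.
Context {R : realType} {n : nat}.

Lemma continuous_enormB (x0 : 'rV[R]_n) : continuous (fun x : 'rV[R]_n => enorm (x - x0)).
Proof.
have cc i : continuous (fun x : 'rV[R]_n => (x - x0) ord0 i).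
  have -> : (fun x : 'rV[R]_n => (x - x0) ord0 i) = (fun x => x ord0 i - x0 ord0 i).
    by apply/funext => y; rewrite !mxE.
  move=> x; apply: (@continuousB _ _ _ (fun x : 'rV[R]_n => x ord0 i : R^o)
    (cst (x0 ord0 i)) x).
    exact: coord_continuous.
  exact: cst_continuous.
have cd : continuous (fun x : 'rV[R]_n => dotrV (x - x0) (x - x0) : R^o).
  apply: (@continuous_big R^o _ +%R 0 xpredT) => [|i _ x]; first exact: add_continuous.
  by apply: (continuousM (cc i x) (cc i x)).
move=> x; apply: (cvg_comp (fun x : 'rV[R]_n => dotrV (x - x0) (x - x0) : R^o) (@Num.sqrt R)).
  exact: cd.
exact: sqrt_continuous.
Qed.

(** The support is closed and lies in a product of segments. *)
Lemma compact_ess_support N (v : 'rV[R]_n -> 'rV[R]_N) (x0 : 'rV[R]_n) (rho : R) :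
  (forall x, rho < enorm (x - x0) -> v x = 0) ->
  compact (ess_support v) /\ ess_support v `<=` [set x | enorm (x - x0) <= rho].
Proof.
move=> v0; have sub : ess_support v `<=` [set x | enorm (x - x0) <= rho].
  move=> x /= vx; rewrite leNgt; apply/negP => xr.
  apply: (vx [set y | rho < enorm (y - x0)]) => //=.
    have : open ((fun y : 'rV[R]_n => enorm (y - x0)) @^-1` [set t : R | rho < t]).
      apply: open_comp; last exact: open_gt.
      by move=> y _; exact: continuous_enormB.
    exact.
  by apply: aeW => y /=; exact: v0.
split => //.
apply: (@subclosed_compact _ _ [set w : 'rV[R]_n | forall i,
    `[x0 ord0 i - rho, x0 ord0 i + rho]%classic (w ord0 i)]).
- rewrite -openC openE => x /existsNP [U /not_implyP [oU /not_implyP [Ux /contrapT vU]]].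
  rewrite /interior/=; apply: filterS (open_nbhs_nbhs (conj oU Ux)).
  by move=> y Uy /(_ U oU Uy).
- apply: (@rV_compact _ n (fun i => `[x0 ord0 i - rho, x0 ord0 i + rho]%classic)) => i.
  exact: segment_compact.
- move=> x /sub /= xr i; have := le_trans (coord_le_enorm (x - x0) i) xr.
  by rewrite !mxE ler_norml in_itv/= => /andP[? ?]; apply/andP; split; lra.
Qed.

End support.

Section tail_bound.
Context {R : realType} {n N : nat} {phi f : R -> R} {q : R} {M : nat}.
Hypothesis G : growth phi f q M.

(** [f t] is at most [f 1] for [t <= 1] and at most [q * phi t] for [t >= 1];
    beyond [r] the weight [z^-(n+s)] is a multiple of the kernel, and bounded. *)
Lemma tail_integrand_le (s r : R) (xB : 'rV[R]_n) (u : 'rV[R]_n -> 'rV[R]_N) y :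
  0 < s -> s < 1 -> 0 < r -> r <= enorm (y - xB) ->
  tail_integrand f s xB u y <=
  f 1 / r `^ s * kern (n := n) (Num.min s (1 - s)) r (enorm (y - xB)) +
  q / r `^ (n%:R + s) * scaled_phi phi s r u y.
Proof.
move=> s0 s1 r0; rewrite /tail_integrand /kern; set z := enorm (y - xB) => rz.
have z0 : 0 < z by exact: lt_le_trans rz.
have zs0 : 0 < z `^ s by rewrite powR_gt0.
have rs0 : 0 < r `^ s by rewrite powR_gt0.
have a0 := enorm_ge0 (u y).
have rzs : r `^ s <= z `^ s by rewrite ge0_ler_powR ?nnegrE ?(ltW s0) ?(ltW r0) ?(ltW z0).
have az0 : 0 <= enorm (u y) / z `^ s by rewrite divr_ge0 ?(ltW zs0).
have q0 : 0 <= q by rewrite (le_trans ler01)// (growth_q1 G).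
have f10 : 0 <= f 1 by rewrite (growth_f_ge0 G).
have phir : phi (enorm (u y) / z `^ s) <= scaled_phi phi s r u y.
  apply: (growth_mono G) => //; rewrite powRN mulrC ler_wpM2r//.
  by rewrite lef_pV2 ?posrE.
have ff : f (enorm (u y) / z `^ s) <= f 1 + q * scaled_phi phi s r u y.
  have sp0 := scaled_phi_ge0 G s r u y.
  have [t1|t1] := leP (enorm (u y) / z `^ s) 1.
    by rewrite (le_trans (growth_fmono G az0 t1))// lerDl mulr_ge0.
  have t0 : 0 <= f (enorm (u y) / z `^ s) by rewrite (growth_f_ge0 G).
  apply: (@le_trans _ _ (q * scaled_phi phi s r u y)); last by rewrite lerDr.
  apply: (@le_trans _ _ (q * phi (enorm (u y) / z `^ s))); last by rewrite ler_wpM2l.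
  by apply: le_trans (growth_f_le G az0); rewrite ler_peMr// ltW.
have zns : 0 < z `^ (n%:R + s) by rewrite powR_gt0.
have rns : 0 < r `^ (n%:R + s) by rewrite powR_gt0.
apply: (@le_trans _ _ ((f 1 + q * scaled_phi phi s r u y) / z `^ (n%:R + s))).
  by rewrite ler_wpM2r ?invr_ge0 ?(ltW zns).
rewrite mulrDl lerD//.
  rewrite -mulrA ler_wpM2l//.
  have mE : Num.min (z / r) (r / z) = r / z.
    by rewrite min_r// ler_pdivrMr// mulrAC ler_pdivlMr// ler_pM// ltW.
  have rz1 : r / z <= 1 by rewrite ler_pdivrMr// mul1r.
  have H : (r / z) `^ s <= (r / z) `^ Num.min s (1 - s).
    by apply: ger_powR; rewrite ?divr_gt0 ?rz1// ge_min lexx.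
  rewrite mE.
  have -> : (z `^ (n%:R + s))^-1 = (r `^ s)^-1 * ((r / z) `^ s / z ^+ n).
    rewrite powRD; last by apply/implyP => _; rewrite gt_eqF.
    rewrite powR_mulrn ?(ltW z0)// powRM ?invr_ge0 ?(ltW r0) ?(ltW z0)//.
    rewrite (powRV s (ltW z0)).
    by field; rewrite !gt_eqF// exprn_gt0.
  rewrite ler_wpM2l ?invr_ge0 ?(ltW rs0)// ler_wpM2r ?invr_ge0 ?exprn_ge0 ?(ltW z0)//.
rewrite mulrAC ler_wpM2r ?(scaled_phi_ge0 G)// ler_wpM2l//.
rewrite lef_pV2 ?posrE// ge0_ler_powR ?nnegrE ?(ltW r0) ?(ltW z0)//.
by rewrite addr_ge0// ltW.
Qed.

End tail_bound.

Section test_function_space.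
Context {R : realType} {n N : nat} {phi f : R -> R} {q : R} {M : nat}.
Hypothesis G : growth phi f q M.
Hypothesis n0 : (0 < n)%N.
Variables (s r : R) (xB : 'rV[R]_n) (u : 'rV[R]_n -> 'rV[R]_N).
Hypotheses (s0 : 0 < s) (s1 : s < 1) (r0 : 0 < r).
Variable Ck : R.
Hypothesis kernC : forall (r : R) (x : 'rV[R]_n), 0 < r ->
  (\int[lebesgue_rV]_y (kern (n := n) (Num.min s (1 - s)) r (enorm (x - y)))%:E <= Ck%:E)%E.
Hypothesis uW : Wsphi s phi u.
Local Open Scope ereal_scope.
Local Notation leb := (@lebesgue_rV R n).

Let u_meas : measurable_fun setT u. Proof. by case: uW => -[[]]. Qed.

Lemma scaled_phi_lty : \int[leb]_x (scaled_phi phi s r u x)%:E < +oo.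
Proof.
have [[_ [lam [lam0 ulam]]] _] := uW.
pose C := (r `^ (- s) * lam)%R.
have C0 : (0 <= C)%R by rewrite mulr_ge0 ?powR_ge0 ?(ltW lam0).
pose K := ((2 * (1 + C)) ^+ M)%R.
have K0 : (0 <= K)%R by rewrite exprn_ge0// mulr_ge0// addr_ge0.
have ul0 x : (0 <= enorm (u x) / lam)%R by rewrite divr_ge0 ?enorm_ge0 ?(ltW lam0).
apply: (@le_lt_trans _ _ (\int[leb]_x (K%:E * (phi (enorm (u x) / lam))%:E))).
  apply: ge0_le_integralW => x _; first by rewrite lee_fin (scaled_phi_ge0 G).
  rewrite -EFinM lee_fin /scaled_phi.
  have -> : (r `^ (- s) * enorm (u x) = C * (enorm (u x) / lam))%R.
    by rewrite /C; field; rewrite gt_eqF.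
  exact: (phi_scale_le G).
rewrite ge0_integralZl_EFin//.
- by rewrite lte_mul_pinfty ?lee_fin.
- by move=> x _; rewrite lee_fin (growth_ge0 G).
- apply/measurable_EFinP; apply: (measurable_mono_comp (growth_mono G)) => //.
  by apply: measurable_funM => //; exact: measurable_enorm_comp.
Qed.

Variables (r1 r2 de k1 : R).
Hypotheses (de0 : (0 < de)%R) (de1 : (de <= 1)%R) (k10 : (0 < k1)%R).
Hypotheses (r12 : (r1 + 2 * (de * r) <= r2)%R) (r22 : (r2 <= 2 * r)%R).
Local Notation psi := (test_fun M r xB u r1 de k1).

Lemma test_fun_Wsphi : Wsphi s phi psi.
Proof.
have [[[_ uK] [lam [lam0 ulam]]] [lam' [lam'0 ulam']]] := uW.
have mpsi : measurable_fun setT psi by exact: measurable_test_fun.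
have psiu x : (enorm (psi x) <= enorm (u x))%R by exact: enorm_test_fun_le.
split; [split; [split => // K cK|]|].
- apply: le_lt_trans (uK K cK); apply: ge0_le_integralW => x _; rewrite lee_fin//.
  exact: enorm_ge0.
- exists lam; split => //; apply: le_lt_trans ulam; apply: ge0_le_integralW => x _.
    by rewrite lee_fin (growth_ge0 G)// divr_ge0 ?enorm_ge0 ?(ltW lam0).
  rewrite lee_fin (growth_mono G) ?divr_ge0 ?enorm_ge0 ?(ltW lam0)//.
  by rewrite ler_wpM2r ?invr_ge0 ?(ltW lam0).
exists lam'; split; first exact: lam'0.
pose S x y := (phi (enorm (u x - u y) / (lam' * enorm (x - y) `^ s)) / enorm (x - y) ^+ n)%R.
pose K x y := (scaled_phi phi s r u x * kern (n := n) (Num.min s (1 - s)) r (enorm (x - y)))%R.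
pose a := (4 ^+ M : R)%R.
pose b := (2 ^+ M * (2 * (1 + M%:R / lam')) ^+ M * (2 / de) ^+ M)%R.
have a0 : (0 <= a)%R by rewrite exprn_ge0.
have b0 : (0 <= b)%R.
  apply: mulr_ge0; last by rewrite exprn_ge0// divr_ge0// ltW.
  by rewrite mulr_ge0 ?exprn_ge0// mulr_ge0// addr_ge0// divr_ge0// ltW.
have arg0 x y : (0 <= enorm (u x - u y) / (lam' * enorm (x - y) `^ s))%R.
  by rewrite divr_ge0 ?mulr_ge0 ?powR_ge0 ?enorm_ge0 ?(ltW lam'0).
have S0 x y : (0 <= S x y)%R.
  by rewrite divr_ge0 ?exprn_ge0 ?enorm_ge0// (growth_ge0 G).
have K0 x y : (0 <= K x y)%R.
  apply: mulr_ge0; [exact: (scaled_phi_ge0 G)|exact/kern_ge0/enorm_ge0].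
have mf := @measurable_fst _ _ 'rV[R]_n 'rV[R]_n.
have ms := @measurable_snd _ _ 'rV[R]_n 'rV[R]_n.
have mS : measurable_fun setT (fun z : 'rV[R]_n * 'rV[R]_n => S z.1 z.2).
  apply: measurable_funM; last first.
    apply: measurable_funV; apply: measurable_funX; apply: measurable_enorm_comp.
    exact: measurable_rVB.
  apply: (measurable_mono_comp (growth_mono G)); first by move=> z; exact: arg0.
  apply: measurable_funM.
    apply: measurable_enorm_comp; apply: measurable_rVB; exact: measurableT_comp.
  apply: measurable_funV; apply: measurable_funM => //.
  exact: measurable_enormB_powR.
have mK : measurable_fun setT (fun z : 'rV[R]_n * 'rV[R]_n => K z.1 z.2).
  apply: measurable_funM; last exact: measurable_kern.
  by apply: measurableT_comp => //; exact: (measurable_scaled_phi G).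
apply: (@le_lt_trans _ _ (\int[leb]_x \int[leb]_y (a * S x y + b * K x y)%:E)).
  apply: ge0_le_integralW => x _.
    apply: integral_ge0 => y _; rewrite lee_fin divr_ge0 ?exprn_ge0 ?enorm_ge0//.
    by rewrite (growth_ge0 G)// divr_ge0 ?mulr_ge0 ?powR_ge0 ?enorm_ge0 ?(ltW lam'0).
  apply: ge0_le_integralW => y _.
    rewrite lee_fin divr_ge0 ?exprn_ge0 ?enorm_ge0//.
    by rewrite (growth_ge0 G)// divr_ge0 ?mulr_ge0 ?powR_ge0 ?enorm_ge0 ?(ltW lam'0).
  by rewrite lee_fin; exact: (phi_test_fun_sub_le G).
rewrite (@integral2D _ _ _ _ (fun x y => a * S x y)%R (fun x y => b * K x y)%R); first last.
- by move=> x y; exact: mulr_ge0.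
- exact: measurable_funM.
- by move=> x y; exact: mulr_ge0.
- exact: measurable_funM.
rewrite (@integral2Zl _ _ _ _ S _ a0 mS S0) (@integral2Zl _ _ _ _ K _ b0 mK K0).
have Kfin : \int[leb]_x \int[leb]_y (K x y)%:E < +oo.
  apply: (@le_lt_trans _ _ (\int[leb]_x (Ck%:E * (scaled_phi phi s r u x)%:E))).
    apply: ge0_le_integralW => x _; first by apply: integral_ge0 => y _; rewrite lee_fin.
    have KE : \int[leb]_y (K x y)%:E = (scaled_phi phi s r u x)%:E *
       \int[leb]_y (kern (n := n) (Num.min s (1 - s)) r (enorm (x - y)))%:E.
      rewrite -ge0_integralZl_EFin//.
      - by move=> y _; rewrite lee_fin; exact/kern_ge0/enorm_ge0.
      - by apply/measurable_EFinP; apply: measurable_kern.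
      - exact: (scaled_phi_ge0 G).
    by rewrite KE muleC lee_wpmul2r ?lee_fin ?(scaled_phi_ge0 G)// kernC.
  have Ck0 : (0 <= Ck)%R.
    rewrite -lee_fin; apply: le_trans (kernC 0%R ltr01).
    by apply: integral_ge0 => y _; rewrite lee_fin; exact/kern_ge0/enorm_ge0.
  rewrite ge0_integralZl_EFin//.
  - by rewrite lte_mul_pinfty ?lee_fin// scaled_phi_lty.
  - by move=> x _; rewrite lee_fin (scaled_phi_ge0 G).
  - by apply/measurable_EFinP; exact: (measurable_scaled_phi G).
by rewrite lte_add_pinfty// lte_mul_pinfty ?lee_fin.
Qed.

Lemma test_fun_Wsphi_c Omega : eball xB (2 * r) `<=` Omega -> Wsphi_c s phi Omega psi.
Proof.
move=> sub.
have psi0 x : (r1 + de * r < enorm (x - xB))%R -> psi x = 0%R.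
  move=> xr; rewrite /test_fun /test_weight cutoff_eq0 ?mulr_gt0 ?(ltW xr)//.
  by rewrite expr0n gtn_eqF ?(growth_M0 G)// mul0r scale0r.
have [cpt ss] := compact_ess_support psi0.
split; [exact: test_fun_Wsphi|exact: cpt|].
move=> x /ss /= xr; apply: sub; rewrite /eball/= (le_lt_trans xr)//.
have dr0 : (0 < de * r)%R by exact: mulr_gt0.
by move: dr0 r12 r22; lra.
Qed.

Lemma tail_mass_lty : tail_mass f s r xB u < +oo.
Proof.
have rs0 : (0 < r `^ s)%R by rewrite powR_gt0.
have q0 : (0 <= q)%R by rewrite (le_trans ler01)// (growth_q1 G).
pose a := (f 1 / r `^ s)%R; pose b := (q / r `^ (n%:R + s))%R.
have f10 : (0 <= f 1)%R by rewrite (growth_f_ge0 G).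
have a0 : (0 <= a)%R by rewrite divr_ge0 ?powR_ge0.
have b0 : (0 <= b)%R by rewrite divr_ge0 ?powR_ge0.
(* The kernel around [xB] takes the constant [f 1]. *)
pose kx y := (kern (n := n) (Num.min s (1 - s)) r (enorm (xB - y)))%:E.
have k0 y : 0 <= kx y by rewrite lee_fin; exact/kern_ge0/enorm_ge0.
have mk : measurable_fun setT kx by apply/measurable_EFinP; exact: measurable_kern.
have sp0 y : 0 <= (scaled_phi phi s r u y)%:E by rewrite lee_fin (scaled_phi_ge0 G).
have msp : measurable_fun setT (fun y => (scaled_phi phi s r u y)%:E).
  by apply/measurable_EFinP; exact: (measurable_scaled_phi G).
apply: (@le_lt_trans _ _ (\int[leb]_y (a%:E * kx y + b%:E * (scaled_phi phi s r u y)%:E))).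
  rewrite /tail_mass.
  apply: (@le_trans _ _ (\int[leb]_(y in ~` eball xB r)
      (a%:E * kx y + b%:E * (scaled_phi phi s r u y)%:E))).
    apply: ge0_le_integralW => y; first by rewrite lee_fin (tail_integrand_ge0 G).
    rewrite /eball/= => /negP; rewrite -leNgt => ry.
    rewrite /kx -!EFinM -EFinD lee_fin enormB.
    exact: (tail_integrand_le G).
  by apply: ge0_integral_setS => // y _; rewrite adde_ge0// mule_ge0.
rewrite ge0_integralD//; first last.
- exact: measurable_funeM.
- by move=> y _; rewrite mule_ge0.
- exact: measurable_funeM.
- by move=> y _; rewrite mule_ge0.
rewrite !ge0_integralZl_EFin//.
rewrite lte_add_pinfty// lte_mul_pinfty ?lee_fin// ?scaled_phi_lty//.
by rewrite (le_lt_trans (kernC _ r0))// ltry.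
Qed.

End test_function_space.


(** * The iteration *)

Section iteration_constants.
Context {R : realType}.

(** The radii [rho_j = r b th^j] of the iteration: [th] beats the growth [2^P] of
    the constants from one step to the next, and [b] the constant of the first. *)
Lemma iteration_constants (s C : R) (n P : nat) : 0 < s -> 0 < C ->
  exists b th : R, [/\ 0 < b, b <= 4^-1, 0 < th, th <= 2^-1 &
    (2 ^+ P * th `^ s <= 1) /\ C * 8 ^+ P * b `^ s <= th ^+ n].
Proof.
move=> s0 C0.
have small (x y : R) : 0 < x -> 0 < y -> exists z : R, [/\ 0 < z, z <= x & z `^ s <= y].
  move=> x0 y0; exists (Num.min x (y `^ s^-1)); split.
  - by rewrite lt_min x0 powR_gt0.
  - by rewrite ge_min lexx.
  - have yE : (y `^ s^-1) `^ s = y by rewrite -powRrM mulVf ?gt_eqF// powRr1 ?ltW.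
    rewrite -[leRHS]yE ge0_ler_powR ?(ltW s0)// ?nnegrE ?powR_ge0 ?ge_min ?lexx ?orbT//.
    by rewrite le_min (ltW x0) powR_ge0.
have half0 : 0 < 2^-1 :> R by rewrite invr_gt0.
have quarter0 : 0 < 4^-1 :> R by rewrite invr_gt0.
have P0 : 0 < (2 ^+ P)^-1 :> R by rewrite invr_gt0 exprn_gt0.
have [th [th0 th1 ths]] := small _ _ half0 P0.
have Q0 : 0 < th ^+ n / (C * 8 ^+ P) by rewrite divr_gt0 ?mulr_gt0 ?exprn_gt0.
have [b [b0 b1 bs]] := small _ _ quarter0 Q0.
exists b, th; split => //; split.
  by rewrite mulrC -ler_pdivlMr ?exprn_gt0// mul1r.
by rewrite mulrC -ler_pdivlMr ?mulr_gt0 ?exprn_gt0.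
Qed.

End iteration_constants.

Section iteration.
Context {R : realType} {n N : nat} (phi : R -> R) (q : R) (M : nat).
Local Notation f := (rderiv phi).
Hypothesis G : growth phi f q M.
Hypothesis n0 : (0 < n)%N.
Variables (s r : R) (xB : 'rV[R]_n) (u : 'rV[R]_n -> 'rV[R]_N) (Omega : set 'rV[R]_n).
Hypotheses (s0 : 0 < s) (s1 : s < 1) (r0 : 0 < r).
Variable Ck : R.
Hypothesis Ck0 : 0 < Ck.
Hypothesis kernC : forall (r : R) (x : 'rV[R]_n), 0 < r ->
  (\int[lebesgue_rV]_y (kern (n := n) (Num.min s (1 - s)) r (enorm (x - y)))%:E <= Ck%:E)%E.
Hypothesis uW : Wsphi s phi u.
Hypothesis weak : weak_solution s phi Omega u.
Hypothesis sub : eball xB (2 * r) `<=` Omega.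
Local Notation leb := (@lebesgue_rV R n).
Local Notation E := (energy_on phi s r u).
Local Notation A := (superlevel xB u).
Let u_meas : measurable_fun setT u. Proof. by case: uW => -[[]]. Qed.
Let P := (M.+1 + (M + n.+1))%N.
Let C1 := 8 * (q / 2 * (4 * M%:R) ^+ M * Ck + q * 4 ^+ M * q) / (2 / n%:R) ^+ n.

Lemma energy_on_ge0 B : (0 <= E B)%E.
Proof. by apply: integral_ge0 => x _; rewrite lee_fin (scaled_phi_ge0 G). Qed.

Lemma energy_on_lty B : (E B < +oo)%E.
Proof.
apply: le_lt_trans (scaled_phi_lty G r uW).
by apply: ge0_integral_setS => // x _; rewrite lee_fin (scaled_phi_ge0 G).
Qed.

Variable kap : R.
Hypothesis kap0 : 0 < kap.
Hypothesis tail_kap : ((r `^ s)%:E * tail_mass f s r xB u <= (f kap)%:E)%E.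

Section levels.
Variables (rho k : R).
Hypothesis kk : kap <= r `^ (- s) * k.

Let level_le x : k < enorm (u x) -> kap <= r `^ (- s) * enorm (u x).
Proof. by move=> kx; apply: (le_trans kk); rewrite ler_wpM2l ?powR_ge0// ltW. Qed.

Lemma superlevel_markov : ((phi kap)%:E * leb (A rho k) <= E (A rho k))%E.
Proof.
rewrite -integral_cst; last exact: measurable_superlevel.
apply: ge0_le_integralW => x [_ /= kx].
  by rewrite lee_fin (growth_ge0 G) ?(ltW kap0).
rewrite lee_fin; apply: (growth_mono G); first exact: ltW.
exact: level_le.
Qed.

(** Above the level [kap] the tail is dominated by the slope of [phi] at [u]
    itself, so that its contribution is absorbed by the energy. *)
Lemma superlevel_tail :
  (tail_mass f s r xB u * \int[leb]_(y in A rho k) (enorm (u y))%:E <=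
   q%:E * E (A rho k))%E.
Proof.
have T0 : (0 <= tail_mass f s r xB u)%E.
  by apply: integral_ge0 => y _; rewrite lee_fin (tail_integrand_ge0 G).
have mA := measurable_superlevel xB u_meas rho k.
have q0 : 0 <= q by rewrite (le_trans ler01)// (growth_q1 G).
rewrite -ge0_integralZl//; first last.
- by move=> y _; rewrite lee_fin enorm_ge0.
- by apply/measurable_EFinP; apply: measurable_funTS; exact: measurable_enorm_comp.
rewrite -ge0_integralZl_EFin//; first last.
- by apply/measurable_EFinP; apply: measurable_funTS; exact: (measurable_scaled_phi G).
- by move=> y _; rewrite lee_fin (scaled_phi_ge0 G).
apply: ge0_le_integralW => y [_ /= ky]; first by rewrite mule_ge0// lee_fin enorm_ge0.
have rs0 : 0 < r `^ s by rewrite powR_gt0.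
have b0 : 0 <= r `^ (- s) * enorm (u y) by rewrite mulr_ge0 ?powR_ge0 ?enorm_ge0.
have -> : (tail_mass f s r xB u * (enorm (u y))%:E =
  (r `^ s)%:E * tail_mass f s r xB u * (r `^ (- s) * enorm (u y))%:E)%E.
  rewrite [((r `^ s)%:E * _)%E]muleC -muleA -EFinM; congr (_ * _)%E; congr _%:E.
  by rewrite powRN mulrA divff ?mul1r// gt_eqF.
apply: (@le_trans _ _ ((f kap)%:E * (r `^ (- s) * enorm (u y))%:E)%E).
  by apply: lee_wpmul2r => //; rewrite lee_fin.
rewrite -!EFinM lee_fin; apply: le_trans (growth_f_le G b0).
rewrite ler_wpM2r//; apply: (growth_fmono G); first exact: ltW.
exact: level_le.
Qed.

End levels.

Variables (b th : R).
Hypotheses (b0 : 0 < b) (b4 : b <= 4^-1) (th0 : 0 < th) (th2 : th <= 2^-1).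
Hypotheses (ths : 2 ^+ P * th `^ s <= 1) (bs : C1 * 8 ^+ P * b `^ s <= th ^+ n).
Hypothesis start : (E (eball xB (2 * r)) <=
  (phi kap * (2^-1 * (2 * (r * b) / n%:R) ^+ n))%:E)%E.
Hypothesis phikap : 0 < phi kap.

(* Radii decrease from [2 r] to [r], levels increase from [k / 2] to [k]. *)
Let h (j : nat) : R := 2^-1 ^+ j.
Let rj j := r * (1 + h j).
Let k := 2 * kap * r `^ s.
Let kj j := k * (1 - h j.+1).
Let rhoj j := r * b * th ^+ j.

Let h0 j : 0 < h j. Proof. by rewrite exprn_gt0. Qed.
Let h1 j : h j <= 1. Proof. by rewrite exprn_ile1//; lra. Qed.
Let hS j : h j.+1 = h j / 2. Proof. by rewrite /h exprSr. Qed.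
Let k_gt0 : 0 < k. Proof. by rewrite !mulr_gt0 ?powR_gt0. Qed.
Let rhoj0 j : 0 < rhoj j. Proof. by rewrite !mulr_gt0 ?exprn_gt0. Qed.

Let kap_kj j : kap <= r `^ (- s) * kj j.
Proof.
have rs0 : 0 < r `^ s by rewrite powR_gt0.
rewrite powRN /kj /k (_ : _ * _ = kap * (2 * (1 - h j.+1))); last by field; rewrite gt_eqF.
by rewrite ler_peMr ?(ltW kap0)// hS; move: (h1 j); lra.
Qed.

Let kj0 j : 0 < kj j.
Proof. by rewrite mulr_gt0// hS subr_gt0; move: (h1 j); lra. Qed.

Let superlevel_small j :
  (E (A (rj j) (kj j)) <= (phi kap * (2^-1 * (2 * rhoj j / n%:R) ^+ n))%:E)%E ->
  (leb (A (rj j) (kj j)) <= (2^-1 * (2 * rhoj j / n%:R) ^+ n)%:E)%E.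
Proof.
move=> EA; have := le_trans (superlevel_markov _ (kap_kj j)) EA.
by rewrite EFinM lee_pmul2l// lte_fin.
Qed.

Let decay_step j :
  (E (A (rj j) (kj j)) <= (phi kap * (2^-1 * (2 * rhoj j / n%:R) ^+ n))%:E)%E ->
  (E (A (rj j.+1) (kj j.+1)) <= (th ^+ n)%:E * E (A (rj j) (kj j)))%E.
Proof.
(* The gap [rj j - rj j.+1] is [h j / 2 * r], twice the width [de * r]. *)
move=> EA; pose de := h j / 4.
have de0 : 0 < de by rewrite divr_gt0.
have de1 : de <= 1 by rewrite ler_pdivrMr//; move: (h1 j); lra.
have rr1 : r <= rj j.+1 by rewrite /rj ler_peMr ?(ltW r0)// lerDl ltW.
have r12 : rj j.+1 + 2 * (de * r) <= rj j.
  by rewrite le_eqVlt; apply/orP; left; apply/eqP; rewrite /rj /de hS; field.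
have r22 : rj j <= 2 * r by rewrite /rj mulrC ler_wpM2r ?(ltW r0)//; move: (h1 j); lra.
have k12 : kj j <= (1 - de) * kj j.+1.
  rewrite /kj !hS mulrCA ler_wpM2l ?(ltW k_gt0)//.
  by move: (h0 j) (h1 j); rewrite /de; nra.
have rhor : rhoj j <= de * r.
  rewrite /rhoj /de -mulrA [leRHS]mulrC ler_wpM2l ?(ltW r0)// [leRHS]mulrC.
  apply: ler_pM; rewrite ?exprn_ge0 ?(ltW th0) ?(ltW b0)//.
  by rewrite lerXn2r// ?nnegrE ?(ltW th0).
have psiW : Wsphi_c s phi Omega (test_fun M r xB u (rj j.+1) de (kj j)).
  exact: (test_fun_Wsphi_c G n0 s0 s1 r0 kernC uW de0 de1 (kj0 j) r12 r22 sub).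
have := energy_decay G n0 s0 s1 r0 u_meas Ck0 kernC de0 de1 rr1 r12 r22 (kj0 j) (kj0 j.+1)
  k12 (rhoj0 j) rhor (superlevel_small EA) (energy_on_lty _)
  (superlevel_tail _ (kap_kj j)) (weak psiW).
move=> /le_trans; apply; apply: lee_wpmul2r; first exact: energy_on_ge0.
rewrite lee_fin -/C1 -/P.
have -> : 2 / de = 8 * 2 ^+ j.
  have h20 : (2 : R) ^+ j != 0 by rewrite gt_eqF// exprn_gt0.
  by rewrite /de /h exprVn; field.
have -> : rhoj j / r = b * th ^+ j by rewrite /rhoj; field; rewrite gt_eqF.
have thX : (th ^+ j) `^ s = (th `^ s) ^+ j.
  elim: (j) => [|i IH]; first by rewrite !expr0 powR1.
  by rewrite !exprS powRM ?exprn_ge0 ?(ltW th0)// IH.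
rewrite powRM ?exprn_ge0 ?(ltW th0) ?(ltW b0)// thX exprMn -exprM mulnC exprM.
have -> : C1 * (8 ^+ P * (2 ^+ P) ^+ j) * (b `^ s * (th `^ s) ^+ j) =
  (C1 * 8 ^+ P * b `^ s) * (2 ^+ P * th `^ s) ^+ j by rewrite [in RHS]exprMn; ring.
apply: le_trans bs; rewrite ler_piMr//; last first.
  by rewrite exprn_ile1 ?mulr_ge0 ?exprn_ge0 ?powR_ge0.
have q0 : 0 <= q by rewrite (le_trans ler01)// (growth_q1 G).
have C10 : 0 <= C1.
  by rewrite /C1 divr_ge0 ?exprn_ge0 ?divr_ge0 ?mulr_ge0 ?addr_ge0 ?mulr_ge0
    ?exprn_ge0 ?mulr_ge0 ?(ltW Ck0).
by apply: mulr_ge0; [apply: mulr_ge0; [exact: C10|exact: exprn_ge0]|exact: powR_ge0].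
Qed.

Let energy_geometric j :
  (E (A (rj j) (kj j)) <= (phi kap * (2^-1 * (2 * rhoj j / n%:R) ^+ n))%:E)%E.
Proof.
elim: j => [|j IH].
  have -> : rhoj 0 = r * b by rewrite /rhoj expr0 mulr1.
  apply: le_trans start; apply: ge0_integral_setS => [x [+ _]|x _].
    by rewrite /rj /h expr0 -[1 + 1]/(2 : R) mulrC.
  by rewrite lee_fin (scaled_phi_ge0 G).
apply: (le_trans (decay_step IH)).
apply: (@le_trans _ _ ((th ^+ n)%:E * (phi kap * (2^-1 * (2 * rhoj j / n%:R) ^+ n))%:E)%E).
  by apply: lee_wpmul2l => //; rewrite lee_fin exprn_ge0// ltW.
rewrite -EFinM lee_fin le_eqVlt; apply/orP; left; apply/eqP.
have -> : 2 * rhoj j.+1 / n%:R = th * (2 * rhoj j / n%:R) by rewrite /rhoj exprS; ring.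
by rewrite [in RHS]exprMn; ring.
Qed.

(** The energies are at most [phi kap] times half the measure of cubes inscribed
    in the balls of radius [rhoj j].  This smallness is what makes the step
    applicable, and the choice of [b] and [th] reproduces it; so the measures of
    the super-level sets tend to zero. *)
Lemma superlevel_null : leb (A r k) = 0%E.
Proof.
apply/eqP; rewrite eq_le measure_ge0 andbT; apply/lee_addgt0Pr => e e0.
rewrite add0e.
pose c := 2^-1 * (2 * (r * b) / n%:R) ^+ n.
have c0 : 0 <= c by rewrite mulr_ge0 ?exprn_ge0 ?divr_ge0 ?mulr_ge0 ?(ltW r0) ?(ltW b0).
have [j jP] : exists j, c * th ^+ j <= e.
  have : (fun j => th ^+ j) @ \oo --> 0.
    by apply: cvg_expr; rewrite ger0_norm ?(ltW th0)//; move: th2; lra.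
  have e1 : 0 < e / (c + 1) by rewrite divr_gt0// ltr_wpDl.
  move=> /cvgr_le/(_ _ e1) [j _ /(_ j (leqnn j)) /= jP]; exists j.
  apply: (@le_trans _ _ ((c + 1) * th ^+ j)).
    by rewrite ler_wpM2r ?exprn_ge0 ?(ltW th0)// lerDl.
  by rewrite mulrC -ler_pdivlMr// ltr_wpDl.
apply: (@le_trans _ _ (leb (A (rj j) (kj j)))).
  apply: le_measure; rewrite ?inE; [exact: measurable_superlevel..|].
  move=> x [/= xr kx]; split.
    by rewrite /eball/= (lt_le_trans xr)// /rj ler_peMr ?(ltW r0)// lerDl ltW.
  by rewrite /= (le_lt_trans _ kx)// /kj ler_piMr ?(ltW k_gt0)// gerBl ltW.
apply: (le_trans (superlevel_small (energy_geometric j))).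
rewrite lee_fin (le_trans _ jP)//.
have -> : 2 * rhoj j / n%:R = 2 * (r * b) / n%:R * th ^+ j by rewrite /rhoj; ring.
rewrite exprMn [2^-1 * _]mulrA -/c ler_wpM2l//.
have [m ->] : exists m, n = m.+1 by case: (n) n0 => // m; exists m.
rewrite exprS ler_piMr ?exprn_ge0 ?(ltW th0)// exprn_ile1 ?exprn_ge0 ?(ltW th0)//.
by rewrite exprn_ile1 ?(ltW th0)//; move: th2; lra.
Qed.

End iteration.


(** * The local bound *)

Section essential_sup.
Context {R : realType} {n N : nat}.

Lemma ess_sup_on_le (D : set 'rV[R]_n) (g : 'rV[R]_n -> \bar R) (y : \bar R) Z :
  measurable Z -> lebesgue_rV Z = 0%E -> (forall x, D x -> ~ Z x -> (g x <= y)%E) ->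
  (ess_sup_on D g <= y)%E.
Proof.
move=> mZ Z0 gy; apply: ereal_inf_lbound => /=.
exists Z; split => // x /= /not_implyP [Dx gx].
by apply: contrapT => nZ; apply: gx; exact: gy.
Qed.

End essential_sup.

Section choice_of_level.
Context {R : realType} {phi f : R -> R} {q : R} {M : nat}.
Hypothesis G : growth phi f q M.
Hypothesis unbounded : forall X, exists2 t, 0 < t & X <= phi t.

(** Halving the argument until [phi] drops below [X] stops, by doubling, at a
    level where [phi] is comparable to [X]. *)
Lemma growth_level (X g : R) : 0 < X -> 0 <= g ->
  exists kap, [/\ 0 < kap, g < kap, X <= phi kap & phi kap <= 2 ^+ M * (X + phi g)].
Proof.
move=> X0 g0; have [t t0 Xt] := unbounded X.
have [k [k0 Xk kX]] : exists k, [/\ 0 < k, X <= phi k & phi k <= 2 ^+ M * X].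
  have ex : exists i, phi (2^-1 ^+ i * t) < X.
    have : (fun i => (2^-1 : R) ^+ i) @ \oo --> 0.
      by apply: cvg_expr; rewrite ger0_norm; lra.
    have phit : 0 < phi t by exact: lt_le_trans Xt.
    have e0 : 0 < X / phi t by rewrite divr_gt0.
    move=> /cvgr_lt/(_ _ e0) [i _ /(_ i (leqnn i)) /= iP]; exists i.
    apply: (@le_lt_trans _ _ (2^-1 ^+ i * phi t)).
      by apply: (growth_sublinear G); rewrite ?exprn_ge0 ?exprn_ile1 ?(ltW t0)//; lra.
    by rewrite -ltr_pdivlMr.
  case: (ex_minnP ex) => -[|i]; first by rewrite expr0 mul1r ltNge Xt.
  move=> iX imin; exists (2^-1 ^+ i * t); split.
  - by rewrite mulr_gt0 ?exprn_gt0.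
  - by rewrite leNgt; apply/negP => /imin; rewrite ltnn.
  - have -> : 2^-1 ^+ i * t = 2 * (2^-1 ^+ i.+1 * t) by rewrite exprS; field.
    have it0 : 0 <= 2^-1 ^+ i.+1 * t by rewrite mulr_ge0 ?exprn_ge0 ?(ltW t0).
    apply: (le_trans (growth_double G it0)).
    by rewrite ler_wpM2l ?exprn_ge0// ltW.
exists (Num.max k (2 * g)); split.
- by rewrite lt_max k0.
- move: g0; rewrite le_eqVlt lt_max => /predU1P[<-|g0]; first by rewrite k0.
  by apply/orP; right; lra.
- by apply: (le_trans Xk); apply: (growth_mono G); rewrite ?(ltW k0)// le_max lexx.
- have pg : 0 <= phi g by exact: (growth_ge0 G).
  rewrite mulrDr; have [kg|kg] := leP k (2 * g).
    apply: (le_trans (growth_double G g0)); rewrite lerDr.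
    by rewrite mulr_ge0 ?exprn_ge0// ltW.
  by apply: (le_trans kX); rewrite lerDl mulr_ge0 ?exprn_ge0.
Qed.

End choice_of_level.

(** [rderiv phi t >= phi t / t] is unbounded, so the infimum is over a nonempty
    set; above it the slope has already reached [tau]. *)
Lemma ginv_fin {R : realType} (phi : R -> R) (tau : R) : N_function phi ->
  exists2 g, ginv (rderiv phi) tau%:E = g%:E &
    0 <= g /\ forall kap, g < kap -> tau <= rderiv phi kap.
Proof.
move=> Nphi; pose S := [set t%:E | t in [set t | 0 <= t /\ (tau%:E < (rderiv phi t)%:E)%E]].
have S0 : lbound S 0%E by move=> _ [t [t0 _] <-]; rewrite lee_fin.
have [t St] : exists t, S t%:E.
  have /cvgryPge/(_ (tau + 1)) := N_function_cvgy Nphi.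
  move=> H; near (+oo_R : set_system R) => t.
  have t1 : 1 <= t by near: t; exact: nbhs_pinfty_ge.
  exists t, t => //; split; first lra.
  rewrite lte_fin; have : tau + 1 <= phi t / t by near: t.
  have t0 : 0 < t by lra.
  have := @N_function_le_rderiv _ _ Nphi t (ltW t0).
  rewrite -ler_pdivrMr//; lra.
have g0 : (0 <= ereal_inf S)%E by exact: le_ereal_inf_tmp.
have gt : (ereal_inf S <= t%:E)%E by exact: ereal_inf_lbound.
rewrite /ginv -/S; move: g0 gt; case E : (ereal_inf S) => [g| |]//.
rewrite lee_fin => g0 _; exists g => //; split => // kap gk.
have Sk : (ereal_inf S < kap%:E)%E by rewrite E lte_fin.
have [_ [w [w0 tw] <-] wk] := ereal_inf_lt Sk.
rewrite lte_fin in tw; rewrite lte_fin in wk.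
by apply: (le_trans (ltW tw)); apply: rderiv_mono => //; exact: ltW.
Unshelve. all: by end_near. Qed.

Unset Implicit Arguments.

Theorem theorem1p2 (R : realType) (n : nat) (s q : R) :
  (0 < n)%N -> 0 < s -> s < 1 ->
  exists c : R, 0 < c /\
    forall (N : nat) (Omega : set 'rV[R]_n) (xB : 'rV[R]_n) (r : R)
           (phi : R -> R) (p : R) (u : 'rV[R]_n -> 'rV[R]_N),
      (0 < N)%N ->
      open Omega -> bounded_set Omega ->
      0 < r -> eball xB (2 * r) `<=` Omega ->
      N_function phi ->
      simonenko_lower phi = p%:E -> simonenko_upper phi = q%:E ->
      1 <= p -> p <= q ->
      Wsphi s phi u -> weak_solution s phi Omega u ->
      Linfty (eball xB r) u /\
      (ess_sup_on (eball xB r) (fun x => (phi (r `^ (- s) * enorm (u x)))%:E)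
       <= c%:E * ((lebesgue_rV (eball xB (2 * r)))^-1
                  * \int[lebesgue_rV]_(x in eball xB (2 * r))
                      (phi (r `^ (- s) * enorm (u x)))%:E)
          + c%:E * ephi phi ((r `^ (- s))%:E * tail s phi u xB r))%E.
Proof.
move=> n0 s0 s1; have [q1|q1] := ltP q 1.
  by exists 1; split => // *; exfalso; lra.
have [M GM] := N_function_growth q1.
have bet0 : 0 < Num.min s (1 - s) by rewrite lt_min s0 subr_gt0.
have [Ck Ck0 kernC] := @integral_kern_le R n _ n0 bet0.
have nR : 0 < n%:R :> R by rewrite ltr0n.
have q0 : 0 < q by lra.
have C0 : 0 < 8 * (q / 2 * (4 * M%:R) ^+ M * Ck + q * 4 ^+ M * q) / (2 / n%:R) ^+ n.
  rewrite divr_gt0 ?exprn_gt0 ?divr_gt0// mulr_gt0// ltr_wpDl//.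
    by rewrite !mulr_ge0 ?exprn_ge0 ?mulr_ge0 ?(ltW Ck0) ?(ltW q0).
  by rewrite !mulr_gt0 ?exprn_gt0.
have [b [th [b0 b4 th0 th2 [ths bs]]]] :=
  iteration_constants n (M.+1 + (M + n.+1)) s0 C0.
(* [cX] compares the measure of the ball of radius [2 r], at most [(4 r)^n], with
   the threshold [cb] below. *)
pose K : R := 2 ^+ M.
pose cX : R := 2 * (2 * n%:R / b) ^+ n.
have K0 : 0 < K by rewrite exprn_gt0.
have cX0 : 0 < cX by rewrite mulr_gt0 ?exprn_gt0 ?divr_gt0 ?mulr_gt0.
exists (K * K * (cX + 1)); split; first by rewrite !mulr_gt0// addr_gt0.
move=> N Omega xB r phi p u _ _ _ r0 sub Nphi lo up p1 pq uW weak.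
have [G phi_gt0] := GM phi p Nphi lo up p1.
have u_meas : measurable_fun setT u by case: uW => -[[]].
have rs0 : 0 < r `^ s by rewrite powR_gt0.
pose f := rderiv phi.
have [T TE] : exists T, tail_mass f s r xB u = T%:E.
  have := tail_mass_lty G xB s0 s1 r0 kernC uW.
  have : (0 <= tail_mass f s r xB u)%E.
    by apply: integral_ge0 => y _; rewrite lee_fin (tail_integrand_ge0 G).
  by rewrite /f; case: (tail_mass _ s r xB u) => [T| |]// _ _; exists T.
have [g gE [g0 gP]] := ginv_fin (r `^ s * T) Nphi.
have tailE : tail s phi u xB r = (r `^ s * g)%:E.
  rewrite /tail -/(tail_integrand f s xB u) EFinM -gE EFinM -TE //.
have [e EE e0] : exists2 e, energy_on phi s r u (eball xB (2 * r)) = e%:E & 0 <= e.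
  have := energy_on_lty G r uW (eball xB (2 * r)).
  have := energy_on_ge0 G s r u (eball xB (2 * r)).
  by case: (energy_on _ _ _ _ _) => [e| |]//; rewrite lee_fin => e0 _; exists e.
have r20 : 0 < 2 * r by rewrite mulr_gt0.
have [v vE [v0 v4]] : exists2 v, lebesgue_rV (eball xB (2 * r)) = v%:E &
    0 < v /\ v <= (4 * r) ^+ n.
  have := lebesgue_eball_le xB r20; have := lebesgue_eball_ge xB n0 r20.
  case: (lebesgue_rV _) => [v| |]//; rewrite !lee_fin => h1 h2; exists v => //.
  split; last by move: h2; rewrite mulrA -natrM.
  by apply: lt_le_trans h1; rewrite exprn_gt0 ?divr_gt0 ?mulr_gt0.
pose cb := 2^-1 * (2 * (r * b) / n%:R) ^+ n.
have cb0 : 0 < cb by rewrite mulr_gt0 ?exprn_gt0 ?divr_gt0 ?mulr_gt0.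
have Xe : e / cb <= cX * (e / v).
  rewrite mulrCA ler_wpM2l// ler_pdivlMr// mulrC ler_pdivrMr//.
  rewrite (le_trans v4)// le_eqVlt; apply/orP; left; apply/eqP.
  rewrite /cX /cb mulrACA mulfV// mul1r -exprMn; congr (_ ^+ _).
  by field; rewrite !gt_eqF.
(* [eps] keeps the level positive when the energy and the tail vanish. *)
have level eps : 0 < eps -> exists kap, [/\ 0 < kap,
    phi kap <= K * (e / cb + eps + phi g) &
    lebesgue_rV (superlevel xB u r (2 * kap * r `^ s)) = 0%E].
  move=> eps0; have X0 : 0 < e / cb + eps by rewrite ltr_wpDl// divr_ge0// ltW.
  have [kap [kap0 gk Xk kX]] := growth_level G (N_function_unbounded Nphi) X0 g0.
  exists kap; split => //.
  apply: (superlevel_null G n0 s0 s1 r0 Ck0 kernC uW weak sub kap0 _ b0 b4 th0 th2 ths bs).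
  - by rewrite TE -EFinM lee_fin; exact: gP.
  - rewrite EE lee_fin -ler_pdivrMr//; apply: le_trans Xk.
    by rewrite lerDl ltW.
  - exact: phi_gt0.
have mZ kap := measurable_superlevel xB u_meas r (2 * kap * r `^ s).
have below kap x : eball xB r x -> ~ superlevel xB u r (2 * kap * r `^ s) x ->
    enorm (u x) <= 2 * kap * r `^ s.
  by move=> xr nZ; rewrite leNgt; apply/negP => h; apply: nZ; split.
split.
  split; first exact: measurable_funTS.
  have [kap [kap0 _ Z0]] := level 1 ltr01.
  apply: (@le_lt_trans _ _ (2 * kap * r `^ s)%:E); last exact: ltry.
  by apply: (ess_sup_on_le (mZ kap) Z0) => x xr nZ; rewrite lee_fin; exact: below nZ.
have gE' : ((r `^ (- s))%:E * (r `^ s * g)%:E = g%:E)%E.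
  by rewrite -EFinM powRN mulKf ?gt_eqF.
rewrite tailE gE' /= vE.
rewrite [X in (_ * (_ * X))%E](_ : _ = e%:E); last exact: EE.
rewrite inver gt_eqF// -!EFinM -EFinD.
apply/lee_addgt0Pr => eps eps0; rewrite -EFinD.
have KK : 0 < K * K by rewrite mulr_gt0.
have [kap [kap0 kX Z0]] := level (eps / (K * K)) (divr_gt0 eps0 KK).
apply: (ess_sup_on_le (mZ kap) Z0) => x xr nZ; rewrite lee_fin.
have ux := below kap x xr nZ.
apply: (@le_trans _ _ (phi (2 * kap))).
  apply: (growth_mono G); first by rewrite mulr_ge0 ?powR_ge0 ?enorm_ge0.
  by rewrite powRN ler_pdivrMl// mulrC.
apply: (le_trans (growth_double G (ltW kap0))).
apply: (@le_trans _ _ (K * (K * (e / cb + eps / (K * K) + phi g)))).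
  by rewrite ler_wpM2l ?exprn_ge0.
have -> : K * (K * (e / cb + eps / (K * K) + phi g)) =
    K * K * (e / cb) + K * K * phi g + eps by field; rewrite !gt_eqF.
rewrite lerD2r lerD//.
  rewrite -!mulrA ler_wpM2l ?(ltW K0)// ler_wpM2l ?(ltW K0)//.
  have ev : 0 <= e / v by rewrite divr_ge0// ltW.
  by rewrite [v^-1 * e]mulrC; apply: (le_trans Xe); rewrite ler_wpM2r// lerDl.
have pg : 0 <= phi g by rewrite (growth_ge0 G).
by rewrite ler_wpM2r// ler_peMr ?(ltW KK)// lerDr ltW.
Qed.
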